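(* Let $j\in\{1,\dots,n\}$ and consider a family in prenormal form $(x^2-\epsilon)y'=B(\epsilon,x)y$, with $r$ and then $\rho$ sufficiently small, such that for all $\hat\epsilon\in S$ both unfolded Stokes matrices $\hat C_R$ and $\hat C_L$ have trivial $j$-th column (i.e. equal to the $j$-th column of the identity matrix). Then the family is analytically equivalent to a family in prenormal form with an invariant subsystem formed by the equations $i\ne j$, i.e. one whose matrix has zero $(i,j)$ entries for all $i\neq j$.
   Context: Systems. A family in prenormal form is a family $(x^2-\epsilon)y'=B(\epsilon,x)y$, $y\in\mathbb{C}^n$, $n\ge2$, $'=d/dx$, with $B=\Lambda(\epsilon,x)+(x^2-\epsilon)R(\epsilon,x)$, $\Lambda(\epsilon,x)=\mathrm{diag}\{\lambda_1(\epsilon,x),\dots,\lambda_n(\epsilon,x)\}=\Lambda_0(\epsilon)+\Lambda_1(\epsilon)x$, $\Lambda_0,\Lambda_1$ diagonal and analytic in $\epsilon$ near $0$, $R$ a matrix of germs of analytic functions of $(\epsilon,x)$ at the origin, and $\Re(\lambda_q(0,0)-\lambda_j(0,0))>0$ for $q<j$. Model system: $(x^2-\epsilon)z'=\Lambda(\epsilon,x)z$. Parameter sector. Let $\theta_0$ be the largest angle (supremum) in $(0,\frac\pi2)$ with $\Re(e^{\pm i\theta_0}(\lambda_q(0,0)-\lambda_j(0,0)))\ge0$ for $q<j$. Fix $\gamma>0$ with $\gamma(1+\frac{2\gamma}{\pi})<\theta_0$ and let $S=\{\hat\epsilon:0<|\hat\epsilon|<\rho,\ \arg\hat\epsilon\in(\pi-2\gamma,3\pi+2\gamma)\}$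 (on the universal covering of $\mathbb{C}^*$; $\epsilon$ is the projection of $\hat\epsilon$). Put $\arg\sqrt{\hat\epsilon}=\frac12\arg\hat\epsilon$, $\hat x_L=\sqrt{\hat\epsilon}$, $\hat x_R=-\sqrt{\hat\epsilon}$. The radius $\rho>0$ is small, in particular so that for some $C>0$, $\Re(e^{\pm i\gamma(1+2\gamma/\pi)}(\lambda_q(\epsilon,\hat x_l)-\lambda_j(\epsilon,\hat x_l)))>C$ for $q<j$, $l=L,R$, $\hat\epsilon\in S$. $S_\cap$ is the auto-intersection of $S$: it consists of the pairs $\bar\epsilon$, $\tilde\epsilon=\bar\epsilon e^{2\pi i}$ both in $S$. Sectorial domains. Fix $r>0$ small, $\mathbb{D}_r=\{|x|<r\}$, $\delta>0$ small, $\Omega_D=\{|x|<r,\,-(\pi+\delta)<\arg x<\delta\}$, $\Omega_U=\{|x|<r,\,-\delta<\arg x<\pi+\delta\}$, such that the closure of $\Omega_D$ (resp. $\Omega_U$) contains no ray $\Re((\lambda_q(0,0)-\lambda_j(0,0))/x)=0$, $q\ne j$, of the upper (resp. lower) half-plane. Use the time $t$ of $\dot x=x^2-\epsilon$: $x(t)=-\sqrt{\hat\epsilon}\coth(\sqrt{\hat\epsilon}\,t)$ if $\epsilon\neq0$ (period $\pi i/\sqrt{\hat\epsilon}$), $x(t)=-1/t$ if $\epsilon=0$. Fix small constants $c_0>0$, $h\in(0,1/r)$, $\kappa\in(0,\frac12)$ independent of $\hat\epsilon$. Let $N_{\hat\epsilon}$ be the connected component containing $t=0$ of $\{t:|x(t)|\ge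 r\}$, $P=-\pi i/\sqrt{\hat\epsilon}$, $\hat\theta=\frac{2\gamma}{\pi}(\pi-\arg\sqrt{\hat\epsilon})$, and $\sigma(u)=0$ if $|u|\le c_0/\sqrt{|\epsilon|}$, $\sigma(u)=(u-\mathrm{sgn}(u)c_0/\sqrt{|\epsilon|})\tan\hat\theta$ otherwise. $\Gamma_D^{\hat\epsilon}$ is the set of $t\notin N_{\hat\epsilon}$ with $\Im t<h+\sigma(\Re t)$ lying above the line $-(\frac12+\kappa)P+\mathbb{R}e^{i\hat\theta}$; $\Gamma_U^{\hat\epsilon}$ is the set of $t\notin N_{\hat\epsilon}$ with $\Im t>-h+\sigma(\Re t)$ lying below the line $(\frac12+\kappa)P+\mathbb{R}e^{i\hat\theta}$. $\Omega_s^{\hat\epsilon}=x(\Gamma_s^{\hat\epsilon})$, $s=D,U$. $\Omega_D^{\hat\epsilon}\cap\Omega_U^{\hat\epsilon}$ has three connected components $\Omega_L^{\hat\epsilon},\Omega_R^{\hat\epsilon},\Omega_C^{\hat\epsilon}$, images of the right and left components of $\Gamma_D^{\hat\epsilon}\cap\Gamma_U^{\hat\epsilon}$ and of $\Gamma_D^{\hat\epsilon}\cap(\Gamma_U^{\hat\epsilon}-P)$; their closures contain respectively $\hat x_L$, $\hat x_R$, and both; $0\in\Omega_C^{\hat\epsilon}$. Model solutions. For $l=L,R$, $\mathcal U_l=\frac1{2\hat x_l}\Lambda(\epsilon,\hat x_l)$. $F(\epsilon,x)=(x-\hat x_R)^{\mathcal U_R}(x-\hat x_L)^{\mathcal U_L}$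 is a fundamental matrix of the model. $F_D(\hat\epsilon,\cdot)$ is its branch on $\Omega_D^{\hat\epsilon}$ (namely $e^{t\Lambda_0}(x^2-\epsilon)^{\Lambda_1/2}$ with $x=x(t)$, $t\in\Gamma_D^{\hat\epsilon}$, converging as $\hat\epsilon\to0$ to $x^{\Lambda_1(0)}e^{-\Lambda_0(0)/x}$ with $-(\pi+\delta)<\arg x<\delta$), and $F_U(\hat\epsilon,\cdot)$ is the analytic continuation of $F_D$ to $\Omega_U^{\hat\epsilon}$ through $\Omega_R^{\hat\epsilon}$. Unfolded Stokes matrices. $H_s(\hat\epsilon,x)$, $s=D,U$, are matrices, analytic for $\hat\epsilon\in S$, $x\in\Omega_s^{\hat\epsilon}$, such that $W_s=H_sF_s$ is a fundamental matrix of solutions of the family on $\Omega_s^{\hat\epsilon}$; $\lim_{x\to\hat x_l,x\in\Omega_s^{\hat\epsilon}}H_s(\hat\epsilon,x)$ ($l=L,R$) is an invertible diagonal matrix independent of $s$, analytic in $\hat\epsilon\in S$ with nonsingular limit at $\epsilon=0$; $|H_s(\bar\epsilon,0)-H_s(\tilde\epsilon,0)|\le c|\bar\epsilon|$ on $S_\cap$ for some $c\ge0$; and $|H_s(\hat\epsilon,0)|$, $|H_s(\hat\epsilon,0)^{-1}|$ are bounded on $S_\cap$. The unfolded Stokes matrices $\hat C_R$ (upper triangular unipotent) and $\hat C_L$ (lower triangular unipotent) are defined by $H_D^{-1}H_U=F_D\hat C_RF_D^{-1}$ on $\Omega_R^{\hat\epsilon}$, $H_D^{-1}H_U=F_D\hat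 C_LF_D^{-1}$ on $\Omega_L^{\hat\epsilon}$ (and $H_D^{-1}H_U=I$ on $\Omega_C^{\hat\epsilon}$). They are unique up to simultaneous conjugation by an invertible diagonal matrix. Two families are (locally) analytically equivalent if an invertible matrix $P_1(\epsilon,x)$ of germs of analytic functions of $(\epsilon,x)$ at the origin exists such that $y=P_1(\epsilon,x)z$ transforms one into the other. *)

(* Defs.v *)
From HB Require Import structures.
From mathcomp Require Import all_boot all_order all_algebra.
From mathcomp Require Import all_classical all_reals all_analysis.
From mathcomp Require Import complex.

Set Implicit Arguments.
Unset Strict Implicit.
Unset Printing Implicit Defensive.

Import Order.TTheory GRing.Theory Num.Theory.
Import numFieldNormedType.Exports.

Local Open Scope classical_set_scope.
Local Open Scope complex_scope.
Local Open Scope ring_scope.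

Local Notation Re := complex.Re.
Local Notation Im := complex.Im.

(* R[i] as a normed module over itself (the norm of R[i] is R[i]-valued). *)
HB.instance Definition _ (R : rcfType) := NormedModule.copy R[i] R[i]^o.

Definition cexp {R : realType} (z : R[i]) : R[i] :=
  (expR (Re z) * cos (Im z)) +i* (expR (Re z) * sin (Im z)).

Definition cis {R : realType} (a : R) : R[i] := cos a +i* sin a.

Definition ccosh {R : realType} (z : R[i]) : R[i] :=
  (cexp z + cexp (- z)) / 2%:R.

Definition csinh {R : realType} (z : R[i]) : R[i] :=
  (cexp z - cexp (- z)) / 2%:R.

Definition analytic_at {R : realType} (f : R[i] -> R[i]) (a : R[i]) : Prop :=
  exists c : nat -> R[i], \forall x \near a,
    series (fun k => c k * (x - a) ^+ k) @ \oo --> f x.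

(* Sum of an absolutely convergent double power series on a polydisc. *)
Definition analytic2_at {R : realType} (f : R[i] -> R[i] -> R[i])
    (a b : R[i]) : Prop :=
  exists (c : nat -> nat -> R[i]) (s M : R),
    [/\ 0 < s,
        forall N, \sum_(k < N) \sum_(l < N) `|c k l| * s%:C ^+ (k + l) <= M%:C
      & forall x y, `|x - a| < s%:C -> `|y - b| < s%:C ->
          (fun N : nat => \sum_(k < N) \sum_(l < N)
             c k l * (x - a) ^+ k * (y - b) ^+ l) @ \oo --> f x y].

Definition mx_analytic2_at {R : realType} {m n : nat}
    (A : R[i] -> R[i] -> 'M[R[i]]_(m, n)) (a b : R[i]) : Prop :=
  forall i k, analytic2_at (fun x y => A x y i k) a b.

(* Lambda(e,x) = diag (lam0 e + x lam1 e), and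
   B(e,x) = Lambda(e,x) + (x^2 - e) remx(e,x).  Only the germs of lam0, lam1 at
   0 and of remx at the origin matter. *)
Record ode_family (R : realType) (n : nat) := Family {
  lam0 : R[i] -> 'rV[R[i]]_n;
  lam1 : R[i] -> 'rV[R[i]]_n;
  remx : R[i] -> R[i] -> 'M[R[i]]_n }.

Definition lam {R : realType} {n} (Y : ode_family R n) (e x : R[i]) :
  'rV[R[i]]_n := lam0 Y e + x *: lam1 Y e.

Definition sysmx {R : realType} {n} (Y : ode_family R n) (e x : R[i]) :
  'M[R[i]]_n := diag_mx (lam Y e x) + (x ^+ 2 - e) *: remx Y e x.

Definition lam_diff {R : realType} {n} (Y : ode_family R n) (e x : R[i])
  (q j : 'I_n) : R[i] := lam Y e x 0 q - lam Y e x 0 j.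

Definition prenormal {R : realType} {n} (Y : ode_family R n) : Prop :=
  [/\ forall i, analytic_at (fun e => lam0 Y e 0 i) 0,
      forall i, analytic_at (fun e => lam1 Y e 0 i) 0,
      mx_analytic2_at (remx Y) 0 0
    & forall q j : 'I_n, (q < j)%N -> 0 < Re (lam_diff Y 0 0 q j)].

(* y = T(e,x) z turns (x^2-e) y' = B y into (x^2-e) z' = B1 z, i.e.
   (x^2-e) T' + T B1 = B T near the origin. *)
Definition analytically_equivalent {R : realType} {n}
    (Y Z : ode_family R n) : Prop :=
  exists T : R[i] -> R[i] -> 'M[R[i]]_n,
    [/\ mx_analytic2_at T 0 0, T 0 0 \in unitmx
      & \forall p \near ((0, 0) : R[i] * R[i]),
          (p.2 ^+ 2 - p.1) *: 'D_1 (T p.1) p.2 + T p.1 p.2 *m sysmx Z p.1 p.2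
          = sysmx Y p.1 p.2 *m T p.1 p.2].

Definition theta0 {R : realType} {n} (Y : ode_family R n) : R :=
  sup [set th : R | [/\ 0 < th, th < pi / 2
    & forall q j : 'I_n, (q < j)%N ->
        0 <= Re (cis th * lam_diff Y 0 0 q j) /\
        0 <= Re (cis (- th) * lam_diff Y 0 0 q j)]].

Record constants (R : realType) := Constants {
  cgam : R; crad : R; cdel : R; cc0 : R; ch : R; ckap : R; crho : R }.

(* A point \hat\epsilon of the universal covering of C^* is represented by its
   logarithm w, so |\hat\epsilon| = exp (Re w), arg \hat\epsilon = Im w,
   multiplication by e^{2 pi i} is w |-> w + 2 pi i, and analyticity in
   \hat\epsilon is analyticity in w. *)
Definition sector {R : realType} (g rho : R) : set R[i] :=
  [set w | [/\ expR (Re w) < rho, pi - 2 * g < Im w & Im w < 3 * pi + 2 * g]].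

Definition csector {R : realType} (K : constants R) : set R[i] :=
  sector (cgam K) (crho K).

(* the filter "\hat\epsilon -> 0 inside the sector" *)
Definition sector_to0 {R : realType} (g : R) : set_system R[i] :=
  filter_from [set rho : R | 0 < rho] (sector g).

Definition turn {R : realType} (w : R[i]) : R[i] := w + (2 * pi) *i.

Definition eps {R : realType} (w : R[i]) : R[i] := cexp w.
Definition sqeps {R : realType} (w : R[i]) : R[i] := cexp (w / 2%:R).
Definition xL {R : realType} (w : R[i]) : R[i] := sqeps w.
Definition xR {R : realType} (w : R[i]) : R[i] := - sqeps w.

Definition sector_gap {R : realType} {n} (Y : ode_family R n) (K : constants R) :
    Prop :=
  let a := cgam K * (1 + 2 * cgam K / pi) in
  exists2 C : R, 0 < C & forall w (q j : 'I_n), csector K w -> (q < j)%N ->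
    forall x, x = xL w \/ x = xR w ->
      C < Re (cis a * lam_diff Y (eps w) x q j) /\
      C < Re (cis (- a) * lam_diff Y (eps w) x q j).

Definition polar {R : realType} (m a : R) : R[i] := m%:C * cis a.

Definition Omega0_D {R : realType} (r d : R) : set R[i] :=
  [set x | exists m a : R,
     [/\ 0 < m < r, - (pi + d) < a < d & x = polar m a]].
Definition Omega0_U {R : realType} (r d : R) : set R[i] :=
  [set x | exists m a : R,
     [/\ 0 < m < r, - d < a < pi + d & x = polar m a]].

Definition ray {R : realType} (r a : R) : set R[i] :=
  [set x | exists2 s : R, 0 < s < r & x = polar s a].

Definition separating {R : realType} {n} (Y : ode_family R n) (a : R) : Prop :=
  exists q j : 'I_n, q != j /\ Re (lam_diff Y 0 0 q j / cis a) = 0.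

Definition sectors_avoid_rays {R : realType} {n} (Y : ode_family R n) (r d : R) :
    Prop :=
  (forall a, 0 < a < pi -> separating Y a ->
     ~ (ray r a `<=` closure (Omega0_D r d))) /\
  (forall a, - pi < a < 0 -> separating Y a ->
     ~ (ray r a `<=` closure (Omega0_U r d))).

Definition xtime {R : realType} (w t : R[i]) : R[i] :=
  - sqeps w * ccosh (sqeps w * t) / csinh (sqeps w * t).

(* Where csinh vanishes x(t) is infinite, so such t satisfy |x(t)| >= r. *)
Definition Nhole {R : realType} (r : R) (w : R[i]) : set R[i] :=
  connected_component
    [set t : R[i] | csinh (sqeps w * t) = 0 \/ r%:C <= `|xtime w t|] 0.

Definition period {R : realType} (w : R[i]) : R[i] :=
  - (pi *i) / sqeps w.

Definition that {R : realType} (g : R) (w : R[i]) : R :=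
  2 * g / pi * (pi - Im w / 2).

Definition sigma {R : realType} (K : constants R) (w : R[i]) (u : R) : R :=
  let b := cc0 K / expR (Re w / 2) in
  if `|u| <= b then 0 else (u - Num.sg u * b) * tan (that (cgam K) w).

Definition above_line {R : realType} (a : R[i]) (th : R) : set R[i] :=
  [set t | exists s v : R, 0 < v /\ t = a + s%:C * cis th + v *i].
Definition below_line {R : realType} (a : R[i]) (th : R) : set R[i] :=
  [set t | exists s v : R, v < 0 /\ t = a + s%:C * cis th + v *i].

Definition Gamma_D {R : realType} (K : constants R) (w : R[i]) : set R[i] :=
  [set t | [/\ ~ Nhole (crad K) w t, Im t < ch K + sigma K w (Re t)
    & above_line (- ((2^-1 + ckap K)%:C * period w)) (that (cgam K) w) t]].
Definition Gamma_U {R : realType} (K : constants R) (w : R[i]) : set R[i] :=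
  [set t | [/\ ~ Nhole (crad K) w t, - ch K + sigma K w (Re t) < Im t
    & below_line ((2^-1 + ckap K)%:C * period w) (that (cgam K) w) t]].

(* For small rho the part of the imaginary axis in {|Im t| < h} lies in Nhole
   since h < 1/r, so Re t > 0 and Re t < 0 cut out the right and the left
   component of the intersection of Gamma_D and Gamma_U. *)
Definition Gamma_right {R : realType} (K : constants R) (w : R[i]) :
  set R[i] := [set t | [/\ Gamma_D K w t, Gamma_U K w t & 0 < Re t]].
Definition Gamma_left {R : realType} (K : constants R) (w : R[i]) :
  set R[i] := [set t | [/\ Gamma_D K w t, Gamma_U K w t & Re t < 0]].

Definition Omega_D {R : realType} (K : constants R) (w : R[i]) : set R[i] :=
  xtime w @` Gamma_D K w.
Definition Omega_U {R : realType} (K : constants R) (w : R[i]) : set R[i] :=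
  xtime w @` Gamma_U K w.
Definition Omega_L {R : realType} (K : constants R) (w : R[i]) : set R[i] :=
  xtime w @` Gamma_right K w.
Definition Omega_R {R : realType} (K : constants R) (w : R[i]) : set R[i] :=
  xtime w @` Gamma_left K w.
Definition Omega_C {R : realType} (K : constants R) (w : R[i]) : set R[i] :=
  xtime w @` [set t | Gamma_D K w t /\ Gamma_U K w (t + period w)].

Definition log_branch {R : realType} (K : constants R)
    (G : R[i] -> set R[i]) (l : R[i] -> R[i] -> R[i]) : Prop :=
  (forall w t, csector K w -> G w t ->
     cexp (l w t) = xtime w t ^+ 2 - eps w) /\
  {within [set p : R[i] * R[i] | csector K p.1 /\ G p.1 p.2],
     continuous (fun p => l p.1 p.2)}.

(* exp(t Lambda_0) (x^2-e)^(Lambda_1/2), where l w t = log (x(t)^2-e).  It is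
   (x-xR)^(U_R) (x-xL)^(U_L) since e^(2 sqrt(e) t) = (x-xL)/(x-xR). *)
Definition model_sol {R : realType} {n} (Y : ode_family R n)
    (l : R[i] -> R[i] -> R[i]) (w t : R[i]) : 'M[R[i]]_n :=
  diag_mx (\row_i cexp (t * lam0 Y (eps w) 0 i
                        + lam1 Y (eps w) 0 i / 2%:R * l w t)).

(* At e = 0, t = -1/x and log (x^2) = 2 (ln |x| + i arg x). *)
Definition model_solutions {R : realType} {n} (Y : ode_family R n)
    (K : constants R) (F_D F_U : R[i] -> R[i] -> 'M[R[i]]_n) : Prop :=
  exists l_D l_U : R[i] -> R[i] -> R[i],
    [/\ log_branch K (Gamma_D K) l_D,
        forall m a : R, 0 < m < crad K ->
          - (pi + cdel K) < a < cdel K -> Im (- (polar m a)^-1) < ch K ->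
          l_D w (- (polar m a)^-1) @[w --> sector_to0 (cgam K)]
            --> (2 * ln m) +i* (2 * a),
        log_branch K (Gamma_U K) l_U,
        forall w t, csector K w -> Gamma_left K w t -> l_U w t = l_D w t
      & forall w, csector K w ->
          (forall t, Gamma_D K w t ->
             F_D w (xtime w t) = model_sol Y l_D w t) /\
          (forall t, Gamma_U K w t ->
             F_U w (xtime w t) = model_sol Y l_U w t)].

Definition fundamental_on {R : realType} {n} (Y : ode_family R n) (e : R[i])
    (Om : set R[i]) (W : R[i] -> 'M[R[i]]_n) : Prop :=
  forall x, Om x ->
    [/\ W x \in unitmx, derivable W x 1
      & (x ^+ 2 - e) *: 'D_1 W x = sysmx Y e x *m W x].

(* The conditions on H_s that involve only one index s; the diagonals of the
   limits at xL and xR are k_L and k_R. *)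
Record sectorial_conjugation {R : realType} {n} (Y : ode_family R n)
    (K : constants R) (Om : R[i] -> set R[i])
    (F H : R[i] -> R[i] -> 'M[R[i]]_n) (k_L k_R : R[i] -> 'rV[R[i]]_n) :
    Prop := {
  sc_analytic : forall w x, csector K w -> Om w x -> mx_analytic2_at H w x;
  sc_fundamental : forall w, csector K w ->
    fundamental_on Y (eps w) (Om w) (fun x => H w x *m F w x);
  sc_limL : forall w, csector K w ->
    H w x @[x --> within (Om w) (nbhs (xL w))] --> diag_mx (k_L w);
  sc_limR : forall w, csector K w ->
    H w x @[x --> within (Om w) (nbhs (xR w))] --> diag_mx (k_R w);
  sc_close : exists2 c : R, 0 <= c &
    forall w, csector K w -> csector K (turn w) ->
      `|H w 0 - H (turn w) 0| <= c%:C * `|eps w|;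
  sc_bounded : exists M : R,
    forall w, csector K w -> csector K (turn w) ->
      [/\ `|H w 0| <= M%:C, `|invmx (H w 0)| <= M%:C,
          `|H (turn w) 0| <= M%:C & `|invmx (H (turn w) 0)| <= M%:C] }.

Definition limit_diagonal {R : realType} {n} (K : constants R)
    (k : R[i] -> 'rV[R[i]]_n) : Prop :=
  [/\ forall w, csector K w -> diag_mx (k w) \in unitmx,
      forall w i, csector K w -> analytic_at (fun z => k z 0 i) w
    & exists2 k0 : 'rV[R[i]]_n, diag_mx k0 \in unitmx &
        k w @[w --> sector_to0 (cgam K)] --> k0].

(* is_trig_mx means lower triangular. *)
Definition lower_unipotent {R : realType} {n} (A : 'M[R[i]]_n) : Prop :=
  is_trig_mx A /\ forall i, A i i = 1.
Definition upper_unipotent {R : realType} {n} (A : 'M[R[i]]_n) : Prop :=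
  lower_unipotent A^T.

Definition unfolded_stokes {R : realType} {n} (Y : ode_family R n)
    (K : constants R) (C_R C_L : R[i] -> 'M[R[i]]_n) : Prop :=
  exists (F_D F_U H_D H_U : R[i] -> R[i] -> 'M[R[i]]_n)
         (k_L k_R : R[i] -> 'rV[R[i]]_n),
    [/\ model_solutions Y K F_D F_U,
        limit_diagonal K k_L /\ limit_diagonal K k_R,
        sectorial_conjugation Y K (Omega_D K) F_D H_D k_L k_R,
        sectorial_conjugation Y K (Omega_U K) F_U H_U k_L k_R
      & forall w, csector K w ->
        [/\ upper_unipotent (C_R w), lower_unipotent (C_L w),
            forall x, Omega_R K w x ->
              invmx (H_D w x) *m H_U w x
              = F_D w x *m C_R w *m invmx (F_D w x),
            forall x, Omega_L K w x ->
              invmx (H_D w x) *m H_U w x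
              = F_D w x *m C_L w *m invmx (F_D w x)
          & forall x, Omega_C K w x ->
              invmx (H_D w x) *m H_U w x = 1%:M]].

(* Main.v *)
(* Only parameters above the half-line eps > 0, on the sheet arg eps = 2 pi, are
   used; there the strips bounding the sectorial domains are horizontal. Since
   the j-th columns of the Stokes matrices are trivial, the j-th columns of H_D
   and H_U agree on the three overlaps and glue to a vector v, continuous on the
   disc and holomorphic off +-sqrt(eps), with (x^2 - eps) v' = (B - lambda_j) v.
   By the maximum principle its Taylor coefficients at 0 grow at most
   geometrically, at a rate independent of eps.
   On the other hand a contraction in a weighted l1-space of coefficients gives
   u(eps, x), analytic at the origin with u_j(eps, 0) = 1, which solves the same
   system up to corrections p_i(eps) x^N, i <> j, and is the only such solution
   of moderate growth, for each fixed eps.  Hence v = v_j(0) u for small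
   eps > 0, so p_i vanishes there, and therefore identically.  Replacing the
   j-th column of the identity matrix by u gives the equivalence. *)
Require Import Defs.
From HB Require Import structures.
From mathcomp Require Import all_boot all_order all_algebra.
From mathcomp Require Import all_classical all_reals all_analysis.
From mathcomp Require Import complex ring lra.

Set Implicit Arguments.
Unset Strict Implicit.
Unset Printing Implicit Defensive.

Import Order.TTheory GRing.Theory Num.Theory.
Import numFieldNormedType.Exports.

Local Open Scope classical_set_scope.
Local Open Scope complex_scope.
Local Open Scope ring_scope.

Local Notation Re := complex.Re.
Local Notation Im := complex.Im.

(** * Sequences and series of complex numbers *)

(** At eps = 0 the singularity is irregular and the formal power series solution usually diverges.
    In row i <> j the coefficient equation has two competing terms, a_i u_k for small k and (k-1)
    u_(k-1) for large k. Solving for the dominant one in each range leaves exactly one equation per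
    row, that of index N, without an unknown of its own. This is the origin of the corrections p_i
    x^N. N must be large for the upper range to contract on a space that contains the comparison
    solution v. N and the weights are fixed from r alone, before eps; this is why the growth rate of
    v must be uniform in eps. The corrections are analytic in eps, so their vanishing on a real
    interval (0, e0) is enough, and the geometry is needed only at positive parameters. The factor
    lambda_j enters because F is diagonal: the j-th column of H F is the j-th column of H times a
    scalar exponential, which can be cancelled from the equation. At the two points +-sqrt(eps)
    nothing but continuity of v is available, so the coefficient estimates rest on a maximum
    principle that is insensitive to them. *)

Section Modulus.
Variable R : realType.
Implicit Types (z w : R[i]) (x y : R).

(** The norm of [R[i]] has values in the partially ordered field [R[i]]. Its real part is the same
    modulus in [R], where estimates reduce to real arithmetic. *)
Definition cabs z : R := Re `|z|.

Lemma normcabs z : `|z| = (cabs z)%:C.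
Proof. by rewrite /cabs normc_def. Qed.

Lemma cabs_ge0 z : 0 <= cabs z.
Proof. by rewrite -lecR -normcabs; exact: (normr_ge0 z). Qed.

Lemma ltcabs z x : (`|z| < x%:C) = (cabs z < x).
Proof. by rewrite normcabs ltcR. Qed.

Lemma cabsM z w : cabs (z * w) = cabs z * cabs w.
Proof. by apply/(@complexI R); rewrite rmorphM -!normcabs normrM. Qed.

Lemma cabsN z : cabs (- z) = cabs z.
Proof. by rewrite /cabs normrN. Qed.

Lemma cabsB z w : cabs (z - w) = cabs (w - z).
Proof. by rewrite /cabs distrC. Qed.

Lemma cabsD z w : cabs (z + w) <= cabs z + cabs w.
Proof. by rewrite -lecR rmorphD -!normcabs ler_normD. Qed.

Lemma cabs_distD z1 z2 z3 : cabs (z1 - z3) <= cabs (z1 - z2) + cabs (z2 - z3).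
Proof. by have := cabsD (z1 - z2) (z2 - z3); rewrite addrA subrK. Qed.

Lemma cabs0 : cabs (0 : R[i]) = 0.
Proof. by rewrite /cabs normr0. Qed.

Lemma cabs1 : cabs (1 : R[i]) = 1.
Proof. by rewrite /cabs normr1. Qed.

Lemma cabs_eq0 z : (cabs z == 0) = (z == 0).
Proof. by rewrite -(normr_eq0 z) normcabs -(inj_eq (@complexI R)). Qed.

Lemma cabs_gt0 z : (0 < cabs z) = (z != 0).
Proof. by rewrite lt0r cabs_eq0 cabs_ge0 andbT. Qed.

Lemma cabsX z n : cabs (z ^+ n) = cabs z ^+ n.
Proof. by apply/(@complexI R); rewrite rmorphXn -!normcabs normrX. Qed.

Lemma cabsV z : cabs z^-1 = (cabs z)^-1.
Proof. by apply/(@complexI R); rewrite fmorphV -!normcabs normfV. Qed.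

Lemma cabsR x : cabs x%:C = `|x|.
Proof. by rewrite /cabs normc_def /= expr0n addr0 sqrtr_sqr. Qed.

Lemma cabs_nat n : cabs (n%:R : R[i]) = n%:R.
Proof. by rewrite /cabs normr_nat -(rmorph_nat (real_complex R)). Qed.

Lemma cabs_sqr z : cabs z ^+ 2 = Re z ^+ 2 + Im z ^+ 2.
Proof. by rewrite /cabs normc_def /= sqr_sqrtr // addr_ge0 ?sqr_ge0. Qed.

Lemma cabs_Re z : `|Re z| <= cabs z.
Proof.
rewrite -(@ler_pXn2r _ 2) ?nnegrE ?cabs_ge0 // cabs_sqr real_normK ?num_real //.
by rewrite lerDl sqr_ge0.
Qed.

Lemma cabs_Im z : `|Im z| <= cabs z.
Proof.
rewrite -(@ler_pXn2r _ 2) ?nnegrE ?cabs_ge0 // cabs_sqr real_normK ?num_real //.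
by rewrite lerDr sqr_ge0.
Qed.

Lemma cabs_le z : cabs z <= `|Re z| + `|Im z|.
Proof.
rewrite -(@ler_pXn2r _ 2) ?nnegrE ?cabs_ge0 ?addr_ge0 // cabs_sqr.
rewrite sqrrD !real_normK ?num_real // -addrA lerD2l lerDr.
by rewrite mulrn_wge0 // mulr_ge0.
Qed.

Lemma cabs_sum (I : Type) (r : seq I) (P : pred I) (F : I -> R[i]) :
  cabs (\sum_(i <- r | P i) F i) <= \sum_(i <- r | P i) cabs (F i).
Proof.
elim/big_ind2 : _ => [|a x b y H1 H2|//]; first by rewrite cabs0.
exact: le_trans (cabsD _ _) (lerD H1 H2).
Qed.

Lemma cabs_triangle_rev z w : cabs z - cabs w <= cabs (z - w).
Proof. by rewrite lerBlDr; have := cabsD (z - w) w; rewrite subrK. Qed.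

End Modulus.

Section Sequences.
Variable R : realType.
Implicit Types (z u v : nat -> R[i]) (l S : R[i]) (M e : R).

(** Convergence with real epsilons; [cvgsP] identifies it with the filter form used in the
    definitions of analyticity. *)
Definition cvgs u l := forall e, 0 < e ->
  exists N, forall n, (N <= n)%N -> cabs (u n - l) < e.

Lemma cvgsP u l : cvgs u l <-> u @ \oo --> l.
Proof.
split=> [ul|/cvgrPdist_lt ul].
  apply/cvgrPdist_lt => -[e e'] /[1!ltcE]/= /andP[/eqP-> e0].
  have [N HN] := ul _ e0; exists N => // n /= /HN.
  by rewrite distrC ltcabs.
move=> e e0; have /ul[N _ HN] : 0 < e%:C by rewrite ltcR.
by exists N => n /HN; rewrite distrC ltcabs.
Qed.

Lemma cvgs_unique u l l' : cvgs u l -> cvgs u l' -> l = l'.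
Proof.
move=> ul ul'; apply/subr0_eq/eqP; rewrite -cabs_eq0.
apply/eqP/le_anti; rewrite cabs_ge0 andbT; apply/ler_addgt0Pr => e e0.
have e20 : 0 < e / 2 by rewrite divr_gt0.
have [N HN] := ul _ e20; have [N' HN'] := ul' _ e20.
have := HN (maxn N N') (leq_maxl _ _); have := HN' (maxn N N') (leq_maxr _ _).
have := cabs_distD l (u (maxn N N')) l'; rewrite (cabsB l (u _)); lra.
Qed.

Lemma cvgs_cst l : cvgs (fun=> l) l.
Proof. by move=> e e0; exists 0%N => n _; rewrite subrr cabs0. Qed.

Lemma cvgs_near u v l N : (forall n, (N <= n)%N -> u n = v n) ->
  cvgs u l -> cvgs v l.
Proof.
move=> uv ul e /ul[N' HN']; exists (maxn N N') => n; rewrite geq_max.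
by move=> /andP[/uv <- /HN'].
Qed.

Lemma cvgsD u v l l' : cvgs u l -> cvgs v l' ->
  cvgs (fun n => u n + v n) (l + l').
Proof.
move=> ul vl e e0; have e20 : 0 < e / 2 by rewrite divr_gt0.
have [N HN] := ul _ e20; have [N' HN'] := vl _ e20.
exists (maxn N N') => n; rewrite geq_max => /andP[/HN ? /HN' ?].
have := cabsD (u n - l) (v n - l'); rewrite addrACA -opprD; lra.
Qed.

Lemma cvgsM u v l l' : cvgs u l -> cvgs v l' ->
  cvgs (fun n => u n * v n) (l * l').
Proof.
move=> ul vl e e0; set K := 1 + cabs l + cabs l'.
have K0 : 0 < K by have := cabs_ge0 l; have := cabs_ge0 l'; rewrite /K; lra.
have d0 : 0 < Num.min 1 (e / (2 * K)) by rewrite lt_min ltr01 divr_gt0 ?mulr_gt0.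
have [N HN] := ul _ d0; have [N' HN'] := vl _ d0.
exists (maxn N N') => n; rewrite geq_max => /andP[/HN + /HN' +].
rewrite !lt_min !ltr_pdivlMr ?mulr_gt0 // => /andP[h1 h2] /andP[h3 h4].
have -> : u n * v n - l * l' = (u n - l) * (v n - l') + l * (v n - l')
   + (u n - l) * l' by ring.
have := cabsD ((u n - l) * (v n - l') + l * (v n - l')) ((u n - l) * l').
have := cabsD ((u n - l) * (v n - l')) (l * (v n - l')).
rewrite !cabsM; move: h1 h2 h3 h4; rewrite /K.
have := cabs_ge0 l; have := cabs_ge0 l'.
have := cabs_ge0 (u n - l); have := cabs_ge0 (v n - l').
move: (cabs l) (cabs l') (cabs (u n - l)) (cabs (v n - l')) => a b c d.
move=> *; nra.
Qed.

Lemma cvgs_sum (I : Type) (r : seq I) (P : pred I) (F : I -> nat -> R[i])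
    (L : I -> R[i]) : (forall i, cvgs (F i) (L i)) ->
  cvgs (fun n => \sum_(i <- r | P i) F i n) (\sum_(i <- r | P i) L i).
Proof.
move=> FL; elim: r => [|i r IH].
  by rewrite big_nil; apply: (cvgs_near (N := 0)) (cvgs_cst 0) => n _; rewrite big_nil.
rewrite big_cons; case: ifP => Pi.
  apply: (cvgs_near (N := 0)) (cvgsD (FL i) IH) => n _.
  by rewrite big_cons Pi.
by apply: (cvgs_near (N := 0)) IH => n _; rewrite big_cons Pi.
Qed.

Lemma cvgs_le u l a e N : (forall n, (N <= n)%N -> cabs (u n - a) <= e) ->
  cvgs u l -> cabs (l - a) <= e.
Proof.
move=> ue ul; apply/ler_addgt0Pr => d /ul[N' HN'].
have := HN' _ (leq_maxr N N'); have := ue _ (leq_maxl N N').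
have := cabs_distD l (u (maxn N N')) a; rewrite (cabsB l (u _)); lra.
Qed.

Lemma cvgs_shift u l k : cvgs u l -> cvgs (fun n => u (n + k)%N) l.
Proof.
move=> ul e /ul[N HN]; exists N => n Nn; apply: HN.
exact: leq_trans Nn (leq_addr _ _).
Qed.

(** Absolute convergence is carried by an explicit bound on all finite partial sums, so that
    majorant arguments involve no limits of moduli. *)
Definition asum z M := forall N : nat, \sum_(k < N) cabs (z k) <= M.

Definition sums z S := cvgs (fun N : nat => \sum_(k < N) z k) S.

Lemma asum_ge0 z M : asum z M -> 0 <= M.
Proof. by move=> /(_ 0%N); rewrite big_ord0. Qed.

Lemma asum_term z M k : asum z M -> cabs (z k) <= M.
Proof.
move=> /(_ k.+1); rewrite big_ord_recr /=; apply: le_trans.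
by rewrite lerDr sumr_ge0 // => i _; apply: cabs_ge0.
Qed.

Lemma asum_le z u M : (forall k, cabs (u k) <= cabs (z k)) ->
  asum z M -> asum u M.
Proof. by move=> uz zM N; apply: le_trans (zM N); apply: ler_sum => i _. Qed.

Lemma real_bounded_series (a : nat -> R) M :
  (forall N : nat, \sum_(k < N) `|a k| <= M) ->
  exists x : R, forall e, 0 < e -> exists N, forall n, (N <= n)%N ->
    `|\sum_(k < n) a k - x| < e.
Proof.
move=> aM.
have /normed_cvg ca : cvgn [normed series a].
  apply: nondecreasing_is_cvgn.
    apply/nondecreasing_seqP => n; rewrite /normed_series_of /= /series /=.
    by rewrite big_nat_recr //= lerDl.
  exists M => _ [n _ <-]; rewrite /normed_series_of /series /= big_mkord.
  exact: aM.
have [x /cvgrPdist_lt al] : exists x : R, series a @ \oo --> x.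
  by exists (limn (series a)).
exists x => e e0; have [N _ HN] := al _ e0; exists N => n /HN.
by rewrite /series /= big_mkord distrC.
Qed.

Lemma asum_sums z M : asum z M -> exists S, sums z S.
Proof.
move=> zM.
have [|x Hx] := @real_bounded_series (fun k => Re (z k)) M.
  by move=> N; apply: le_trans (zM N); apply: ler_sum => i _; apply: cabs_Re.
have [|y Hy] := @real_bounded_series (fun k => Im (z k)) M.
  by move=> N; apply: le_trans (zM N); apply: ler_sum => i _; apply: cabs_Im.
exists (x +i* y) => e e0; have e20 : 0 < e / 2 by rewrite divr_gt0.
have [N HN] := Hx _ e20; have [N' HN'] := Hy _ e20.
exists (maxn N N') => n; rewrite geq_max => /andP[/HN h1 /HN' h2].
apply: le_lt_trans (cabs_le _) _.
rewrite !raddfB /= !raddf_sum /=; lra.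
Qed.

Lemma sums_le z S M : asum z M -> sums z S -> cabs S <= M.
Proof.
move=> zM zS; have := @cvgs_le _ S 0 M 0 _ zS; rewrite subr0; apply => n _.
by rewrite subr0; apply: le_trans (cabs_sum _ _ _) (zM n).
Qed.

Lemma sums_unique z S S' : sums z S -> sums z S' -> S = S'.
Proof. exact: cvgs_unique. Qed.

Lemma eq_sums z u S : (forall k, z k = u k) -> sums z S -> sums u S.
Proof. by move=> /funext ->. Qed.

Lemma sumsD z u S T : sums z S -> sums u T -> sums (fun k => z k + u k) (S + T).
Proof.
move=> zS uT; apply: (cvgs_near (N := 0)) (cvgsD zS uT) => n _.
by rewrite big_split.
Qed.

Lemma sumsZ a z S : sums z S -> sums (fun k => a * z k) (a * S).
Proof.
move=> zS; apply: (cvgs_near (N := 0)) (cvgsM (cvgs_cst a) zS) => n _.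
by rewrite mulr_sumr.
Qed.

Lemma sums_big (I : Type) (r : seq I) (P : pred I) (F : I -> nat -> R[i])
    (L : I -> R[i]) : (forall i, sums (F i) (L i)) ->
  sums (fun n => \sum_(i <- r | P i) F i n) (\sum_(i <- r | P i) L i).
Proof.
move=> FL; apply: (cvgs_near (N := 0)) (cvgs_sum r P FL) => n _.
by rewrite exchange_big.
Qed.

Lemma sums_finite z K : (forall k, (K <= k)%N -> z k = 0) ->
  sums z (\sum_(k < K) z k).
Proof.
move=> zK; apply: (cvgs_near (N := K)) (cvgs_cst _) => n Kn.
rewrite -(subnKC Kn) big_split_ord /= [X in _ + X]big1 ?addr0 //.
by move=> i _; rewrite zK // leq_addr.
Qed.

Lemma sums_recl z S : sums z S -> sums (fun k => z k.+1) (S - z 0%N).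
Proof.
move=> zS; have := cvgsD (cvgs_shift 1 zS) (cvgs_cst (- z 0%N)).
apply: (cvgs_near (N := 0)) => n _.
by rewrite addn1 big_ord_recl addrC addKr.
Qed.

Lemma sums_recl_inv z S : sums (fun k => z k.+1) S -> sums z (z 0%N + S).
Proof.
move=> zS e e0; have [N HN] := zS _ e0; exists N.+1 => -[//|n] /HN.
by rewrite big_ord_recl opprD addrACA subrr add0r.
Qed.

Lemma geo_half K : \sum_(k < K) (2^-1 : R) ^+ k <= 2.
Proof.
have -> : \sum_(k < K) (2^-1 : R) ^+ k = 2 - 2 * (2^-1) ^+ K.
  elim: K => [|K IH]; first by rewrite big_ord0 expr0; lra.
  by rewrite big_ord_recr /= IH exprS; lra.
by have : 0 <= (2^-1 : R) ^+ K; [rewrite exprn_ge0 // invr_ge0 | lra].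
Qed.

End Sequences.

(** * Cauchy products and interchange of summations *)

Section CauchyProduct.
Variable R : realType.
Implicit Types (z y : nat -> R[i]) (M e : R).

Lemma bounded_tail (a : nat -> R) M :
  (forall m n, (m <= n)%N -> a m <= a n) -> (forall n, a n <= M) ->
  forall e, 0 < e -> exists K, forall n, (K <= n)%N -> a n - a K <= e.
Proof.
move=> ndec aM e e0.
have supA : has_sup (range a).
  by split; [exists (a 0%N), 0%N | exists M => _ [n _ <-]].
have [_ [K _ <-] HK] := sup_adherent e0 supA.
exists K => n _; have : a n <= sup (range a).
  by apply: ub_le_sup; [exact: supA.2 | exists n].
lra.
Qed.

Definition cprod z y (m : nat) : R[i] := \sum_(k < m.+1) z k * y (m - k)%N.

Lemma sum_triangle (V : zmodType) (F : nat -> nat -> V) N :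
  \sum_(m < N) \sum_(k < m.+1) F k (m - k)%N
  = \sum_(k < N) \sum_(l < N - k) F k l.
Proof.
elim: N => [|N IH]; first by rewrite !big_ord0.
rewrite big_ord_recr /= IH [RHS]big_ord_recr /= subSnn big_ord1.
rewrite [X in _ + X]big_ord_recr /= subnn addrA; congr (_ + _).
rewrite -big_split /=; apply: eq_bigr => k _.
by rewrite subSn ?big_ord_recr //= ltnW.
Qed.

Lemma asum_cprod z y M M' : asum z M -> asum y M' -> asum (cprod z y) (M * M').
Proof.
move=> zM yM N.
apply: (@le_trans _ _ (\sum_(m < N) \sum_(k < m.+1) cabs (z k) * cabs (y (m - k)%N))).
  apply: ler_sum => m _; apply: le_trans (cabs_sum _ _ _) _.
  by apply: ler_sum => k _; rewrite cabsM.
rewrite (sum_triangle (fun k l => cabs (z k) * cabs (y l))).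
apply: (@le_trans _ _ (\sum_(k < N) cabs (z k) * M')).
  by apply: ler_sum => k _; rewrite -mulr_sumr ler_wpM2l ?cabs_ge0.
by rewrite -mulr_suml ler_wpM2r // (asum_ge0 yM).
Qed.

Lemma psum_mono (a : nat -> R) : (forall k, 0 <= a k) ->
  forall m n, (m <= n)%N -> \sum_(k < m) a k <= \sum_(k < n) a k.
Proof.
move=> a0 m n mn; rewrite -(subnKC mn) big_split_ord /= lerDl.
exact: sumr_ge0.
Qed.

Lemma sum_ord_cut (V : zmodType) (F : nat -> V) K N : (K <= N)%N ->
  \sum_(l < N) F l = \sum_(l < K) F l + \sum_(l < N - K) F (K + l)%N.
Proof.
by move=> KN; move: (N - K)%N (subnKC KN) => D <-; rewrite big_split_ord.
Qed.

Lemma sum_cut (V : zmodType) (F : nat -> V) K N : (K <= N)%N ->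
  \sum_(l < N) F l - \sum_(l < K) F l = \sum_(l < N - K) F (K + l)%N.
Proof.
by move=> /(sum_ord_cut F) ->; rewrite addrC addKr.
Qed.

Lemma asum_tail z M : asum z M -> forall e, 0 < e ->
  exists K, forall n, (K <= n)%N ->
    \sum_(k < n) cabs (z k) - \sum_(k < K) cabs (z k) <= e.
Proof.
move=> zM; apply: (@bounded_tail (fun n => \sum_(k < n) cabs (z k)) M) => //.
exact: (@psum_mono (fun k => cabs (z k)) (fun k => cabs_ge0 _)).
Qed.

(** The triangle of the Cauchy product differs from the product of the partial sums by the terms
    [z k * y l] with [N - k <= l < N]. If [k < K], then [l] lies beyond [K] because [N >= 2K], and
    the tail of [y] is small; if [k >= K], the tail of [z] is small. *)
Lemma sums_cprod z y M M' Z Y : asum z M -> asum y M' -> sums z Z -> sums y Y ->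
  sums (cprod z y) (Z * Y).
Proof.
move=> zM yM zZ yY e e0.
have M0 := asum_ge0 zM; have M'0 := asum_ge0 yM.
have [N1 H1] := cvgsM zZ yY (divr_gt0 e0 (ltr0Sn _ 1)).
(* The two tails contribute at most [M * d + d * M'], which this choice keeps within [e / 2]; the
   summand 1 keeps the denominator positive. *)
set d := e / (2 * (M + M' + 1)).
have den0 : 0 < M + M' + 1 by lra.
have d0 : 0 < d by rewrite divr_gt0 // mulr_gt0.
have [K1 HK1] := asum_tail zM d0; have [K2 HK2] := asum_tail yM d0.
set K := maxn K1 K2.
exists (maxn N1 (K + K)) => N; rewrite geq_max => /andP[/H1 h1 KN].
have KN' : (K <= N)%N by apply: leq_trans KN; rewrite leq_addr.
apply: le_lt_trans (cabs_distD _ ((\sum_(k < N) z k) * (\sum_(k < N) y k)) _) _.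
suff: cabs (\sum_(k < N) cprod z y k - (\sum_(k < N) z k) * (\sum_(k < N) y k))
      <= e / 2 by lra.
rewrite /cprod (sum_triangle (fun k l => z k * y l)) cabsB mulr_suml -sumrB.
have B k : (K <= k)%N -> (k <= N)%N ->
    \sum_(l < N) cabs (y l) - \sum_(l < k) cabs (y l) <= d.
  move=> Kk kN; have h2 := HK2 N (leq_trans (leq_maxr _ _) KN').
  apply: le_trans h2.
  rewrite lerB // (@psum_mono (fun k => cabs (y k)) (fun k => cabs_ge0 _)) //.
  exact: leq_trans (leq_maxr _ _) Kk.
apply: (@le_trans _ _ (\sum_(k < N) cabs (z k) *
    (\sum_(l < N) cabs (y l) - \sum_(l < N - k) cabs (y l)))).
  apply: le_trans (cabs_sum _ _ _) _; apply: ler_sum => k _.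
  rewrite -mulr_sumr -mulrBr cabsM ler_wpM2l ?cabs_ge0 //.
  have Nk : (N - k <= N)%N by rewrite leq_subr.
  by rewrite (sum_cut y Nk) (sum_cut (fun l => cabs (y l)) Nk); exact: cabs_sum.
rewrite (sum_ord_cut (fun k => cabs (z k) *
    (\sum_(l < N) cabs (y l) - \sum_(l < N - k) cabs (y l))) KN') /=.
apply: (@le_trans _ _ (M * d + d * M')); last first.
  have dE : d * (M + M' + 1) = e / 2 by rewrite /d; field; apply/eqP; lra.
  by move: dE; lra.
apply: lerD.
  apply: (@le_trans _ _ (\sum_(k < K) cabs (z k) * d)); last first.
    by rewrite -mulr_suml; apply: ler_wpM2r; [exact: ltW|exact: zM].
  apply: ler_sum => k _; rewrite ler_wpM2l ?cabs_ge0 // B ?leq_subr //.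
  by rewrite leq_subRL ?(leq_trans (ltnW (ltn_ord k)) KN') // (leq_trans _ KN) // leq_add2r ltnW.
apply: (@le_trans _ _ (\sum_(k < N - K) cabs (z (K + k)%N) * M')).
  apply: ler_sum => k _; rewrite ler_wpM2l ?cabs_ge0 //.
  rewrite lerBlDr (le_trans (yM N)) // lerDl sumr_ge0 // => i _.
  exact: cabs_ge0.
rewrite -mulr_suml ler_wpM2r //.
have := HK1 N (leq_trans (leq_maxl _ _) KN').
have := sum_ord_cut (fun k => cabs (z k)) KN'.
have := @psum_mono (fun k => cabs (z k)) (fun k => cabs_ge0 _) K1 K (leq_maxl _ _).
lra.
Qed.

Lemma sum_square_widen (V : zmodType) (f : nat -> nat -> V) N L K :
  (N <= L)%N -> (N <= K)%N ->
  \sum_(l < N) \sum_(k < N) f k l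
  = \sum_(l < L) \sum_(k < K) (if (l < N)%N && (k < N)%N then f k l else 0).
Proof.
move=> NL NK; rewrite (big_ord_widen L (fun l => \sum_(k < N) f k l)) //.
rewrite [LHS]big_mkcond; apply: eq_bigr => l _.
case: ifP => lN /=; last by rewrite big1.
by rewrite (big_ord_widen K (fun k => f k l)) // [LHS]big_mkcond.
Qed.

(** The terms outside the square of side [N] have total modulus at most the remaining growth of the
    absolute square sums, which are monotone and bounded. Finite rectangles are compared with the
    square, and their inner and then outer side tends to infinity. *)
Lemma square_sums (w : nat -> nat -> R[i]) (g : nat -> R[i]) G M :
  (forall N : nat, \sum_(k < N) \sum_(l < N) cabs (w k l) <= M) ->
  (forall l, sums (fun k => w k l) (g l)) -> sums g G ->
  cvgs (fun N : nat => \sum_(k < N) \sum_(l < N) w k l) G.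
Proof.
move=> wM wg gG e e0; have e20 : 0 < e / 2 by rewrite divr_gt0.
pose A N : R := \sum_(l < N) \sum_(k < N) cabs (w k l).
have mA m n : (m <= n)%N -> A m <= A n.
  move=> mn; rewrite /A (sum_square_widen (fun k l => cabs (w k l)) mn mn).
  apply: ler_sum => l _; apply: ler_sum => k _.
  by case: ifP => // _; apply: cabs_ge0.
have AM n : A n <= M by rewrite /A exchange_big.
have [K HK] := bounded_tail mA AM e20.
exists K => N KN; rewrite exchange_big /= cabsB.
apply: (@le_lt_trans _ _ (e / 2)); last by lra.
apply: (cvgs_le (N := N)) gG => L NL.
have hL : cvgs (fun K' : nat => \sum_(l < L) \sum_(k < K') w k l) (\sum_(l < L) g l).
  by apply: cvgs_sum => l; apply: wg.
apply: (cvgs_le (N := N)) hL => K' NK'.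
rewrite (sum_square_widen w NL NK') -sumrB.
under eq_bigr do rewrite -sumrB.
have KNm : (K <= maxn L K')%N by rewrite (leq_trans KN) // (leq_trans NL) // leq_maxl.
apply: (@le_trans _ _ (A (maxn L K') - A N)); last first.
  by have := HK _ KNm; have := mA _ _ KN; lra.
have NN : (N <= maxn L K')%N by rewrite (leq_trans NL) // leq_maxl.
rewrite {2}/A (sum_square_widen (fun k l => cabs (w k l)) NN NN) /A -sumrB.
under [X in _ <= X]eq_bigr do rewrite -sumrB.
pose F l k := cabs (w k l) - (if (l < N)%N && (k < N)%N then cabs (w k l) else 0).
have F0 l k : 0 <= F l k by rewrite /F; case: ifP; rewrite ?subrr ?subr0 ?cabs_ge0.
apply: (@le_trans _ _ (\sum_(l < L) \sum_(k < K') F l k)).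
  apply: le_trans (cabs_sum _ _ _) _; apply: ler_sum => l _.
  apply: le_trans (cabs_sum _ _ _) _; apply: ler_sum => k _.
  by rewrite /F; case: ifP; rewrite ?subrr ?cabs0 // !subr0.
apply: (@le_trans _ _ (\sum_(l < L) \sum_(k < maxn L K') F l k)).
  by apply: ler_sum => l _; apply: psum_mono; rewrite ?leq_maxr.
apply: (@psum_mono (fun l => \sum_(k < maxn L K') F l k)); rewrite ?leq_maxl //.
by move=> l; apply: sumr_ge0.
Qed.

Lemma square_col (w : nat -> nat -> R[i]) M l :
  (forall N : nat, \sum_(k < N) \sum_(l < N) cabs (w k l) <= M) ->
  asum (fun k => w k l) M.
Proof.
move=> wM N; apply: le_trans (wM (maxn N l.+1)).
apply: (@le_trans _ _ (\sum_(k < maxn N l.+1) cabs (w k l))).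
  by apply: (@psum_mono (fun k => cabs (w k l))); rewrite ?leq_maxl // => k; apply: cabs_ge0.
apply: ler_sum => k _; rewrite (bigD1 (Ordinal (leq_maxr N l.+1))) //= lerDl.
by apply: sumr_ge0 => i _; apply: cabs_ge0.
Qed.

(** The [N] infinite column sums are truncated at a common height [K'], each with an error of at
    most [e / N.+1]; the truncated sums lie in a finite square. *)
Lemma square_asum (w : nat -> nat -> R[i]) (g : nat -> R[i]) M :
  (forall N : nat, \sum_(k < N) \sum_(l < N) cabs (w k l) <= M) ->
  (forall l, sums (fun k => w k l) (g l)) -> asum g M.
Proof.
move=> wM wg N.
have B K : \sum_(l < N) cabs (\sum_(k < K) w k l) <= M.
  apply: le_trans (wM (maxn N K)); rewrite exchange_big /=.
  apply: (@le_trans _ _ (\sum_(l < N) \sum_(k < maxn N K) cabs (w k l))).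
    apply: ler_sum => l _; apply: le_trans (cabs_sum _ _ _) _.
    by apply: (@psum_mono (fun k => cabs (w k l))); rewrite ?leq_maxr // => k; apply: cabs_ge0.
  apply: (@psum_mono (fun l => \sum_(k < maxn N K) cabs (w k l))); rewrite ?leq_maxl //.
  by move=> l; apply: sumr_ge0 => k _; apply: cabs_ge0.
apply/ler_addgt0Pr => e e0.
have e0' : 0 < e / N.+1%:R by rewrite divr_gt0.
have /choice[K HK] l := wg l _ e0'.
pose K' := \max_(l < N) K l.
apply: (@le_trans _ _ (\sum_(l < N) (cabs (\sum_(k < K') w k l) + e / N.+1%:R))).
  apply: ler_sum => l _.
  have /(HK l) : (K l <= K')%N by apply: (leq_bigmax_cond l).
  have := cabs_triangle_rev (g l) (\sum_(k < K') w k l).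
  rewrite (cabsB (g l)); move: (e / _) => d; lra.
rewrite big_split /=; apply: lerD; first exact: B.
rewrite sumr_const card_ord -[_ *+ N]mulr_natl mulrCA.
by rewrite ger_pMr // ler_pdivrMr ?mul1r ?ler_nat.
Qed.

End CauchyProduct.

(** * Power series in one and two variables *)

Section Derivative.
Variable R : realType.
Implicit Types (f : R[i] -> R[i]) (x d : R[i]).

Lemma nbhs_cabs (x : R[i]) (P : set R[i]) :
  nbhs x P <-> exists2 e : R, 0 < e & forall y, cabs (y - x) < e -> P y.
Proof.
split=> [/nbhs_ballP[[e e'] /= /[1!ltcE]/= /andP[/eqP-> e0] xP]|[e e0 xP]].
  by exists e => // y ye; apply: xP; rewrite -ball_normE /= distrC ltcabs.
apply/nbhs_ballP; exists e%:C; first by rewrite /= ltcR.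
by move=> y; rewrite -ball_normE /= distrC ltcabs; exact: xP.
Qed.

(** The increment form of the derivative, free of quotients and of the exclusion of h = 0. *)
Lemma is_derive_cabs f x d :
  (forall e : R, 0 < e -> exists2 r : R, 0 < r & forall h, cabs h < r ->
     cabs (f (x + h) - f x - d * h) <= e * cabs h) <->
  is_derive x 1 f d.
Proof.
split=> [fd|[df fd] e e0].
  have c : h^-1 *: ((f \o shift x) (h *: 1) - f x) @[h --> 0^'] --> d.
    apply/cvgrPdist_lt => -[e e'] /[1!ltcE]/= /andP[/eqP-> e0].
    have /fd[r r0 Hr] : 0 < e / 2 by rewrite divr_gt0.
    apply/nbhs_cabs; exists r => // h; rewrite subr0 => hr h0.
    rewrite /= -[h *: 1]/(h * 1) mulr1 (addrC h) distrC ltcabs.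
    rewrite -[_ *: _]/(h^-1 * _).
    have -> : h^-1 * (f (x + h) - f x) - d = h^-1 * (f (x + h) - f x - d * h).
      by field.
    rewrite cabsM cabsV mulrC ltr_pdivrMr ?cabs_gt0 //.
    apply: le_lt_trans (Hr h hr) _; rewrite ltr_pM2r ?cabs_gt0 //; lra.
  by apply: DeriveDef; [apply/cvg_ex; exists d | apply: cvg_lim c].
have : h^-1 *: ((f \o shift x) (h *: 1) - f x) @[h --> 0^'] --> d.
  by rewrite -fd; exact: df.
move=> /cvgrPdist_lt/(_ e%:C); rewrite ltcR => /(_ e0) /nbhs_cabs[r r0 Hr].
exists r => // h hr; have [->|h0] := eqVneq h 0.
  by rewrite addr0 mulr0 !subrr cabs0 mulr0.
have := Hr h; rewrite subr0 => /(_ hr h0).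
rewrite /= -[h *: 1]/(h * 1) mulr1 (addrC h) distrC ltcabs.
rewrite -[_ *: _]/(h^-1 * _) => /ltW H.
have -> : f (x + h) - f x - d * h = h * (h^-1 * (f (x + h) - f x) - d) by field.
by rewrite cabsM mulrC ler_wpM2r ?cabs_ge0.
Qed.

End Derivative.

Section PowerSeries.
Variable R : realType.
Implicit Types (f g : R[i] -> R[i]) (c d : nat -> R[i]) (s r : R) (x y h : R[i]).

Definition asumr c s M := asum (fun k => c k * s%:C ^+ k) M.

(** At the radius [s] itself the coefficients are absolutely summable. They thus lie in a weighted
    l1-algebra, and sums and products of series keep the same [s]. *)
Definition ps f c s :=
  [/\ 0 < s, exists M, asumr c s M
    & forall x, cabs x < s -> sums (fun k => c k * x ^+ k) (f x)].

Lemma asumr_le c s M x : asumr c s M -> cabs x <= s ->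
  asum (fun k => c k * x ^+ k) M.
Proof.
move=> cM xs; have s0 : 0 <= s := le_trans (cabs_ge0 x) xs.
apply: asum_le cM => k; rewrite !cabsM !cabsX cabsR ger0_norm //.
by rewrite ler_wpM2l ?cabs_ge0 // lerXn2r ?nnegrE ?cabs_ge0.
Qed.

Lemma asumr_weaken c s r M : asumr c s M -> 0 <= r <= s -> asumr c r M.
Proof.
by move=> cM /andP[r0 rs]; apply: asumr_le cM _; rewrite cabsR ger0_norm.
Qed.

Lemma ps_weaken f c s r : ps f c s -> 0 < r <= s -> ps f c r.
Proof.
move=> [s0 [M cM] fc] /andP[r0 rs]; split=> //.
  by exists M; apply: asumr_weaken cM _; rewrite ltW.
by move=> x xr; apply: fc; apply: lt_le_trans rs.
Qed.

Lemma ps_ext f g c s : (forall x, cabs x < s -> f x = g x) ->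
  ps f c s -> ps g c s.
Proof.
by move=> fg [s0 cM fc]; split=> // x xs; rewrite -fg //; apply: fc.
Qed.

Lemma eq_ps f c d s : c =1 d -> ps f c s -> ps f d s.
Proof. by move=> /funext ->. Qed.

Lemma ps_exists c s M : 0 < s -> asumr c s M -> exists f, ps f c s.
Proof.
move=> s0 cM; have /choice[f Hf] : forall x, exists S, cabs x < s ->
    sums (fun k => c k * x ^+ k) S.
  move=> x; case: (ltP (cabs x) s) => [xs|_]; last by exists 0.
  have [S HS] := asum_sums (asumr_le cM (ltW xs)).
  by exists S.
by exists f; split=> //; exists M.
Qed.

Lemma ps_bounded f c s : ps f c s ->
  exists2 M, 0 <= M & forall x, cabs x < s -> cabs (f x) <= M.
Proof.
move=> [s0 [M cM] fc]; exists M; first exact: asum_ge0 cM.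
by move=> x xs; apply: sums_le (asumr_le cM (ltW xs)) (fc _ xs).
Qed.

Lemma psD f g c d s : ps f c s -> ps g d s ->
  ps (fun x => f x + g x) (fun k => c k + d k) s.
Proof.
move=> [s0 [M cM] fc] [_ [M' dM] gd]; split=> //.
  exists (M + M') => N; apply: le_trans (lerD (cM N) (dM N)).
  by rewrite -big_split /=; apply: ler_sum => k _; rewrite mulrDl cabsD.
by move=> x xs; apply: eq_sums (sumsD (fc _ xs) (gd _ xs)) => k; rewrite mulrDl.
Qed.

Lemma psZ a f c s : ps f c s -> ps (fun x => a * f x) (fun k => a * c k) s.
Proof.
move=> [s0 [M cM] fc]; split=> //.
  exists (cabs a * M) => N; apply: le_trans (ler_wpM2l (cabs_ge0 a) (cM N)).
  by rewrite mulr_sumr; apply: ler_sum => k _; rewrite -mulrA cabsM.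
by move=> x xs; apply: eq_sums (sumsZ a (fc _ xs)) => k; rewrite mulrA.
Qed.

Lemma psB f g c d s : ps f c s -> ps g d s ->
  ps (fun x => f x - g x) (fun k => c k - d k) s.
Proof.
move=> fc /(psZ (-1)) gd; apply: (eq_ps _ (ps_ext _ (psD fc gd))) => [k|x _].
  by rewrite mulN1r.
by rewrite mulN1r.
Qed.

Lemma ps_cst a s : 0 < s -> ps (fun=> a) (fun k => if k == 0%N then a else 0) s.
Proof.
move=> s0; split=> //.
  exists (cabs a) => -[|N]; first by rewrite big_ord0 cabs_ge0.
  rewrite big_ord_recl /= big1 ?addr0 ?expr0 ?mulr1 // => i _.
  by rewrite mul0r cabs0.
move=> x _; have : sums (fun k => (if k == 0%N then a else 0) * x ^+ k)
   (\sum_(k < 1) (if val k == 0%N then a else 0) * x ^+ k).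
  by apply: sums_finite => -[//|k] _; rewrite mul0r.
by rewrite big_ord1 expr0 mulr1.
Qed.

Lemma ps_big n (F : 'I_n -> R[i] -> R[i]) (C : 'I_n -> nat -> R[i]) s :
  0 < s -> (forall i, ps (F i) (C i) s) ->
  ps (fun x => \sum_i F i x) (fun k => \sum_i C i k) s.
Proof.
move=> s0 FC; elim: (index_enum _) => [|i l IH].
  apply: (eq_ps _ (ps_ext _ (ps_cst 0 s0))) => [k|x _]; rewrite big_nil //.
  by case: ifP.
apply: (eq_ps _ (ps_ext _ (psD (FC i) IH))) => [k|x _]; by rewrite big_cons.
Qed.

Lemma cprod_exp c d x m :
  cprod (fun k => c k * x ^+ k) (fun k => d k * x ^+ k) m = cprod c d m * x ^+ m.
Proof.
rewrite /cprod mulr_suml; apply: eq_bigr => k _.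
by rewrite mulrACA -exprD subnKC // -ltnS.
Qed.

Lemma psM f g c d s : ps f c s -> ps g d s ->
  ps (fun x => f x * g x) (cprod c d) s.
Proof.
move=> [s0 [M cM] fc] [_ [M' dM] gd]; split=> //.
  exists (M * M') => N; have := asum_cprod cM dM N.
  by under eq_bigr do rewrite cprod_exp.
move=> x xs; have := sums_cprod (asumr_le cM (ltW xs)) (asumr_le dM (ltW xs))
  (fc _ xs) (gd _ xs).
by apply: eq_sums => k; rewrite cprod_exp.
Qed.

Lemma ps_mulx f c s : ps f c s ->
  ps (fun x => x * f x) (fun k => if k is k'.+1 then c k' else 0) s.
Proof.
move=> [s0 [M cM] fc]; split=> //.
  exists (s * M) => -[|N]; first by rewrite big_ord0 mulr_ge0 ?(asum_ge0 cM) ?(ltW s0).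
  rewrite big_ord_recl /= mul0r cabs0 add0r.
  apply: le_trans (ler_wpM2l (ltW s0) (cM N)); rewrite mulr_sumr.
  apply: ler_sum => k _; rewrite ?lift0 /bump ?leq0n ?add1n !cabsM !cabsX cabsR gtr0_norm // exprS.
  by rewrite mulrCA.
move=> x xs; set z := (fun k => _ * _).
have : sums (fun k => z k.+1) (x * f x).
  by apply: eq_sums (sumsZ x (fc _ xs)) => k; rewrite /z exprS mulrCA.
by move/sums_recl_inv; rewrite /z mul0r add0r.
Qed.

Lemma ps_shift f c s : ps f c s ->
  ps (fun x => if x == 0 then c 1%N else (f x - c 0%N) / x) (fun k => c k.+1) s.
Proof.
move=> [s0 [M cM] fc]; split=> //.
  exists (M / s) => N; rewrite ler_pdivlMr // mulr_suml.
  apply: le_trans (cM N.+1); rewrite big_ord_recl /= -[X in X <= _]add0r.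
  rewrite lerD ?cabs_ge0 //.
  apply: ler_sum => k _; rewrite ?lift0 /bump ?leq0n ?add1n !cabsM !cabsX cabsR gtr0_norm // exprSr.
  by rewrite mulrA.
move=> x xs; case: eqVneq => [->|x0].
  have : sums (fun k => c k.+1 * (0 : R[i]) ^+ k) (\sum_(k < 1) c k.+1 * 0 ^+ k).
    by apply: sums_finite => -[//|k] _; rewrite expr0n /= mulr0.
  by rewrite big_ord1 expr0 mulr1.
have := sumsZ x^-1 (sums_recl (fc _ xs)); rewrite expr0 mulr1 mulrC.
by apply: eq_sums => k; rewrite exprS mulrCA mulKf.
Qed.

Lemma ps_lin f c s : ps f c s ->
  exists2 B, 0 <= B & forall x, cabs x < s -> cabs (f x - c 0%N) <= B * cabs x.
Proof.
move=> fc; have [B B0 HB] := ps_bounded (ps_shift fc).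
exists B => // x xs; have [x0|x0] := eqVneq x 0.
  have [s0 _ /(_ 0)] := fc; rewrite cabs0 => /(_ s0) f0.
  have : sums (fun k => c k * (0 : R[i]) ^+ k) (\sum_(k < 1) c k * 0 ^+ k).
    by apply: sums_finite => -[//|k] _; rewrite expr0n /= mulr0.
  move/(sums_unique f0); rewrite x0 big_ord1 expr0 mulr1 => ->.
  by rewrite subrr cabs0 mulr0.
have := HB x xs; rewrite (negPf x0) cabsM cabsV ler_pdivrMr //.
by rewrite cabs_gt0.
Qed.

Lemma ps_at0 f c s : ps f c s -> f 0 = c 0%N.
Proof.
move=> fc; have [s0 _ _] := fc; have [B B0 /(_ 0)] := ps_lin fc.
rewrite cabs0 mulr0 => /(_ s0) f0; apply/subr0_eq/eqP.
by rewrite -cabs_eq0 eq_le f0 cabs_ge0.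
Qed.

(** Feeds the averaging argument of [la_no_max], which computes the terms up to degree 2 exactly. *)
Lemma ps_cubic f c s : ps f c s ->
  exists2 B, 0 <= B & forall x, cabs x < s ->
    cabs (f x - c 0%N - c 1%N * x - c 2%N * x ^+ 2) <= B * cabs x ^+ 3.
Proof.
move=> fc; have [B B0 HB] := ps_bounded (ps_shift (ps_shift (ps_shift fc))).
exists B => // x xs; have [->|x0] := eqVneq x 0.
  by rewrite (ps_at0 fc) !expr0n /= !mulr0 !subr0 subrr cabs0 expr0n /= mulr0.
have := HB x xs; rewrite (negPf x0) => H.
have -> : f x - c 0%N - c 1%N * x - c 2%N * x ^+ 2
  = ((((f x - c 0%N) / x - c 1%N) / x) - c 2%N) / x * x ^+ 3 by field.
rewrite cabsM cabsX.
by rewrite ler_wpM2r ?exprn_ge0 ?cabs_ge0.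
Qed.

Lemma ps_eq0_head f c s (e : R) : ps f c s -> 0 < e ->
  (forall y : R, 0 < y < e -> f y%:C = 0) -> c 0%N = 0.
Proof.
move=> fc e0 f0; have [B B0 HB] := ps_lin fc; have [s0 _ _] := fc.
apply/eqP; rewrite -cabs_eq0 eq_le cabs_ge0 andbT.
apply/ler_addgt0Pr => d d0; rewrite add0r.
pose y := Num.min (Num.min (s / 2) (e / 2)) (d / (B + 1)).
have B1 : 0 < B + 1 by lra.
have y0 : 0 < y by rewrite !lt_min !divr_gt0.
have ys : y < s by rewrite !gt_min; apply/orP; left; apply/orP; left; lra.
have ye : y < e by rewrite !gt_min; apply/orP; left; apply/orP; right; lra.
have yd : y <= d / (B + 1) by rewrite ge_min lexx orbT.
have := HB y%:C; rewrite cabsR gtr0_norm // => /(_ ys).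
rewrite f0 ?y0 // sub0r cabsN => /le_trans; apply.
move: yd; rewrite ler_pdivlMr //; nra.
Qed.

(** Identity theorem along a segment of the positive reals: the constant term is the limit at 0, and
    division by the variable brings the next coefficient into its place. It is applied to the
    corrections as functions of eps. *)
Lemma ps_eq0 f c s (e : R) : ps f c s -> 0 < e ->
  (forall y : R, 0 < y < e -> f y%:C = 0) -> forall k, c k = 0.
Proof.
move=> fc e0 f0 k; elim: k f c fc f0 => [|k IH] f c fc f0.
  exact: ps_eq0_head fc e0 f0.
have c0 := ps_eq0_head fc e0 f0.
apply: (IH _ _ (ps_shift fc)) => y /[dup] /f0 -> /andP[y0 _].
rewrite c0 subrr mul0r; case: eqP => // /(@complexI R) y00.
by move: y0; rewrite y00 ltxx.
Qed.

Lemma ps_uniq f g c d s (e : R) : ps f c s -> ps g d s -> 0 < e ->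
  (forall y, cabs y < e -> f y = g y) -> c =1 d.
Proof.
move=> fc gd e0 fg k; apply/subr0_eq.
apply: (ps_eq0 (psB fc gd) e0) => y /andP[y0 ye].
by rewrite fg ?subrr // cabsR gtr0_norm.
Qed.

(** The second-order Taylor bound k^2 |h|^2 r^(k-2), multiplied by [r ^+ 2] so that neither a
    negative exponent nor a division appears. *)
Lemma exp_taylor2 x h (r : R) k : cabs x <= r -> cabs (x + h) <= r ->
  cabs ((x + h) ^+ k - x ^+ k - h * (k%:R * x ^+ k.-1)) * r ^+ 2
  <= k%:R ^+ 2 * cabs h ^+ 2 * r ^+ k.
Proof.
move=> xr xhr; have r0 : 0 <= r := le_trans (cabs_ge0 _) xr.
elim: k => [|k IH].
  rewrite !expr0 subrr mul0r mulr0 subr0 cabs0 mul0r.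
  by rewrite !mulr_ge0 ?exprn_ge0 ?cabs_ge0.
have [->|k0] := posnP k.
  rewrite (_ : _ - _ - _ = 0); last by rewrite /=; ring.
  rewrite cabs0 mul0r.
  by rewrite !mulr_ge0 ?exprn_ge0 ?cabs_ge0.
set E := (X in cabs X * _ <= _) in IH.
have -> : (x + h) ^+ k.+1 - x ^+ k.+1 - h * (k.+1%:R * x ^+ k.+1.-1)
  = (x + h) * E + k%:R * h ^+ 2 * x ^+ k.-1.
  rewrite /E -(prednK k0) /= !exprS -[k.-1.+2%:R]natr1; ring.
have E2 : cabs (k%:R * h ^+ 2 * x ^+ k.-1) * r ^+ 2 <= k%:R * cabs h ^+ 2 * r ^+ k.+1.
  rewrite !cabsM !cabsX cabs_nat -!mulrA ler_wpM2l // ler_wpM2l ?exprn_ge0 ?cabs_ge0 //.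
  have -> : r ^+ k.+1 = r ^+ k.-1 * r ^+ 2 by rewrite -exprD addn2 prednK.
  by rewrite ler_wpM2l ?cabs_ge0 // ler_wpM2r ?exprn_ge0 // lerXn2r ?nnegrE ?cabs_ge0.
have E1 : cabs ((x + h) * E) * r ^+ 2 <= k%:R ^+ 2 * cabs h ^+ 2 * r ^+ k.+1.
  have -> : k%:R ^+ 2 * cabs h ^+ 2 * r ^+ k.+1 = r * (k%:R ^+ 2 * cabs h ^+ 2 * r ^+ k).
    by rewrite (exprS r k) mulrCA.
  rewrite cabsM -mulrA; apply: ler_pM => //; first exact: cabs_ge0.
  by rewrite mulr_ge0 ?cabs_ge0 ?exprn_ge0.
apply: (@le_trans _ _ ((cabs ((x + h) * E) + cabs (k%:R * h ^+ 2 * x ^+ k.-1)) * r ^+ 2)).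
  by rewrite ler_wpM2r ?exprn_ge0 // cabsD.
rewrite mulrDl; apply: le_trans (lerD E1 E2) _; rewrite -natr1.
have t0 : (0 : R) <= k%:R by [].
have X0 : 0 <= cabs h ^+ 2 * r ^+ k.+1 by rewrite mulr_ge0 ?exprn_ge0 ?cabs_ge0.
have := mulr_ge0 t0 X0; move: X0.
by move: (k%:R : R) (cabs h ^+ 2) (r ^+ k.+1) => t X Y; nra.
Qed.

Lemma sqr_le_4X k : (k ^ 2 <= 4 ^ k)%N.
Proof. by have := ltn_expl k (isT : (1 < 2)%N) => /ltnW; rewrite -leq_sqr -expnM mulnC expnM. Qed.

(** Halving the radius absorbs the factor [k.+1]. For the remainder, x and x + h stay below [s / 4],
    where the Taylor bound k^2 (s/4)^k is at most s^k because k^2 <= 4^k. *)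
Lemma ps_deriv f c s : ps f c s ->
  exists2 f1, ps f1 (fun k => k.+1%:R * c k.+1) (s / 2)
    & forall x, cabs x < s / 8 -> is_derive x 1 f (f1 x).
Proof.
move=> fc; have [s0 [M cM] fs] := fc.
have M0 := asum_ge0 cM.
have c1M : asumr (fun k => k.+1%:R * c k.+1) (s / 2) (M / s).
  move=> N; rewrite ler_pdivlMr // mulr_suml.
  apply: le_trans (cM N.+1); rewrite big_ord_recl /= -[X in X <= _]add0r.
  rewrite lerD ?cabs_ge0 //.
  apply: ler_sum => k _; rewrite ?lift0 /bump ?leq0n ?add1n !cabsM !cabsX !cabsR cabs_nat.
  rewrite !gtr0_norm ?divr_gt0 // expr_div_n exprSr mulrA ler_wpM2r ?(ltW s0) //.
  rewrite -mulrA mulrCA ler_wpM2l ?cabs_ge0 // mulrCA ler_piMr ?exprn_ge0 ?(ltW s0) //.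
  rewrite ler_pdivrMr ?exprn_gt0 // mul1r -natrX ler_nat.
  exact: ltn_expl.
have [f1 f1c] := ps_exists (divr_gt0 s0 (ltr0Sn _ 1)) c1M.
exists f1 => // x xs; apply/is_derive_cabs => e e0.
set B := M / (s / 4) ^+ 2.
have B0 : 0 <= B by rewrite divr_ge0 // exprn_ge0 // divr_ge0 // ltW.
exists (Num.min (s / 8) (e / (B + 1))).
  by rewrite lt_min !divr_gt0 //; lra.
move=> h; rewrite lt_min => /andP[hs he].
have xh : cabs (x + h) < s / 4 by apply: le_lt_trans (cabsD _ _) _; lra.
suff : cabs (f (x + h) - f x - f1 x * h) <= B * cabs h ^+ 2.
  move=> /le_trans; apply; rewrite expr2 mulrA ler_wpM2r ?cabs_ge0 //.
  move: he; rewrite ltr_pdivlMr; last by lra.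
  by have := cabs_ge0 h; nra.
have S1 := fs (x + h); have S2 := fs x.
have [_ _ S3] := f1c.
have {}S1 : sums (fun k => c k * (x + h) ^+ k) (f (x + h)) by apply: S1; lra.
have {}S2 : sums (fun k => c k * x ^+ k) (f x) by apply: S2; lra.
have {}S3 : sums (fun k => k.+1%:R * c k.+1 * x ^+ k) (f1 x) by apply: S3; lra.
have {}S3 : sums (fun k => k%:R * c k * x ^+ k.-1) (f1 x).
  have := @sums_recl_inv _ (fun k => k%:R * c k * x ^+ k.-1) _ S3.
  by rewrite !mul0r add0r.
have S := sumsD S1 (sumsD (sumsZ (-1) S2) (sumsZ (-h) S3)).
have -> : f (x + h) - f x - f1 x * h = f (x + h) + (-1 * f x + - h * f1 x) by ring.
apply: sums_le S => N; apply: le_trans (_ : (\sum_(k < N) cabs (c k * s%:C ^+ k)) *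
   (cabs h ^+ 2 / (s / 4) ^+ 2) <= _); last first.
  have -> : B * cabs h ^+ 2 = M * (cabs h ^+ 2 / (s / 4) ^+ 2).
    by rewrite /B mulrAC mulrA.
  apply: ler_wpM2r; last exact: cM.
  by rewrite mulr_ge0 ?exprn_ge0 ?cabs_ge0 // invr_ge0 exprn_ge0 // divr_ge0 // ltW.
rewrite mulr_suml; apply: ler_sum => k _.
have -> : c k * (x + h) ^+ k + (-1 * (c k * x ^+ k) + - h * (k%:R * c k * x ^+ k.-1))
  = c k * ((x + h) ^+ k - x ^+ k - h * (k%:R * x ^+ k.-1)) by ring.
have s40 : 0 < s / 4 by rewrite divr_gt0.
rewrite [X in X <= _]cabsM [cabs (c k * _)]cabsM cabsX cabsR gtr0_norm //.
rewrite -(mulrA (cabs (c k))) ler_wpM2l ?cabs_ge0 // [X in _ <= X]mulrA.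
rewrite ler_pdivlMr ?exprn_gt0 //.
apply: le_trans (exp_taylor2 k _ (ltW xh)) _; first lra.
rewrite mulrAC ler_wpM2r ?exprn_ge0 ?cabs_ge0 // expr_div_n mulrA.
rewrite ler_pdivrMr ?exprn_gt0 // mulrC ler_wpM2l ?exprn_ge0 ?(ltW s0) //.
by rewrite -!natrX ler_nat sqr_le_4X.
Qed.

End PowerSeries.

(** * Double power series in the parameter and the variable *)

Section DoubleSeries.
Variable R : realType.
Implicit Types (f g : R[i] -> R[i] -> R[i]) (c d : nat -> nat -> R[i]).
Implicit Types (s r M : R) (e x : R[i]).

Definition sqsum c s M := forall N : nat,
  \sum_(k < N) \sum_(l < N) cabs (c k l) * s ^+ (k + l) <= M.

(** Square partial sums as in [analytic2_at], with the absolute bound in [R]; [ds_rows] trades them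
    for power series in x whose coefficients are power series in eps. *)
Definition ds f c s :=
  [/\ 0 < s, exists M, sqsum c s M
    & forall e x, cabs e < s -> cabs x < s ->
      cvgs (fun N : nat => \sum_(k < N) \sum_(l < N) c k l * e ^+ k * x ^+ l)
        (f e x)].

Lemma analytic2_at_ds f : analytic2_at f 0 0 <-> exists c s, ds f c s.
Proof.
have E c s N : (\sum_(k < N) \sum_(l < N) cabs (c k l) * s ^+ (k + l))%:C
    = \sum_(k < N) \sum_(l < N) `|c k l| * s%:C ^+ (k + l) :> R[i].
  rewrite rmorph_sum; apply: eq_bigr => k _; rewrite rmorph_sum.
  by apply: eq_bigr => l _; rewrite normcabs rmorphM rmorphXn.
split=> [[c [s [M [s0 cM fc]]]]|[c [s [s0 [M cM] fc]]]].
  exists c, s; split=> //.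
    by exists M => N; rewrite -lecR E; apply: cM.
  move=> e x es xs; apply/cvgsP; have := fc e x.
  by rewrite !subr0 !ltcabs => /(_ es xs).
exists c, s, M; split=> //.
  by move=> N; rewrite -E lecR; apply: cM.
move=> e x; rewrite !subr0 !ltcabs => es xs.
by apply/cvgsP; apply: fc.
Qed.

Lemma sqsum_scale c s M e x : 0 <= s -> sqsum c s M -> cabs e <= s -> cabs x <= s ->
  forall N : nat, \sum_(k < N) \sum_(l < N) cabs (c k l * e ^+ k * x ^+ l) <= M.
Proof.
move=> s0 cM es xs N; apply: le_trans (cM N); apply: ler_sum => k _.
apply: ler_sum => l _; rewrite !cabsM !cabsX -mulrA ler_wpM2l ?cabs_ge0 // exprD.
by apply: ler_pM; rewrite ?exprn_ge0 ?cabs_ge0 // lerXn2r ?nnegrE ?cabs_ge0.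
Qed.

Lemma cabs_realexp s n : 0 <= s -> cabs (s%:C ^+ n) = s ^+ n.
Proof. by move=> s0; rewrite cabsX cabsR ger0_norm. Qed.

Lemma sqsum_col c s M e : 0 < s -> sqsum c s M -> cabs e <= s -> forall l,
  asum (fun k => c k l * e ^+ k) (M / s ^+ l).
Proof.
move=> s0 cM es l; have := sqsum_scale (ltW s0) cM es (x := s%:C).
rewrite cabsR gtr0_norm // => /(_ (lexx s)) cM'.
move=> N; have H := @square_col _ (fun k l => c k l * e ^+ k * s%:C ^+ l) M l cM'.
rewrite ler_pdivlMr ?exprn_gt0 // mulr_suml; apply: le_trans (H N).
by apply: ler_sum => k _; rewrite [X in _ <= X]cabsM cabs_realexp // ltW.
Qed.

(* The square partial sums of an absolutely convergent double series converge
   to the iterated sum. *)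
Lemma ds_rows f c s :
  [/\ 0 < s, exists M, sqsum c s M
    & forall e, cabs e < s -> exists2 g : nat -> R[i],
        (forall l, sums (fun k => c k l * e ^+ k) (g l)) & ps (f e) g s]
  <-> ds f c s.
Proof.
have key s0 M e x (g : nat -> R[i]) : 0 < s0 -> sqsum c s0 M -> cabs e <= s0 ->
    cabs x <= s0 -> (forall l, sums (fun k => c k l * e ^+ k) (g l)) ->
    asum (fun l => g l * x ^+ l) M /\ forall G, sums (fun l => g l * x ^+ l) G ->
    cvgs (fun N : nat => \sum_(k < N) \sum_(l < N) c k l * e ^+ k * x ^+ l) G.
  move=> s00 cM es xs gs; have cM' := sqsum_scale (ltW s00) cM es xs.
  have gx l : sums (fun k => c k l * e ^+ k * x ^+ l) (g l * x ^+ l).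
    by rewrite mulrC; apply: eq_sums (sumsZ (x ^+ l) (gs l)) => k; rewrite mulrC.
  split; first exact: (square_asum cM' gx).
  by move=> G HG; apply: (square_sums cM' gx HG).
split=> [[s0 [M cM] fg]|[s0 [M cM] fc]]; split=> //.
- by exists M.
- move=> e x es xs; have [g gs [_ _ gf]] := fg _ es.
  have [_] := key _ _ _ _ _ s0 cM (ltW es) (ltW xs) gs; apply.
  exact: gf.
- by exists M.
- move=> e es.
  have /choice[g gs] l : exists S, sums (fun k => c k l * e ^+ k) S.
    exact: asum_sums (sqsum_col s0 cM (ltW es) l).
  exists g => //; split=> //.
    have ss : cabs s%:C <= s by rewrite cabsR gtr0_norm.
    by exists M; have [] := key _ _ _ _ _ s0 cM (ltW es) ss gs.
  move=> x xs; have [/asum_sums[G HG] HH] := key _ _ _ _ _ s0 cM (ltW es) (ltW xs) gs.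
  by rewrite (cvgs_unique (fc _ _ es xs) (HH _ HG)).
Qed.

Lemma ds_exists c s M : 0 < s -> sqsum c s M -> exists f, ds f c s.
Proof.
move=> s0 cM; have /choice[f Hf] : forall e, exists h : R[i] -> R[i], cabs e < s ->
    exists2 g : nat -> R[i], (forall l, sums (fun k => c k l * e ^+ k) (g l))
      & ps h g s.
  move=> e; case: (ltP (cabs e) s) => [es|_]; last by exists (fun=> 0).
  have /choice[g gs] l : exists S, sums (fun k => c k l * e ^+ k) S.
    exact: asum_sums (sqsum_col s0 cM (ltW es) l).
  have [|h hg] := @ps_exists _ g s M s0.
    apply: (@square_asum _ (fun k l => c k l * e ^+ k * s%:C ^+ l)).
      apply: (sqsum_scale (ltW s0) cM (ltW es)).
      by rewrite cabsR gtr0_norm.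
    move=> l; rewrite mulrC; apply: eq_sums (sumsZ (s%:C ^+ l) (gs l)) => k.
    by rewrite mulrC.
  by exists h => _; exists g.
by exists f; apply/ds_rows; split=> //; exists M.
Qed.

Lemma sqsum_weaken c s r M : sqsum c s M -> 0 <= r <= s -> sqsum c r M.
Proof.
move=> cM /andP[r0 rs] N; apply: le_trans (cM N); apply: ler_sum => k _.
apply: ler_sum => l _; rewrite ler_wpM2l ?cabs_ge0 // lerXn2r ?nnegrE //.
exact: le_trans rs.
Qed.

Lemma ds_weaken f c s r : ds f c s -> 0 < r <= s -> ds f c r.
Proof.
move=> [s0 [M cM] fc] /andP[r0 rs]; split=> //.
  by exists M; apply: sqsum_weaken cM _; rewrite ltW.
by move=> e x es xs; apply: fc; apply: lt_le_trans rs.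
Qed.

Lemma ds_ext f g c s : (forall e x, cabs e < s -> cabs x < s -> f e x = g e x) ->
  ds f c s -> ds g c s.
Proof. by move=> fg [s0 cM fc]; split=> // e x es xs; rewrite -fg //; apply: fc. Qed.

Lemma dsD f g c d s : ds f c s -> ds g d s ->
  ds (fun e x => f e x + g e x) (fun k l => c k l + d k l) s.
Proof.
move=> [s0 [M cM] fc] [_ [M' dM] gd]; split=> //.
  exists (M + M') => N; apply: le_trans (lerD (cM N) (dM N)).
  rewrite -big_split /=; apply: ler_sum => k _; rewrite -big_split /=.
  apply: ler_sum => l _; rewrite -mulrDl ler_wpM2r ?exprn_ge0 ?(ltW s0) //.
  exact: cabsD.
move=> e x es xs; apply: (cvgs_near (N := 0)) (cvgsD (fc e x es xs) (gd e x es xs)).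
move=> n _; rewrite -big_split /=; apply: eq_bigr => k _; rewrite -big_split /=.
by apply: eq_bigr => l _; rewrite !mulrDl.
Qed.

Definition cprod2 c d k l : R[i] :=
  \sum_(a < k.+1) \sum_(b < l.+1) c a b * d (k - a)%N (l - b)%N.

Lemma square_cprod2 c d s N : 0 <= s ->
  \sum_(k < N) \sum_(l < N) cabs (cprod2 c d k l) * s ^+ (k + l)
  <= (\sum_(k < N) \sum_(l < N) cabs (c k l) * s ^+ (k + l)) *
     (\sum_(k < N) \sum_(l < N) cabs (d k l) * s ^+ (k + l)).
Proof.
move=> s0.
pose F a b k l := cabs (c a b) * s ^+ (a + b) * (cabs (d k l) * s ^+ (k + l)).
have F0 a b k l : 0 <= F a b k l by rewrite !mulr_ge0 ?cabs_ge0 ?exprn_ge0.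
apply: (@le_trans _ _ (\sum_(k < N) \sum_(a < k.+1) \sum_(l < N) \sum_(b < l.+1)
    F a b (k - a)%N (l - b)%N)).
  apply: ler_sum => k _; rewrite exchange_big /=; apply: ler_sum => l _.
  apply: le_trans (ler_wpM2r (exprn_ge0 _ s0) (cabs_sum _ _ _)) _.
  rewrite mulr_suml; apply: ler_sum => a _.
  apply: le_trans (ler_wpM2r (exprn_ge0 _ s0) (cabs_sum _ _ _)) _.
  rewrite mulr_suml; apply: ler_sum => b _; rewrite /F cabsM.
  have -> : (k + l = (a + b) + ((k - a) + (l - b)))%N.
    by rewrite addnACA !subnKC // -ltnS.
  by rewrite exprD mulrACA.
pose F1 a k := \sum_(l < N) \sum_(b < l.+1) F a b k (l - b)%N.
rewrite (sum_triangle F1).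
have E : \sum_(a < N) \sum_(k < N) \sum_(b < N) \sum_(l < N) F a b k l
   = (\sum_(a < N) \sum_(b < N) cabs (c a b) * s ^+ (a + b)) *
     (\sum_(k < N) \sum_(l < N) cabs (d k l) * s ^+ (k + l)).
  rewrite mulr_suml; apply: eq_bigr => a _; rewrite exchange_big mulr_suml /=.
  apply: eq_bigr => b _; rewrite mulr_sumr; apply: eq_bigr => k _.
  by rewrite mulr_sumr.
apply: (@le_trans _ _ (\sum_(a < N) \sum_(k < N) \sum_(b < N) \sum_(l < N) F a b k l)).
  apply: ler_sum => a _.
  apply: (@le_trans _ _ (\sum_(k < N - a) \sum_(b < N) \sum_(l < N) F a b k l)).
    apply: ler_sum => k _; rewrite /F1 (sum_triangle (fun b l => F a b k l)).
    apply: ler_sum => b _; apply: (@psum_mono _ (F a b k)); rewrite ?leq_subr //.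
  apply: (@psum_mono _ (fun k => \sum_(b < N) \sum_(l < N) F a b k l)).
    by move=> k; rewrite sumr_ge0 // => b _; rewrite sumr_ge0.
  exact: leq_subr.
by rewrite E.
Qed.

Lemma sqsum_cprod2 c d s M M' : 0 <= s -> sqsum c s M -> sqsum d s M' ->
  sqsum (cprod2 c d) s (M * M').
Proof.
move=> s0 cM dM N; apply: le_trans (square_cprod2 c d N s0) _.
by apply: ler_pM => //; rewrite !sumr_ge0 // => k _; rewrite sumr_ge0 // => l _;
  rewrite mulr_ge0 ?cabs_ge0 ?exprn_ge0.
Qed.

(** At a fixed parameter this is a product of power series in x, and each of its coefficients is a
    finite sum of Cauchy products in eps. *)
Lemma dsM f g c d s : ds f c s -> ds g d s ->
  ds (fun e x => f e x * g e x) (cprod2 c d) s.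
Proof.
move=> /ds_rows[s0 [M cM] fc] /ds_rows[_ [M' dM] gd]; apply/ds_rows; split=> //.
  by exists (M * M'); apply: sqsum_cprod2 => //; rewrite ltW.
move=> e es; have [u us uf] := fc _ es; have [v vs vg] := gd _ es.
exists (cprod u v); last exact: psM.
move=> l; have S (b : 'I_l.+1) := sums_cprod (sqsum_col s0 cM (ltW es) b)
   (sqsum_col s0 dM (ltW es) (l - b)%N) (us b) (vs (l - b)%N).
apply: eq_sums (sums_big (index_enum _) xpredT S) => k.
rewrite /cprod2 [in RHS]exchange_big mulr_suml /=; apply: eq_bigr => b _.
exact: (cprod_exp (c^~ b) (d^~ (l - b)%N)).
Qed.

Lemma ds_fst (f : R[i] -> R[i]) (c : nat -> R[i]) s : ps f c s ->
  ds (fun e _ => f e) (fun k l => if l == 0%N then c k else 0) s.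
Proof.
move=> [s0 [M cM] fc]; apply/ds_rows; split=> //.
  exists M => N; apply: le_trans (cM N); apply: ler_sum => k _.
  case: N k => [[]//|N] k; rewrite big_ord_recl big1 /= => [|l _].
    by rewrite addr0 addn0 cabsM cabs_realexp // ltW.
  by rewrite cabs0 mul0r.
move=> e es; exists (fun l => if l == 0%N then f e else 0); last exact: ps_cst.
move=> [|l] /=; first exact: fc.
by have := sumsZ 0 (fc _ es); rewrite mul0r; apply: eq_sums => k; rewrite !mul0r.
Qed.

Lemma ds_snd (f : R[i] -> R[i]) (c : nat -> R[i]) s : ps f c s ->
  ds (fun _ x => f x) (fun k l => if k == 0%N then c l else 0) s.
Proof.
move=> fps; have [s0 [M cM] fc] := fps; apply/ds_rows; split=> //.
  exists M => -[|N]; first by rewrite big_ord0 (asum_ge0 cM).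
  apply: le_trans (cM N.+1); rewrite big_ord_recl [X in _ + X]big1 /= => [|k _]; last first.
    by rewrite big1 // => l _; rewrite cabs0 mul0r.
  by rewrite addr0; apply: ler_sum => k _; rewrite add0n cabsM cabs_realexp // ltW.
move=> e es; exists c => // l.
have [_ _ /(_ e es)] := ps_cst (c l) s0.
by apply: eq_sums => k; case: k.
Qed.

Definition analytic20 f := exists c s, ds f c s.

Lemma analytic20_ext f g r : 0 < r ->
  (forall e x, cabs e < r -> cabs x < r -> f e x = g e x) ->
  analytic20 f -> analytic20 g.
Proof.
move=> r0 fg [c [s fc]]; have [s0 _ _] := fc; exists c, (Num.min s r).
apply: (ds_ext (f := f)).
  by move=> e x; rewrite !lt_min => /andP[_ er] /andP[_ xr]; apply: fg.
by apply: ds_weaken fc _; rewrite lt_min s0 r0 ge_min lexx.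
Qed.

Lemma ds_common f g : analytic20 f -> analytic20 g ->
  exists s c d, ds f c s /\ ds g d s.
Proof.
move=> [c [s fc]] [d [r gd]]; exists (Num.min s r), c, d.
have [s0 _ _] := fc; have [r0 _ _] := gd.
split; [apply: ds_weaken fc _|apply: ds_weaken gd _];
  by rewrite lt_min s0 r0 ge_min lexx // orbT.
Qed.

Lemma analytic20D f g : analytic20 f -> analytic20 g ->
  analytic20 (fun e x => f e x + g e x).
Proof.
move=> fa ga; have [s [c [d [fc gd]]]] := ds_common fa ga.
by exists (fun k l => c k l + d k l), s; apply: dsD.
Qed.

Lemma analytic20M f g : analytic20 f -> analytic20 g ->
  analytic20 (fun e x => f e x * g e x).
Proof.
move=> fa ga; have [s [c [d [fc gd]]]] := ds_common fa ga.
by exists (cprod2 c d), s; apply: dsM.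
Qed.

Lemma analytic20_fst (f : R[i] -> R[i]) (c : nat -> R[i]) s : ps f c s ->
  analytic20 (fun e _ => f e).
Proof. by move=> /ds_fst fc; eexists; exists s; exact: fc. Qed.

Lemma analytic20_cst (a : R[i]) : analytic20 (fun _ _ => a).
Proof. exact: analytic20_fst (ps_cst a ltr01). Qed.

Lemma ps_id s : 0 < s -> ps id (fun k => if k is k'.+1 then if k' == 0%N then 1 else 0 else 0) s.
Proof. by move=> s0; apply: ps_ext (ps_mulx (ps_cst 1 s0)) => x _; rewrite mulr1. Qed.

Lemma analytic20_e : analytic20 (fun e _ => e).
Proof. exact: analytic20_fst (ps_id ltr01). Qed.

Lemma analytic20_x : analytic20 (fun _ x => x).
Proof. by have := ds_snd (ps_id ltr01) => H; eexists; exists 1; exact: H. Qed.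

Lemma analytic20B f g : analytic20 f -> analytic20 g ->
  analytic20 (fun e x => f e x - g e x).
Proof.
move=> fa ga; apply: (@analytic20_ext _ _ 1 ltr01 _
  (analytic20D fa (analytic20M (analytic20_cst (-1)) ga))).
by move=> e x _ _; rewrite mulN1r.
Qed.

(** Only convergence of the series near 0 is given. The terms at [r / 2] are therefore bounded, and
    those at [r / 4] are dominated by a geometric series of ratio 1/2. *)
Lemma analytic_at0_ps (f : R[i] -> R[i]) : analytic_at f 0 ->
  exists (c : nat -> R[i]) s, ps f c s.
Proof.
move=> [c /nbhs_cabs[r r0 H]]; exists c, (r / 4).
have r2 : 0 < r / 2 by rewrite divr_gt0.
have S x : cabs x < r -> sums (fun k => c k * x ^+ k) (f x).
  move=> xr; have := H x; rewrite subr0 => /(_ xr)/cvgsP.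
  by apply: (cvgs_near (N := 0)) => n _; rewrite /series /= big_mkord.
have [|N HN] := S (r / 2)%:C _ 1 ltr01.
  by rewrite cabsR gtr0_norm //; lra.
pose z k := c k * (r / 2)%:C ^+ k.
(* From [N] on the partial sums lie within 1 of the limit, so the terms are below 2; the finitely
   many earlier terms are added in. *)
pose B := 2 + \sum_(k < N) cabs (z k).
have zB k : cabs (z k) <= B.
  have s0 : 0 <= \sum_(k < N) cabs (z k) by rewrite sumr_ge0 // => i _; apply: cabs_ge0.
  case: (ltnP k N) => [kN|Nk].
    rewrite /B (bigD1 (Ordinal kN)) //= addrCA lerDl addr_ge0 //.
    by rewrite sumr_ge0 // => i _; apply: cabs_ge0.
  have h1 := HN _ (leqW Nk); have h2 := HN _ Nk.
  have := cabs_distD (\sum_(k < k.+1) z k) (f (r / 2)%:C) (\sum_(k < k) z k).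
  rewrite [X in X - _]big_ord_recr /= addrAC subrr add0r (cabsB (f _)).
  move: h1 h2; rewrite /B -/(z) => h1 h2.
  have := h1; have := h2; rewrite /z; lra.
split; first by rewrite divr_gt0.
  exists (B * 2) => n.
  have : \sum_(k < n) cabs (c k * (r / 4)%:C ^+ k) <= B * \sum_(k < n) (2^-1) ^+ k.
    rewrite mulr_sumr; apply: ler_sum => k _.
    have -> : (r / 4)%:C = (r / 2)%:C * (2^-1 : R)%:C.
      by rewrite -rmorphM; congr (_%:C); field.
    rewrite exprMn mulrA cabsM cabs_realexp ?invr_ge0 // ler_wpM2r ?exprn_ge0 ?invr_ge0 //.
    exact: zB.
  move=> /le_trans; apply; rewrite ler_wpM2l //.
    by rewrite /B addr_ge0 // sumr_ge0 // => i _; apply: cabs_ge0.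
  exact: geo_half.
by move=> x xr; apply: S; lra.
Qed.

End DoubleSeries.

(** * The corrected system and its contraction *)

Section WeightedSums.
Variable R : realType.
Implicit Types (a b V W kap : nat -> R) (M d : R).

Definition rsum b M := forall K : nat, \sum_(k < K) b k <= M.

Lemma rsum_ge0 b M : rsum b M -> 0 <= M.
Proof. by move=> /(_ 0%N); rewrite big_ord0. Qed.

Lemma rsum_term b M k : (forall k, 0 <= b k) -> rsum b M -> b k <= M.
Proof.
move=> b0 /(_ k.+1); rewrite big_ord_recr /=; apply: le_trans.
by rewrite lerDr sumr_ge0.
Qed.

Lemma rsumD a b M M' : rsum a M -> rsum b M' -> rsum (fun k => a k + b k) (M + M').
Proof. by move=> aM bM K; rewrite big_split lerD. Qed.

Lemma rsum_shift a b M d s : 0 <= d -> (forall k, 0 <= b k) -> rsum b M ->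
  (forall k, a k <= d * b (k + s)%N) -> rsum a (d * M).
Proof.
move=> d0 b0 bM ab K; apply: (@le_trans _ _ (d * \sum_(k < K) b (s + k)%N)).
  by rewrite mulr_sumr; apply: ler_sum => k _; rewrite addnC.
rewrite ler_wpM2l //; apply: le_trans (bM (s + K)%N).
by rewrite big_split_ord /= lerDr sumr_ge0.
Qed.

Lemma rsum_shiftr a b M d : 0 <= d -> rsum b M -> a 0%N <= 0 ->
  (forall k, a k.+1 <= d * b k) -> rsum a (d * M).
Proof.
move=> d0 bM a0 ab [|K].
  by rewrite big_ord0 mulr_ge0 // (rsum_ge0 bM).
rewrite big_ord_recl -[X in _ <= X]add0r lerD //.
apply: le_trans (ler_wpM2l d0 (bM K)); rewrite mulr_sumr.
by apply: ler_sum => k _; exact: ab.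
Qed.

Definition rprod kap V k : R := \sum_(c < k.+1) kap c * V (k - c)%N.

Lemma rprod_ge0 kap V : (forall k, 0 <= kap k) -> (forall k, 0 <= V k) ->
  forall k, 0 <= rprod kap V k.
Proof. by move=> k0 V0 k; rewrite sumr_ge0 // => c _; rewrite mulr_ge0. Qed.

(** Submultiplicativity of the weights makes convolution with [kap] bounded on the weighted
    l1-space, with norm at most the sum of the [kap k * rho ^+ k]. *)
Lemma rsum_prod kap V W M e rho : (forall k, 0 <= kap k) -> (forall k, 0 <= V k) ->
  0 <= rho -> (forall k, 0 <= W k) ->
  (forall k l, W (k + l)%N <= rho ^+ k * W l) ->
  rsum (fun k => kap k * rho ^+ k) e -> rsum (fun k => W k * V k) M ->
  rsum (fun k => W k * rprod kap V k) (e * M).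
Proof.
move=> kap0 V0 rho0 W0 WW kape VM K.
pose F c l := kap c * rho ^+ c * (W l * V l).
apply: (@le_trans _ _ (\sum_(k < K) \sum_(c < k.+1) F c (k - c)%N)).
  apply: ler_sum => k _; rewrite mulr_sumr; apply: ler_sum => c _.
  rewrite /F mulrCA -mulrA ler_wpM2l // mulrA ler_wpM2r //.
  by rewrite -{1}(subnKC (n := k) (m := c)) // -ltnS.
rewrite (sum_triangle F) /F.
apply: (@le_trans _ _ (\sum_(c < K) kap c * rho ^+ c * M)).
  by apply: ler_sum => c _; rewrite -mulr_sumr ler_wpM2l ?mulr_ge0 ?exprn_ge0.
by rewrite -mulr_suml ler_wpM2r // (rsum_ge0 VM).
Qed.

End WeightedSums.

(** * The scalar majorant of the fixed-point map *)

Section Majorant.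
Variable R : realType.
Variables (N : nat) (alpha A sg rho eta eta' : R) (kap kap' W : nat -> R).

(** Majorant of [fixop], with [sg] bounding |eps|: three terms of the rows i <> j for k < N, three
    for k >= N, and the one of row j. All are added, so that a single sequence [V] controls every
    row. *)
Definition major (V : nat -> R) (k : nat) : R :=
    (if (k < N)%N then alpha^-1 * (k.-1%:R * V k.-1) else 0)
  + (if (k < N)%N then alpha^-1 * (sg * (k.+1%:R * V k.+1)) else 0)
  + (if (k < N)%N then alpha^-1 * rprod kap V k else 0)
  + (if (k < N)%N then 0 else k%:R^-1 * (A * V k.+1))
  + (if (k < N)%N then 0 else k%:R^-1 * (sg * (k.+2%:R * V k.+2)))
  + (if (k < N)%N then 0 else k%:R^-1 * rprod kap V k.+1)
  + (if k is k'.+1 then k'.+1%:R^-1 * rprod kap' V k' else 0).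

(* Bounds making the map [major] a contraction of ratio 7/8 in the l1-norm with
   weights W; below the index N the weights have the small ratio alpha / (8 N)
   and from N on the larger ratio rho = 8 A / N, see [weights_exist]. *)
Record weights_ok : Prop := WeightsOk {
  w_alpha : 0 < alpha; w_A : 0 <= A; w_sg : 0 <= sg; w_rho : 0 <= rho;
  w_N : (0 < N)%N;
  w_kap : forall k, 0 <= kap k; w_kap' : forall k, 0 <= kap' k;
  w_gt0 : forall k, 0 < W k;
  w_kapS : rsum (fun k => kap k * rho ^+ k) eta;
  w_kapS' : rsum (fun k => kap' k * rho ^+ k) eta';
  w_sub : forall k l, W (k + l)%N <= rho ^+ k * W l;
  w_fwd : forall k, (k.+1 < N)%N -> W k.+1 * k%:R <= 8^-1 * alpha * W k;
  w_fwds : forall k, (k < N)%N -> W k * (sg * k.+1%:R) <= 8^-1 * alpha * W k.+1;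
  w_bwd : forall k, (N <= k)%N -> W k * A <= 8^-1 * k%:R * W k.+1;
  w_bwds : forall k, (N <= k)%N -> W k * (sg * k.+2%:R) <= 8^-1 * k%:R * W k.+2;
  w_bwde : forall k, (N <= k)%N -> W k * eta <= 8^-1 * k%:R * W k.+1;
  w_eta : eta <= 8^-1 * alpha;
  w_eta' : rho * eta' <= 8^-1 }.

Hypothesis ok : weights_ok.

Let alphaV : 0 <= alpha^-1. Proof. by rewrite invr_ge0 ltW //; case: ok. Qed.

Lemma major_ge0 V : (forall k, 0 <= V k) -> forall k, 0 <= major V k.
Proof.
move=> V0 k; have [_ A0 s0 _ _ k0 k0' _ _ _ _ _ _ _ _ _ _ _] := ok.
have r0 := rprod_ge0 k0 V0; have r0' := rprod_ge0 k0' V0.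
rewrite /major; apply: addr_ge0; last first.
  by case: k => // k; rewrite mulr_ge0 ?invr_ge0.
do ![apply: addr_ge0]; case: ifP => // _;
  do ?[apply: mulr_ge0] => //; rewrite invr_ge0.
Qed.

(** Each of the seven summands is paid for by one smallness condition of [weights_ok] and takes 1/8
    of the norm. *)
Lemma major_contr V M : (forall k, 0 <= V k) -> rsum (fun k => W k * V k) M ->
  rsum (fun k => W k * major V k) (7 / 8 * M).
Proof.
move=> V0 VM.
have [al0 A0 s0 rho0 N0 k0 k0' W0 kS kS' wsub fwd fwds bwd bwds bwde et et'] := ok.
have W0' k := ltW (W0 k).
have WV0 k : 0 <= W k * V k by rewrite mulr_ge0.
have eta0 := rsum_ge0 kS; have eta0' := rsum_ge0 kS'.
have h0 : 0 <= 8^-1 :> R by rewrite invr_ge0.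
have M0 := rsum_ge0 VM.
have cv := rsum_prod k0 V0 rho0 W0' wsub kS VM.
have cv' := rsum_prod k0' V0 rho0 W0' wsub kS' VM.
have cv0 k : 0 <= W k * rprod kap V k by rewrite mulr_ge0 // rprod_ge0.
have cv0' k : 0 <= W k * rprod kap' V k by rewrite mulr_ge0 // rprod_ge0.
have -> : 7 / 8 * M = 8^-1 * M + 8^-1 * M + 8^-1 * M + 8^-1 * M + 8^-1 * M
   + 8^-1 * M + 8^-1 * M by field.
have kpos k : (N <= k)%N -> 0 < k%:R :> R.
  by move=> Nk; rewrite ltr0n (leq_trans N0).
suff [[h1 h2 h3] [h4 h5 h6] h7] :
  [/\ [/\ rsum (fun k => W k * (if (k < N)%N then alpha^-1 * (k.-1%:R * V k.-1) else 0)) (8^-1 * M),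
          rsum (fun k => W k * (if (k < N)%N then alpha^-1 * (sg * (k.+1%:R * V k.+1)) else 0)) (8^-1 * M)
        & rsum (fun k => W k * (if (k < N)%N then alpha^-1 * rprod kap V k else 0)) (8^-1 * M)],
      [/\ rsum (fun k => W k * (if (k < N)%N then 0 else k%:R^-1 * (A * V k.+1))) (8^-1 * M),
          rsum (fun k => W k * (if (k < N)%N then 0 else k%:R^-1 * (sg * (k.+2%:R * V k.+2)))) (8^-1 * M)
        & rsum (fun k => W k * (if (k < N)%N then 0 else k%:R^-1 * rprod kap V k.+1)) (8^-1 * M)]
    & rsum (fun k => W k * (if k is k'.+1 then k'.+1%:R^-1 * rprod kap' V k' else 0)) (8^-1 * M)].
  have := rsumD (rsumD (rsumD (rsumD (rsumD (rsumD h1 h2) h3) h4) h5) h6) h7.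
  by move=> H K; apply: le_trans (H K); apply: ler_sum => k _; rewrite /major !mulrDr.
split; [split|split|].
- apply: (rsum_shiftr h0 VM) => [|k /=]; first by rewrite N0 /= !mul0r !mulr0.
  case: ifP => [/fwd H|_]; last by rewrite mulr0 mulr_ge0.
  have H' := ler_wpM2r (V0 k) H; rewrite mulrCA ler_pdivrMl //; lra.
- apply: (rsum_shift (s := 1) h0 WV0 VM) => k; rewrite addn1.
  case: ifP => [/fwds H|_]; last by rewrite mulr0 mulr_ge0.
  have H' := ler_wpM2r (V0 k.+1) H; rewrite mulrCA ler_pdivrMl //; lra.
- have : rsum (fun k => W k * (if (k < N)%N then alpha^-1 * rprod kap V k else 0))
      (alpha^-1 * (eta * M)).
    apply: (rsum_shift (s := 0) alphaV cv0 cv) => k; rewrite addn0.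
    case: ifP => _; first by rewrite mulrCA.
    by rewrite mulr0 mulr_ge0.
  move=> H K; apply: le_trans (H K) _; rewrite mulrA ler_wpM2r //.
  by rewrite ler_pdivrMl // mulrC.
- apply: (rsum_shift (s := 1) h0 WV0 VM) => k; rewrite addn1.
  case: (ltnP k N) => [_|Nk]; first by rewrite mulr0 mulr_ge0.
  have H' := ler_wpM2r (V0 k.+1) (bwd _ Nk); rewrite mulrCA ler_pdivrMl ?kpos //; lra.
- apply: (rsum_shift (s := 2) h0 WV0 VM) => k; rewrite addn2.
  case: (ltnP k N) => [_|Nk]; first by rewrite mulr0 mulr_ge0.
  have H' := ler_wpM2r (V0 k.+2) (bwds _ Nk); rewrite mulrCA ler_pdivrMl ?kpos //; lra.
(* The general estimate rescales the convolution bound by 1 / (8 eta). For [eta = 0] the convolution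
   itself vanishes at the indices concerned. *)
- have [eta00|etan0] := eqVneq eta 0.
    move=> K; apply: le_trans (_ : 0 <= _); last by rewrite mulr_ge0.
    rewrite big1 // => k _; case: ifP => _; first by rewrite mulr0.
    have := cv k.+2; rewrite eta00 mul0r => /(le_trans _) H.
    have : W k.+1 * rprod kap V k.+1 <= 0.
      apply: H; rewrite big_ord_recr /= lerDr sumr_ge0 //.
    move=> h; have : W k.+1 * rprod kap V k.+1 = 0.
      by apply/le_anti; rewrite h cv0.
    by move=> /eqP; rewrite mulf_eq0 gt_eqF //= => /eqP ->; rewrite !mulr0.
  have etap : 0 < eta by rewrite lt0r etan0.
  have : rsum (fun k => W k * (if (k < N)%N then 0 else k%:R^-1 * rprod kap V k.+1))
      (8^-1 / eta * (eta * M)).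
    apply: (rsum_shift (s := 1) _ cv0 cv) => [|k]; first by rewrite divr_ge0.
    rewrite addn1; case: (ltnP k N) => [_|Nk].
      by rewrite mulr0 mulr_ge0 // divr_ge0.
    have r0 := rprod_ge0 k0 V0 k.+1.
    have H' := ler_wpM2r r0 (bwde _ Nk).
    rewrite mulrCA ler_pdivrMl ?kpos // -[_ / eta * _]mulrAC.
    rewrite [X in _ <= X]mulrA ler_pdivlMr //; lra.
  by rewrite mulrA divfK.
- have : rsum (fun k => W k * (if k is k'.+1 then k'.+1%:R^-1 * rprod kap' V k' else 0))
      (rho * (eta' * M)).
    apply: (rsum_shiftr rho0 cv') => [|k]; first by rewrite mulr0.
    rewrite !mulrA ler_wpM2r ?rprod_ge0 //.
    have := wsub 1%N k; rewrite add1n expr1; apply: le_trans.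
    by rewrite ler_piMr // invf_le1 // ler1n.
  move=> H K; apply: le_trans (H K) _; rewrite mulrA ler_wpM2r //.
Qed.

Lemma iter_major V M t : (forall k, 0 <= V k) -> rsum (fun k => W k * V k) M ->
  (forall k, 0 <= iter t major V k) /\
  rsum (fun k => W k * iter t major V k) ((7 / 8) ^+ t * M).
Proof.
move=> V0 VM; elim: t => [|t [IH1 IH2]]; first by rewrite mul1r.
split; first exact: major_ge0.
by rewrite exprS -mulrA; apply: major_contr.
Qed.

End Majorant.

(** * The fixed-point map over an abstract coefficient module *)

Section CoefficientModule.
Variable R : realType.
Variables (n : nat) (j : 'I_n) (a : 'I_n -> R[i]) (N : nat).

(* An operator on sequences [nat -> E]^n, where [E] stands for the ring of
   coefficients in eps: [S] is multiplication by eps, [Q i l k] and [P l k] are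
   multiplication by the coefficient of x^k in the (i, l) entry, respectively
   in the (j, l) entry.
   The coefficient of x^k in row i <> j of the system reads
     (k-1) u_(k-1) - eps (k+1) u_(k+1) = a_i u_k + (Q u)_k.
   For k < N [fixop] solves it for a_i u_k, and for k > N it solves it for
   (k-1) u_(k-1); the equation k = N is dropped. *)
Definition rowprod (E : lmodType R[i]) (P : 'I_n -> nat -> E -> E)
    (u : 'I_n -> nat -> E) (k : nat) : E :=
  \sum_l \sum_(c < k.+1) P l c (u l (k - c)%N).

Definition fixop (E : lmodType R[i]) (S : E -> E)
    (Q : 'I_n -> 'I_n -> nat -> E -> E) (P : 'I_n -> nat -> E -> E)
    (u : 'I_n -> nat -> E) (i : 'I_n) (k : nat) : E :=
  if i == j then
    if k is k'.+1 then (k'.+1%:R^-1 : R[i]) *: rowprod P u k' else 0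
  else if (k < N)%N then
    (a i)^-1 *: ((k.-1%:R : R[i]) *: u i k.-1 - (k.+1%:R : R[i]) *: S (u i k.+1)
                 - rowprod (Q i) u k)
  else (k%:R^-1 : R[i]) *: (a i *: u i k.+1 + (k.+2%:R : R[i]) *: S (u i k.+2)
                 + rowprod (Q i) u k.+1).

Section Transfer.
Variables (E E' : lmodType R[i]) (S : E -> E) (S' : E' -> E').
Variables (Q : 'I_n -> 'I_n -> nat -> E -> E) (Q' : 'I_n -> 'I_n -> nat -> E' -> E').
Variables (P : 'I_n -> nat -> E -> E) (P' : 'I_n -> nat -> E' -> E').
Variable rel : E -> E' -> Prop.
Hypotheses (rel0 : rel 0 0)
  (relD : forall x y x' y', rel x x' -> rel y y' -> rel (x + y) (x' + y'))
  (relZ : forall (c : R[i]) x x', rel x x' -> rel (c *: x) (c *: x'))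
  (relS : forall x x', rel x x' -> rel (S x) (S' x'))
  (relQ : forall i l k x x', rel x x' -> rel (Q i l k x) (Q' i l k x'))
  (relP : forall l k x x', rel x x' -> rel (P l k x) (P' l k x')).

Let relB x y x' y' : rel x x' -> rel y y' -> rel (x - y) (x' - y').
Proof. by move=> h1 h2; rewrite -2!scaleN1r; apply: relD => //; apply: relZ. Qed.

Lemma rowprod_rel T T' u u' : (forall l k x x', rel x x' -> rel (T l k x) (T' l k x')) ->
  (forall i k, rel (u i k) (u' i k)) ->
  forall k, rel (rowprod T u k) (rowprod T' u' k).
Proof.
move=> relT uu k; apply: (big_rec2 rel) => // l x x' _ xx; apply: relD => //.
by apply: (big_rec2 rel) => // c y y' _ yy; apply: relD => //; apply: relT.
Qed.

(** [fixop] is built from linear operations, hence preserves every relation compatible with them.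
    Three relations will be used: extraction of one iterate, termwise summation over the iterates,
    and evaluation of power series in eps. *)
Lemma fixop_rel u u' : (forall i k, rel (u i k) (u' i k)) ->
  forall i k, rel (fixop S Q P u i k) (fixop S' Q' P' u' i k).
Proof.
move=> uu i k; rewrite /fixop; case: ifP => _.
  by case: k => // k; apply: relZ; apply: rowprod_rel.
case: ifP => _; apply: relZ.
  apply: relB; last by apply: rowprod_rel => // *; apply: relQ.
  by apply: relB; apply: relZ => //; apply: relS.
apply: relD; last by apply: rowprod_rel => // *; apply: relQ.
by apply: relD; apply: relZ => //; apply: relS.
Qed.

End Transfer.

Section Norm.
Variables (E : lmodType R[i]) (S : E -> E).
Variables (Q : 'I_n -> 'I_n -> nat -> E -> E) (P : 'I_n -> nat -> E -> E).
Variable nu : E -> R -> Prop.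
Variables (alpha A sg rho eta eta' : R) (kap kap' W : nat -> R).
Variables (q : 'I_n -> 'I_n -> nat -> R) (p : 'I_n -> nat -> R).
Hypotheses (nu0 : nu 0 0)
  (nuD : forall x y m m', nu x m -> nu y m' -> nu (x + y) (m + m'))
  (nuZ : forall (c : R[i]) x m, nu x m -> nu (c *: x) (cabs c * m))
  (nu_le : forall x m m', nu x m -> m <= m' -> nu x m')
  (nuS : forall x m, nu x m -> nu (S x) (sg * m))
  (nuQ : forall i l k x m, nu x m -> nu (Q i l k x) (q i l k * m))
  (nuP : forall l k x m, nu x m -> nu (P l k x) (p l k * m))
  (q_le : forall i k, i != j -> \sum_l q i l k <= kap k)
  (p_le : forall k, \sum_l p l k <= kap' k).
Hypotheses (a_ge : forall i, i != j -> alpha <= cabs (a i))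
  (a_le : forall i, i != j -> cabs (a i) <= A).
Hypothesis ok : weights_ok N alpha A sg rho eta eta' kap kap' W.

Lemma rowprod_norm T (t : 'I_n -> nat -> R) kp u V :
  (forall l k x m, nu x m -> nu (T l k x) (t l k * m)) ->
  (forall k, \sum_l t l k <= kp k) ->
  (forall k, 0 <= V k) -> (forall i k, nu (u i k) (V k)) ->
  forall k, nu (rowprod T u k) (rprod kp V k).
Proof.
move=> nuT t_le V0 uV k.
apply: (@nu_le _ (\sum_l \sum_(c < k.+1) t l c * V (k - c)%N)).
  apply: (big_rec2 nu) => // l x x' _ xx; apply: nuD => //.
  by apply: (big_rec2 nu) => // c y y' _ yy; apply: nuD => //; apply: nuT.
rewrite exchange_big /=; apply: ler_sum => c _.
by rewrite -mulr_suml ler_wpM2r.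
Qed.

(** The relation [nu x m] reads: the norm of [x] is at most [m]. It is abstract because the estimate
    serves both the coefficient sequences in eps with their l1-norm and the complex numbers at a
    fixed eps. *)
Lemma fixop_norm u V : (forall k, 0 <= V k) -> (forall i k, nu (u i k) (V k)) ->
  forall i k, nu (fixop S Q P u i k)
    (major N alpha A sg kap kap' V k).
Proof.
move=> V0 uV i k.
have [al0 A0 s0 rho0 N0 k0 k0' W0 kS kS' wsub fwd fwds bwd bwds bwde et et'] := ok.
have r0 := rprod_ge0 k0 V0; have r0' := rprod_ge0 k0' V0.
have nuN x m : nu x m -> nu (- x) m.
  by move=> /(nuZ (-1)); rewrite cabsN cabs1 mul1r scaleN1r.
have al0' : 0 <= alpha^-1 by rewrite invr_ge0 ltW.
have tail0 : 0 <= (if k is k'.+1 then k'.+1%:R^-1 * rprod kap' V k' else 0).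
  by case: k => // k; rewrite mulr_ge0 ?invr_ge0.
rewrite /fixop; case: eqVneq => [_|ij].
  apply: (@nu_le _ (if k is k'.+1 then k'.+1%:R^-1 * rprod kap' V k' else 0)).
    case: k {tail0} => // k; have := nuZ k.+1%:R^-1 (rowprod_norm nuP p_le V0 uV k).
    by rewrite cabsV cabs_nat.
  rewrite /major lerDr; case: ifP => _; rewrite ?addr0 ?add0r;
    do ?[apply: addr_ge0]; do ?[apply: mulr_ge0] => //; by rewrite invr_ge0.
rewrite /major; case: ifP => kN; rewrite ?addr0 ?add0r.
  apply: (nu_le (m := cabs (a i)^-1 * (k.-1%:R * V k.-1 + k.+1%:R * (sg * V k.+1)
      + rprod kap V k))).
    apply: nuZ; apply: nuD; last first.
      apply: nuN; apply: (@rowprod_norm (Q i) (q i)) => // *; first exact: nuQ.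
      exact: q_le.
    apply: nuD; first by have := nuZ k.-1%:R (uV i k.-1); rewrite cabs_nat.
    apply: nuN; have := nuZ k.+1%:R (nuS (uV i k.+1)).
    by rewrite cabs_nat.
  rewrite -!mulrDr (mulrCA sg); apply: (@le_trans _ _ (alpha^-1 * (k.-1%:R * V k.-1 +
       k.+1%:R * (sg * V k.+1) + rprod kap V k))); last by rewrite lerDl.
  rewrite ler_wpM2r ?addr_ge0 ?mulr_ge0 // cabsV lef_pV2 ?a_ge ?posrE //.
  exact: lt_le_trans al0 (a_ge ij).
apply: (nu_le (m := k%:R^-1 * (cabs (a i) * V k.+1 + k.+2%:R * (sg * V k.+2)
      + rprod kap V k.+1))).
  have -> : k%:R^-1 = cabs (k%:R^-1 : R[i]) by rewrite cabsV cabs_nat.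
  apply: nuZ; apply: nuD; last first.
    apply: (@rowprod_norm (Q i) (q i)) => // *; first exact: nuQ.
    exact: q_le.
  apply: nuD; first exact: nuZ.
  by have := nuZ k.+2%:R (nuS (uV i k.+2)); rewrite cabs_nat.
rewrite -!mulrDr (mulrCA sg); apply: (@le_trans _ _ (k%:R^-1 * (A * V k.+1 +
       k.+2%:R * (sg * V k.+2) + rprod kap V k.+1))); last by rewrite lerDl.
by rewrite ler_wpM2l ?invr_ge0 // !lerD2r ler_wpM2r // a_le.
Qed.

Lemma fixop_iter_norm u V t : (forall k, 0 <= V k) ->
  (forall i k, nu (u i k) (V k)) ->
  forall i k, nu (iter t (fixop S Q P) u i k)
    (iter t (major N alpha A sg kap kap') V k).
Proof.
move=> V0 uV; elim: t => [//|t IH] i k; rewrite !iterS.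
apply: fixop_norm => //; elim: t {IH} => [//|t IH] k' /=.
exact: (major_ge0 ok IH).
Qed.

(** A fixed point equals all its iterates, and the norm of the t-th one is at most (7/8)^t M / W
    k. *)
Lemma fixop_eq0 u V M : (forall k, 0 <= V k) -> rsum (fun k => W k * V k) M ->
  (forall i k, nu (u i k) (V k)) ->
  (forall i k, u i k = fixop S Q P u i k) ->
  forall i k e, 0 < e -> nu (u i k) e.
Proof.
move=> V0 VM uV ufix i k e e0.
have W0 : 0 < W k by case: ok.
have M0 := rsum_ge0 VM.
have it t : iter t (fixop S Q P) u = u.
  elim: t => [//|t /= ->]; apply/funext => i'; apply/funext => k'.
  by rewrite -ufix.
have [t Ht] : exists t : nat, (7 / 8) ^+ t * M / W k < e.
  have : (7 / 8 : R) ^+ t @[t --> \oo] --> 0.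
    by apply: cvg_expr; rewrite ger0_norm ?divr_ge0 //; lra.
  move=> /cvgrPdist_lt /(_ (e * W k / (M + 1))).
  rewrite divr_gt0 ?mulr_gt0 //; last lra.
  move=> /(_ isT)[t _ /(_ t (leqnn t))]; rewrite sub0r normrN.
  rewrite ger0_norm ?exprn_ge0 ?divr_ge0 // ltr_pdivlMr; last by lra.
  move=> H; exists t; rewrite ltr_pdivrMr //; apply: le_lt_trans H.
  by rewrite ler_wpM2l ?exprn_ge0 ?divr_ge0 //; lra.
have [Vt0 Vt] := iter_major ok t V0 VM.
have := fixop_iter_norm t V0 uV i k; rewrite it => /nu_le; apply.
apply: ltW; apply: le_lt_trans Ht; rewrite ler_pdivlMr // mulrC.
by apply: (rsum_term k _ Vt) => k'; rewrite mulr_ge0 // ltW //; case: ok.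
Qed.

End Norm.
End CoefficientModule.

(** * The solution as a power series in eps *)

Section FormalSolution.
Variable R : realType.
Variables (n : nat) (j : 'I_n) (a : 'I_n -> R[i]) (N : nat).
Variables (q : 'I_n -> 'I_n -> nat -> nat -> R[i]) (p : 'I_n -> nat -> nat -> R[i]).
Variables (alpha A sg rho eta eta' : R) (kap kap' W : nat -> R).
Variables (qb : 'I_n -> 'I_n -> nat -> R) (pb : 'I_n -> nat -> R).
Hypotheses (q_sum : forall i l k, asumr (q i l ^~ k) sg (qb i l k))
  (p_sum : forall l k, asumr (p l ^~ k) sg (pb l k))
  (q_le : forall i k, i != j -> \sum_l qb i l k <= kap k)
  (p_le : forall k, \sum_l pb l k <= kap' k)
  (a_ge : forall i, i != j -> alpha <= cabs (a i))
  (a_le : forall i, i != j -> cabs (a i) <= A)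
  (sgp : 0 < sg) (ok : weights_ok N alpha A sg rho eta eta' kap kap' W).

Let sg0 : 0 <= sg. Proof. by case: ok. Qed.

Definition seqshift (e : nat -> R[i]) (m : nat) : R[i] := if m is m'.+1 then e m' else 0.

Definition seqnorm (e : nat -> R[i]) (M : R) := asumr e sg M.

Lemma seqnorm0 : seqnorm 0 0.
Proof. by move=> K; rewrite big1 // => m _; rewrite mul0r cabs0. Qed.

Lemma seqnormD e f M M' : seqnorm e M -> seqnorm f M' -> seqnorm (e + f) (M + M').
Proof.
move=> eM fM K; apply: le_trans (lerD (eM K) (fM K)).
by rewrite -big_split /=; apply: ler_sum => m _; rewrite mulrDl cabsD.
Qed.

Lemma seqnormZ (c : R[i]) e M : seqnorm e M -> seqnorm (c *: e) (cabs c * M).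
Proof.
move=> eM K; apply: le_trans (ler_wpM2l (cabs_ge0 c) (eM K)).
rewrite mulr_sumr; apply: ler_sum => m _.
by rewrite -cabsM mulrA.
Qed.

Lemma seqnorm_le e M M' : seqnorm e M -> M <= M' -> seqnorm e M'.
Proof. by move=> eM MM K; apply: le_trans MM. Qed.

Lemma seqnormS e M : seqnorm e M -> seqnorm (seqshift e) (sg * M).
Proof.
move=> eM [|K]; first by rewrite big_ord0 mulr_ge0 // (asum_ge0 eM).
rewrite big_ord_recl /= mul0r cabs0 add0r.
apply: le_trans (ler_wpM2l sg0 (eM K)); rewrite mulr_sumr.
apply: ler_sum => m _; rewrite /bump leq0n add1n /= !cabsM !cabs_realexp //.
by rewrite exprS mulrCA.
Qed.

Lemma seqnorm_cprod c e M M' : asumr c sg M -> seqnorm e M' ->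
  seqnorm (cprod c e) (M * M').
Proof.
move=> cM eM K; have := asum_cprod cM eM K.
by under eq_bigr do rewrite cprod_exp.
Qed.

Definition seqQ i l k := cprod (q i l ^~ k).
Definition seqP l k := cprod (p l ^~ k).

Definition seqfix := fixop j a N seqshift seqQ seqP.

(** The normalisation u_j(eps, 0) = 1 as an inhomogeneous term; row j of [fixop] is 0 at k = 0 and
    leaves this value free. *)
Definition seqinit (i : 'I_n) (k m : nat) : R[i] := ((i == j) && (k == 0%N) && (m == 0%N))%:R.

Lemma seqinit_norm i k : seqnorm (seqinit i k) (if k == 0%N then 1 else 0).
Proof.
move=> [|K]; first by rewrite big_ord0; case: ifP => _; rewrite ?ler01.
rewrite /seqinit; case: (boolP ((i == j) && (k == 0%N))) => [/andP[_ ->]|_].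
  rewrite big_ord_recl /= big1 ?addr0 => [|m _]; last by rewrite mul0r cabs0.
  by rewrite expr0 mulr1 cabs1.
rewrite big1 => [|m _]; last by rewrite mul0r cabs0.
by case: ifP => _; rewrite ?ler01.
Qed.

Lemma sumsN0 (z : nat -> R[i]) : (forall k, z k = 0) -> sums z 0.
Proof. by move=> z0; have := @sums_finite _ z 0 (fun k _ => z0 k); rewrite big_ord0. Qed.

Lemma cvgs_cabs (u : nat -> R[i]) (l : R[i]) : cvgs u l ->
  cvgs (fun t => (cabs (u t))%:C) (cabs l)%:C.
Proof.
move=> ul e /ul[K HK]; exists K => t /HK; apply: le_lt_trans.
rewrite -rmorphB cabsR ler_norml; have := cabs_triangle_rev (u t) l.
by have := cabs_triangle_rev l (u t); rewrite cabsB; lra.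
Qed.

Lemma cvgs_real_le (x : nat -> R) (l M : R) : (forall t, x t <= M) ->
  cvgs (fun t => (x t)%:C) l%:C -> l <= M.
Proof.
move=> xM xl; apply/ler_addgt0Pr => e /xl[K /(_ K (leqnn _))].
rewrite -rmorphB cabsR ltr_norml => /andP[h _]; have := xM K; lra.
Qed.

Lemma sums_shift_rel (d : nat -> nat -> R[i]) (e : nat -> R[i]) :
  (forall m, sums (fun t => d t m) (e m)) ->
  forall m, sums (fun t => seqshift (d t) m) (seqshift e m).
Proof. by move=> de [|m] /=; [apply: sumsN0 | apply: de]. Qed.

Lemma sums_cprod_rel (c : nat -> R[i]) (d : nat -> nat -> R[i]) (e : nat -> R[i]) :
  (forall m, sums (fun t => d t m) (e m)) ->
  forall m, sums (fun t => cprod c (d t) m) (cprod c e m).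
Proof. by move=> de m; apply: sums_big => k; apply: sumsZ. Qed.

(** Neumann series: the iterates of [seqfix] on [seqinit] are summed coefficient by coefficient.
    Their norms decrease like (7/8)^t, and the sum of these powers is the 8 in the bound. *)
Lemma formal_solution : exists U : 'I_n -> nat -> nat -> R[i],
  (forall i k, U i k = seqinit i k + seqfix U i k) /\
  (forall i (K : nat), \sum_(m < K) \sum_(k < K) cabs (U i k m) * sg ^+ m * W k <= 8 * W 0%N).
Proof.
pose D t := iter t seqfix seqinit.
pose V0 (k : nat) : R := if k == 0%N then 1 else 0.
have V00 k : 0 <= V0 k by rewrite /V0; case: ifP => _; rewrite ?ler01.
have W0 k : 0 < W k by case: ok.
have VM : rsum (fun k => W k * V0 k) (W 0%N).
  move=> [|K]; first by rewrite big_ord0 ltW.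
  rewrite big_ord_recl /= big1 ?addr0 /V0 ?mulr1 // => k _.
  by rewrite /= mulr0.
pose V t := iter t (major N alpha A sg kap kap') V0.
have Vt0 t := (iter_major ok t V00 VM).1.
have VtM t := (iter_major ok t V00 VM).2.
have DV t i k : seqnorm (D t i k) (V t k).
  apply: (@fixop_iter_norm R n j a N _ seqshift seqQ seqP seqnorm alpha A sg rho
    eta eta' kap kap' W qb pb seqnorm0 seqnormD seqnormZ seqnorm_le seqnormS) => //.
  - by move=> i' l k' x m; apply: seqnorm_cprod.
  - by move=> l k' x m; apply: seqnorm_cprod.
  - exact: seqinit_norm.
have geo K : \sum_(t < K) (7 / 8 : R) ^+ t <= 8.
  have -> : \sum_(t < K) (7 / 8 : R) ^+ t = 8 - 8 * (7 / 8) ^+ K.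
    elim: K => [|K IH]; first by rewrite big_ord0 expr0; lra.
    by rewrite big_ord_recr /= IH exprS; lra.
  by have : 0 <= (7 / 8 : R) ^+ K; [rewrite exprn_ge0 ?divr_ge0 | lra].
have DW t i k m : cabs (D t i k m) <= (7 / 8) ^+ t * (W 0%N / (W k * sg ^+ m)).
  have h1 : cabs (D t i k m * sg%:C ^+ m) <= V t k.
    exact: (asum_term m (DV t i k)).
  have h2 : W k * V t k <= (7 / 8) ^+ t * W 0%N.
    apply: (@rsum_term _ (fun k => W k * V t k) _ k _ (VtM t)) => k'.
    by rewrite mulr_ge0 ?(ltW (W0 _)) //; exact: Vt0.
  rewrite mulrA ler_pdivlMr ?mulr_gt0 ?exprn_gt0 //; apply: le_trans h2.
  by rewrite mulrCA ler_wpM2l ?(ltW (W0 k)) //; move: h1; rewrite cabsM cabs_realexp.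
have /choice[U0 HU0] : forall x : 'I_n * nat * nat, exists S,
    sums (fun t => D t x.1.1 x.1.2 x.2) S.
  move=> [[i k] m] /=; apply: (@asum_sums _ _ (8 * (W 0%N / (W k * sg ^+ m)))) => K.
  apply: (@le_trans _ _ (\sum_(t < K) (7 / 8) ^+ t * (W 0%N / (W k * sg ^+ m)))).
    by apply: ler_sum => t _; apply: DW.
  rewrite -mulr_suml ler_wpM2r // divr_ge0 ?mulr_ge0 ?exprn_ge0 // ltW //.
pose U i k m := U0 (i, k, m).
have HU i k m : sums (fun t => D t i k m) (U i k m) by exact: (HU0 (i, k, m)).
exists U; split.
  (* The iterates are collected into sequences indexed by t, on which all operations act termwise.
     [fixop] of the collection then has the next iterate as its entry at t, and can be compared with
     [seqfix] of the sum. *)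
  pose S1 (d : nat -> nat -> R[i]) := (fun t => seqshift (d t)) : nat -> nat -> R[i].
  pose Q1 i l k (d : nat -> nat -> R[i]) := (fun t => seqQ i l k (d t)) : nat -> nat -> R[i].
  pose P1 l k (d : nat -> nat -> R[i]) := (fun t => seqP l k (d t)) : nat -> nat -> R[i].
  pose d i k := (fun t => D t i k) : nat -> nat -> R[i].
  have e1 t i k : fixop j a N S1 Q1 P1 d i k t = D t.+1 i k.
    apply: (@fixop_rel _ _ j a N (nat -> nat -> R[i]) (nat -> R[i]) S1 seqshift
      Q1 seqQ P1 seqP (fun x y => x t = y)) => //.
    - by move=> x y x' y' <- <-.
    - by move=> c x x' <-.
    - by move=> x x' <-.
    - by move=> i' l k' x x' <-.
    - by move=> l k' x x' <-.
  have e2 i k m : sums (fun t => D t.+1 i k m) (seqfix U i k m).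
    apply: (@eq_sums _ (fun t => fixop j a N S1 Q1 P1 d i k t m)).
      by move=> t; rewrite e1.
    move: m; apply: (@fixop_rel _ _ j a N (nat -> nat -> R[i]) (nat -> R[i]) S1 seqshift
      Q1 seqQ P1 seqP (fun x y => forall m, sums (fun t => x t m) (y m))).
    - by move=> m; apply: sumsN0.
    - by move=> x y x' y' h1 h2 m; apply: sumsD.
    - by move=> c x x' h m; apply: sumsZ.
    - by move=> x x'; apply: sums_shift_rel.
    - by move=> i' l k' x x'; apply: sums_cprod_rel.
    - by move=> l k' x x'; apply: sums_cprod_rel.
    - exact: HU.
  move=> i k; apply/funext => m.
  rewrite -[RHS]/(seqinit i k m + seqfix U i k m).
  by rewrite (sums_unique (e2 i k m) (sums_recl (HU i k m))) addrC subrK.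
move=> i K.
apply: (@cvgs_real_le (fun tau : nat => \sum_(m < K) \sum_(k < K)
    cabs (\sum_(t < tau) D t i k m) * sg ^+ m * W k)).
  move=> tau; apply: le_trans (ler_wpM2r (ltW (W0 0%N)) (geo tau)).
  apply: (@le_trans _ _ (\sum_(t < tau) \sum_(k < K) W k * V t k)); last first.
    by rewrite mulr_suml; apply: ler_sum => t _; apply: VtM.
  apply: (@le_trans _ _ (\sum_(t < tau) \sum_(k < K) W k * \sum_(m < K) cabs (D t i k m * sg%:C ^+ m))).
    rewrite exchange_big /= [X in _ <= X]exchange_big /=; apply: ler_sum => k _.
    rewrite -mulr_suml mulrC -mulr_sumr ler_wpM2l ?(ltW (W0 k)) //.
    rewrite exchange_big /=; apply: ler_sum => m _.
    apply: le_trans (ler_wpM2r (exprn_ge0 _ sg0) (cabs_sum _ _ _)) _.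
    by rewrite mulr_suml; apply: ler_sum => t _; rewrite cabsM cabs_realexp.
  apply: ler_sum => t _; apply: ler_sum => k _; rewrite ler_wpM2l ?(ltW (W0 k)) //.
  exact: DV.
have E (f : nat -> nat -> R) : (\sum_(m < K) \sum_(k < K) f k m * sg ^+ m * W k)%:C =
    \sum_(m < K) \sum_(k < K) (f k m)%:C * (sg ^+ m * W k)%:C.
  rewrite rmorph_sum; apply: eq_bigr => m _.
  by rewrite rmorph_sum; apply: eq_bigr => k _; rewrite -mulrA rmorphM.
rewrite (E (fun k m => cabs (U i k m))).
apply: (@cvgs_near _ (fun tau => \sum_(m < K) \sum_(k < K)
    (cabs (\sum_(t < tau) D t i k m))%:C * (sg ^+ m * W k)%:C) _ _ 0).
  by move=> tau _; rewrite (E (fun k m => cabs (\sum_(t < tau) D t i k m))).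
apply: cvgs_sum => m; apply: cvgs_sum => k.
apply: cvgsM; last exact: cvgs_cst.
exact: cvgs_cabs (HU i k m).
Qed.

End FormalSolution.

(** * Fixed parameter: uniqueness and vanishing of the corrections *)

Section Specialization.
Variable R : realType.
Variables (n : nat) (j : 'I_n) (a : 'I_n -> R[i]) (N : nat).
Variables (q : 'I_n -> 'I_n -> nat -> nat -> R[i]) (p : 'I_n -> nat -> nat -> R[i]).
Variables (alpha A sg rho eta eta' : R) (kap kap' W : nat -> R).
Variables (qb : 'I_n -> 'I_n -> nat -> R) (pb : 'I_n -> nat -> R).
Hypotheses (q_sum : forall i l k, asumr (q i l ^~ k) sg (qb i l k))
  (p_sum : forall l k, asumr (p l ^~ k) sg (pb l k))
  (q_le : forall i k, i != j -> \sum_l qb i l k <= kap k)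
  (p_le : forall k, \sum_l pb l k <= kap' k)
  (a_ge : forall i, i != j -> alpha <= cabs (a i))
  (a_le : forall i, i != j -> cabs (a i) <= A)
  (sgp : 0 < sg) (ok : weights_ok N alpha A sg rho eta eta' kap kap' W).
Variables (qe : R[i] -> 'I_n -> 'I_n -> nat -> R[i]) (pe : R[i] -> 'I_n -> nat -> R[i]).
Hypotheses (qe_sum : forall e i l k, cabs e <= sg ->
    sums (fun m => q i l m k * e ^+ m) (qe e i l k))
  (pe_sum : forall e l k, cabs e <= sg -> sums (fun m => p l m k * e ^+ m) (pe e l k)).

Definition rowsum (c d : 'I_n -> nat -> R[i]) (k : nat) : R[i] :=
  \sum_l cprod (c l) (d l) k.

(* With [skip] the equations k = N, which [fixop] drops, are omitted. *)
Definition recursion (e : R[i]) (skip : bool) (d : 'I_n -> nat -> R[i]) : Prop :=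
  (forall i k, i != j -> skip ==> (k != N) ->
     k.-1%:R * d i k.-1 - e * (k.+1%:R * d i k.+1)
     = a i * d i k + rowsum (qe e i) d k) /\
  (forall k, k.+1%:R * d j k.+1 = rowsum (pe e) d k).

Definition spfix e := @fixop R n j a N R[i] (fun x => e * x)
  (fun i l k x => qe e i l k * x) (fun l k x => pe e l k * x).

Definition spinit (i : 'I_n) (k : nat) : R[i] := ((i == j) && (k == 0%N))%:R.

Let a0 i : i != j -> a i != 0.
Proof.
by move=> /a_ge h; rewrite -cabs_gt0; apply: lt_le_trans h; case: ok.
Qed.

Let N0 : (0 < N)%N. Proof. by case: ok. Qed.

(** In the rows i <> j the fixed-point formula at k is the equation of index k if k < N and of index
    k + 1 if k >= N. So each index except N occurs exactly once. *)
Lemma spfix_recursion e c d :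
  (forall i k, d i k = c * spinit i k + spfix e d i k) <->
  recursion e true d /\ d j 0%N = c.
Proof.
split=> [H|[[H1 H2] H3] i k].
  split; last by rewrite H /spinit /spfix /fixop !eqxx mulr1 addr0.
  split=> [i k ij /= kN|k]; last first.
    rewrite H /spinit /spfix /fixop eqxx /= mulr0 add0r.
    by rewrite -[_ *: _]/(_ * _) mulrA divff ?pnatr_eq0 // mul1r.
  move: kN; rewrite neq_ltn => /orP[kN|].
    have := H i k; rewrite /spinit /spfix /fixop (negPf ij) kN /= mulr0 add0r.
    rewrite -!/(_ * _) => E; rewrite [in RHS]E.
    rewrite -[_ *: (_ - _)]/((a i)^-1 * _) mulVKf ?a0 // -[_ *: _]/(_ * _).
    rewrite -[_ *: _]/(_ * _) subrK; congr (_ - _); exact: mulrCA.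
  case: k => // k; rewrite ltnS => Nk.
  have := H i k; rewrite /spinit /spfix /fixop (negPf ij) ltnNge Nk /= mulr0 add0r => E.
  have k0 : k%:R != 0 :> R[i] by rewrite pnatr_eq0 -lt0n (leq_trans N0).
  rewrite [in LHS]E -[_ *: (_ + _ + _)]/(k%:R^-1 * _) mulVKf //.
  rewrite -[_ *: _]/(_ * _) -[_ *: _]/(_ * _) addrAC (mulrCA e) addrK.
  by [].
rewrite /spfix /fixop /spinit; case: eqVneq => [->|ij] /=.
  case: k => [|k]; first by rewrite H3 mulr1 addr0.
  rewrite mulr0 add0r -[_ *: _]/(_ * _); apply: (@mulfI _ k.+1%:R).
    by rewrite pnatr_eq0.
  by rewrite H2 mulrA divff ?pnatr_eq0 // mul1r.
rewrite mulr0 add0r; case: (ltnP k N) => [kN|Nk].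
  have := H1 i k ij; rewrite /= neq_ltn kN /= => /(_ isT) E.
  rewrite -[_ *: (_ - _)]/((a i)^-1 * _); apply: (@mulfI _ (a i)); first exact: a0.
  rewrite mulVKf ?a0 // -[_ *: _]/(_ * _) -[_ *: (e * _)]/(_ * _) (mulrCA _ e).
  by rewrite E addrK.
have := H1 i k.+1 ij; rewrite /= gtn_eqF ?ltnS //= => /(_ isT) E.
have k0 : k%:R != 0 :> R[i] by rewrite pnatr_eq0 -lt0n (leq_trans N0).
apply: (@mulfI _ k%:R) => //.
rewrite -[_ *: (_ + _ + _)]/(k%:R^-1 * _) mulVKf // -[_ *: _]/(_ * _).
rewrite -[_ *: (e * _)]/(_ * _) (mulrCA _ e) addrAC.
by rewrite -[rowprod _ _ _]/(rowsum (qe e i) d k.+1) -E subrK.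
Qed.

Let sg0 : 0 <= sg := ltW sgp.

Lemma qe_le e i l k : cabs e <= sg -> cabs (qe e i l k) <= qb i l k.
Proof. by move=> es; apply: sums_le (asumr_le (q_sum i l k) es) (qe_sum i l k es). Qed.

Lemma pe_le e l k : cabs e <= sg -> cabs (pe e l k) <= pb l k.
Proof. by move=> es; apply: sums_le (asumr_le (p_sum l k) es) (pe_sum l k es). Qed.

Lemma spfix_eq0 e d M : cabs e <= sg ->
  rsum (fun k => W k * \sum_i cabs (d i k)) M ->
  (forall i k, d i k = spfix e d i k) -> forall i k, d i k = 0.
Proof.
move=> es dM dfix i k; apply/eqP; rewrite -cabs_eq0 eq_le cabs_ge0 andbT.
apply/ler_addgt0Pr => x x0; rewrite add0r.
apply: (@fixop_eq0 R n j a N R[i] _ _ _ (fun x m => cabs x <= m)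
   alpha A sg rho eta eta' kap kap' W qb pb _ _ _ _ _ _ _ q_le p_le a_ge a_le ok
   d (fun k => \sum_i cabs (d i k)) M _ dM _ dfix) => //.
- by rewrite cabs0.
- by move=> y z m m' h1 h2; apply: le_trans (cabsD _ _) (lerD h1 h2).
- by move=> c y m h; rewrite -[_ *: _]/(_ * _) cabsM ler_wpM2l ?cabs_ge0.
- by move=> y m m'; apply: le_trans.
- by move=> y m h; rewrite cabsM; apply: ler_pM; rewrite ?cabs_ge0.
- by move=> i' l k' y m h; rewrite cabsM; apply: ler_pM; rewrite ?cabs_ge0 ?qe_le.
- by move=> l k' y m h; rewrite cabsM; apply: ler_pM; rewrite ?cabs_ge0 ?pe_le.
- by move=> k'; rewrite sumr_ge0 // => i' _; apply: cabs_ge0.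
- by move=> i' k'; rewrite (bigD1 i') //= lerDl sumr_ge0 // => i'' _; apply: cabs_ge0.
Qed.

(** Evaluation of a power series in eps. Summability at [sg] belongs to the relation because Cauchy
    products can be evaluated only with it. *)
Definition evals (e : R[i]) (x : nat -> R[i]) (y : R[i]) :=
  (exists M, asumr x sg M) /\ sums (fun m => x m * e ^+ m) y.

Lemma evals0 e : evals e 0 0.
Proof.
split; last by apply: sumsN0 => k; rewrite mul0r.
by exists 0; apply: seqnorm0.
Qed.

Lemma evalsD e x y x' y' : evals e x x' -> evals e y y' -> evals e (x + y) (x' + y').
Proof.
move=> [[M xM] xx] [[M' yM] yy]; split; last first.
  by apply: eq_sums (sumsD xx yy) => m; rewrite mulrDl.
by exists (M + M'); apply: seqnormD.
Qed.

Lemma evalsZ e (c : R[i]) x x' : evals e x x' -> evals e (c *: x) (c *: x').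
Proof.
move=> [[M xM] xx]; split; last first.
  by apply: eq_sums (sumsZ c xx) => m; rewrite mulrA.
by exists (cabs c * M); apply: seqnormZ.
Qed.

Lemma evalsS e x x' : cabs e <= sg -> evals e x x' -> evals e (seqshift x) (e * x').
Proof.
move=> es [[M xM] xx]; split; first by exists (sg * M); apply: (seqnormS ok).
have : sums (fun m => seqshift x m.+1 * e ^+ m.+1) (e * x').
  by apply: eq_sums (sumsZ e xx) => m; rewrite exprS mulrCA.
by move/(@sums_recl_inv _ (fun m => seqshift x m * e ^+ m)); rewrite /= mul0r add0r.
Qed.

Lemma evals_cprod e (c : nat -> R[i]) M c' x x' : cabs e <= sg -> asumr c sg M ->
  sums (fun m => c m * e ^+ m) c' ->
  evals e x x' -> evals e (cprod c x) (c' * x').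
Proof.
move=> es cM cc [[M' xM] xx]; split.
  by exists (M * M'); apply: seqnorm_cprod.
have := sums_cprod (asumr_le cM es) (asumr_le xM es) cc xx.
by apply: eq_sums => m; rewrite cprod_exp.
Qed.

Variable U : 'I_n -> nat -> nat -> R[i].
Hypotheses (U_fix : forall i k, U i k = seqinit R j i k + seqfix j a N q p U i k)
  (U_sum : forall i (K : nat),
     \sum_(m < K) \sum_(k < K) cabs (U i k m) * sg ^+ m * W k <= 8 * W 0%N).

Let W0 k : 0 < W k. Proof. by case: ok. Qed.

Let U_sq e i : cabs e <= sg -> forall K : nat,
  \sum_(m < K) \sum_(k < K) cabs ((W k)%:C * (U i k m * e ^+ m)) <= 8 * W 0%N.
Proof.
move=> es K; apply: le_trans (U_sum i K); apply: ler_sum => m _.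
apply: ler_sum => k _; rewrite mulrC !cabsM cabsX cabsR ger0_norm ?(ltW (W0 k)) //.
rewrite ler_wpM2r ?(ltW (W0 k)) // ler_wpM2l ?cabs_ge0 //.
by rewrite lerXn2r ?nnegrE ?cabs_ge0.
Qed.

Lemma U_asum i k : asumr (U i k) sg (8 * W 0%N / W k).
Proof.
move=> K; have ss : cabs sg%:C <= sg by rewrite cabsR ger0_norm.
have := @square_col _ (fun m k => (W k)%:C * (U i k m * sg%:C ^+ m)) _ k (U_sq i ss) K.
rewrite ler_pdivlMr // mulr_suml; apply: le_trans; apply: ler_sum => m _.
by rewrite [X in _ <= X]cabsM cabsR gtr0_norm // mulrC.
Qed.

Variable ue : R[i] -> 'I_n -> nat -> R[i].
Hypothesis ue_sum : forall e i k, cabs e <= sg ->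
  sums (fun m => U i k m * e ^+ m) (ue e i k).

Lemma ue_evals e i k : cabs e <= sg -> evals e (U i k) (ue e i k).
Proof. by move=> es; split; [exists (8 * W 0%N / W k); apply: U_asum | apply: ue_sum]. Qed.

Lemma ue_asum e i : cabs e <= sg -> rsum (fun k => W k * cabs (ue e i k)) (8 * W 0%N).
Proof.
move=> es; have H := @square_asum _ (fun m k => (W k)%:C * (U i k m * e ^+ m))
  (fun k => (W k)%:C * ue e i k) _ (U_sq i es).
move=> K; apply: le_trans (H _ K) => [|k].
  by apply: ler_sum => k _; rewrite cabsM cabsR gtr0_norm.
by apply: sumsZ; apply: ue_sum.
Qed.

(** Evaluation at [e] is linear and multiplicative, so it carries the formal fixed-point equation to
    the one at the parameter [e]. *)
Lemma ue_fix e : cabs e <= sg -> forall i k,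
  ue e i k = 1 * spinit i k + spfix e (ue e) i k.
Proof.
move=> es i k; rewrite mul1r; apply: (sums_unique (ue_sum i k es)).
have h1 : evals e (seqfix j a N q p U i k) (spfix e (ue e) i k).
  rewrite /seqfix /spfix; refine (@fixop_rel R n j a N (nat -> R[i]) R[i] (@seqshift R) (fun x => e * x)
    (seqQ q) (fun i l k x => qe e i l k * x) (seqP p) (fun l k x => pe e l k * x)
    (evals e) _ _ _ _ _ _ _ _ _ i k).
  - exact: evals0.
  - by move=> *; apply: evalsD.
  - by move=> *; apply: evalsZ.
  - by move=> *; apply: evalsS.
  - by move=> i' l k' x x'; apply: (evals_cprod es (q_sum _ _ _) (qe_sum _ _ _ es)).
  - by move=> l k' x x'; apply: (evals_cprod es (p_sum _ _) (pe_sum _ _ es)).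
  - by move=> i' k'; apply: ue_evals.
have h2 : sums (fun m => seqinit R j i k m * e ^+ m) (spinit i k).
  have : sums (fun m => seqinit R j i k m * e ^+ m)
      (\sum_(m < 1) seqinit R j i k m * e ^+ m).
    by apply: sums_finite => -[//|m] _; rewrite /seqinit andbF mul0r.
  by rewrite big_ord1 expr0 mulr1 /seqinit andbT.
apply: eq_sums (sumsD h2 h1.2) => m; rewrite -mulrDl.
by rewrite U_fix.
Qed.

(** The defect in row i of the skipped equation k = N, as a power series in eps: up to sign, the
    correction p_i(eps). *)
Definition residual (i : 'I_n) : nat -> R[i] :=
  a i *: U i N + rowprod (seqQ q i) U N - ((N.-1%:R : R[i]) *: U i N.-1
  - (N.+1%:R : R[i]) *: seqshift (U i N.+1)).

Lemma residual_evals e i : cabs e <= sg -> evals e (residual i)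
  (a i * ue e i N + rowsum (qe e i) (ue e) N
   - (N.-1%:R * ue e i N.-1 - e * (N.+1%:R * ue e i N.+1))).
Proof.
move=> es; have evalsB (x y : nat -> R[i]) (x' y' : R[i]) : evals e x x' -> evals e y y' ->
    evals e (x - y) (x' - y').
  by move=> h1 h2; move: (evalsD h1 (evalsZ (-1) h2)); rewrite !scaleN1r.
apply: (evalsB _ _ _ _); last first.
  apply: (evalsB _ _ _ _); first exact: (evalsZ N.-1%:R (ue_evals i N.-1 es)).
  rewrite mulrCA; exact: (evalsZ N.+1%:R (evalsS es (ue_evals i N.+1 es))).
apply: evalsD; first exact: (evalsZ (a i) (ue_evals i N es)).
refine (@rowprod_rel R n (nat -> R[i]) R[i] (evals e)
  (evals0 e) (@evalsD e) (seqQ q i) (fun l k x => qe e i l k * x) _ _ _ _ N).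
  move=> l k' x x'; apply: (evals_cprod es (q_sum _ _ _) (qe_sum _ _ _ es)).
by move=> i' k'; apply: ue_evals.
Qed.

Lemma rowsum_lin c x u d k :
  rowsum c (fun i k => x * u i k - d i k) k = x * rowsum c u k - rowsum c d k.
Proof.
rewrite /rowsum mulr_sumr -sumrB; apply: eq_bigr => l _.
rewrite /cprod mulr_sumr -sumrB; apply: eq_bigr => b _.
by rewrite mulrBr mulrCA.
Qed.

(** At a real parameter in (0, e0), d_j(0) times [ue] minus the true solution d is a homogeneous
    fixed point, hence zero. As d is not zero, d_j(0) <> 0, and [ue] inherits the equation k = N
    from d. The residual vanishes on an interval, so all its coefficients are zero and the equation
    holds for every small eps. *)
Lemma ue_recursion (e0 : R) : 0 < e0 ->
  (forall x : R, 0 < x < e0 -> exists d M,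
    [/\ recursion x%:C false d, rsum (fun k => W k * \sum_i cabs (d i k)) M
      & exists i k, d i k != 0]) ->
  forall e, cabs e <= sg -> recursion e false (ue e) /\ ue e j 0%N = 1.
Proof.
move=> e00 sol.
have res0 i : i != j -> forall m, residual i m = 0.
  move=> ij m.
  have resM : exists M, asumr (residual i) sg M.
    by have [] := residual_evals i (e := 0) _; rewrite ?cabs0.
  have rps : ps (fun e => a i * ue e i N + rowsum (qe e i) (ue e) N
      - (N.-1%:R * ue e i N.-1 - e * (N.+1%:R * ue e i N.+1))) (residual i) sg.
    by split=> // e es; have [] := residual_evals i (ltW es).
  have m0 : 0 < Num.min e0 sg by rewrite lt_min e00.
  apply: (ps_eq0 rps m0) => x; rewrite lt_min => /and3P[x0 xe xs].
  have es : cabs x%:C <= sg by rewrite cabsR gtr0_norm // ltW.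
  have [|d [M [drec dM [i0 [k0 dn0]]]]] := sol x; first by rewrite x0.
  have dfix : forall i k, d i k = d j 0%N * spinit i k + spfix x%:C d i k.
    apply/spfix_recursion; split=> //; case: drec => h1 h2; split=> //.
    by move=> i' k' ij' _; apply: h1.
  pose D i k := d j 0%N * ue x%:C i k - d i k.
  have Dfix i' k' : D i' k' = spfix x%:C D i' k'.
    have /(spfix_recursion x%:C 0 D) -> : recursion x%:C true D /\ D j 0%N = 0.
      have [[h1 h2] h3] := (spfix_recursion _ _ _).1 (ue_fix es).
      have [g1 g2] := drec.
      split; last by rewrite /D h3; ring.
      split=> [i1 k1 ij1 kN|k1]; rewrite rowsum_lin.
        transitivity (d j 0%N * (k1.-1%:R * ue x%:C i1 k1.-1
            - x%:C * (k1.+1%:R * ue x%:C i1 k1.+1))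
          - (k1.-1%:R * d i1 k1.-1 - x%:C * (k1.+1%:R * d i1 k1.+1))).
          by rewrite /D; ring.
        by rewrite h1 // g1 // /D; ring.
      by rewrite -h2 -g2 /D; ring.
    by rewrite mul0r add0r.
  have D0 : forall i k, D i k = 0.
    apply: (@spfix_eq0 x%:C D (cabs (d j 0%N) * \sum_(i < n) 8 * W 0%N + M)) => // K.
    apply: (@le_trans _ _ (cabs (d j 0%N) * (\sum_(i < n) \sum_(k < K)
        W k * cabs (ue x%:C i k)) + \sum_(k < K) W k * \sum_i cabs (d i k))).
      rewrite exchange_big /= mulr_sumr -big_split /=; apply: ler_sum => k _.
      rewrite -mulr_sumr mulrCA -mulrDr ler_wpM2l ?(ltW (W0 k)) //.
      rewrite mulr_sumr -big_split /=; apply: ler_sum => i' _.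
      by rewrite -cabsM -(cabsN (d i' k)) cabsD.
    rewrite lerD // ler_wpM2l ?cabs_ge0 //; apply: ler_sum => i' _.
    exact: ue_asum.
  have dE : d = fun i k => d j 0%N * ue x%:C i k.
    by apply/funext => i'; apply/funext => k'; rewrite [RHS](subr0_eq (D0 i' k')).
  have c0 : d j 0%N != 0.
    by apply: contra dn0 => /eqP c0; rewrite dE c0 mul0r.
  apply: (mulfI c0); rewrite mulr0.
  have [/(_ i N ij isT) g1 _] := drec.
  have r0 : rowsum (qe x%:C i) d N = d j 0%N * rowsum (qe x%:C i) (ue x%:C) N.
    apply/esym/subr0_eq; rewrite -rowsum_lin /rowsum big1 // => l _.
    by rewrite /cprod big1 // => b _; rewrite -[X in _ * X]/(D l (N - b)%N) D0 mulr0.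
  transitivity (a i * d i N + rowsum (qe x%:C i) d N
    - (N.-1%:R * d i N.-1 - x%:C * (N.+1%:R * d i N.+1))); last by rewrite g1 subrr.
  rewrite r0; have dEi k' : d i k' = d j 0%N * ue x%:C i k'.
    by rewrite [in LHS]dE.
  by rewrite !dEi; ring.
move=> e es; have [[h1 h2] h3] := (spfix_recursion _ _ _).1 (ue_fix es).
split=> //; split=> // i k ij _; have [kN|kN] := eqVneq k N; last exact: h1.
rewrite kN; have [_ H] := residual_evals i es.
apply/esym/subr0_eq; apply: (sums_unique H); apply: sumsN0 => m.
by rewrite res0 // mul0r.
Qed.

End Specialization.

(** * Choice of the weights and norms of the coefficients *)

Section Weights.
Variable R : realType.

Lemma weights_exist (alpha A tau : R) : 0 < alpha -> alpha <= A -> 0 < tau ->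
  exists (N : nat) (sg rho rho1 : R) (W : nat -> R),
  [/\ [/\ 0 < sg, sg <= rho, rho <= tau & 0 < rho1],
      forall k, rho1 ^+ k <= W k, forall k, W k <= rho ^+ k
    & forall (kap kap' : nat -> R) (eta eta' : R),
      (forall k, 0 <= kap k) -> (forall k, 0 <= kap' k) ->
      rsum (fun k => kap k * rho ^+ k) eta -> rsum (fun k => kap' k * rho ^+ k) eta' ->
      eta <= 8^-1 * alpha -> tau * eta' <= 8^-1 ->
      weights_ok N alpha A sg rho eta eta' kap kap' W].
Proof.
move=> al0 alA t0; have A0 : 0 < A := lt_le_trans al0 alA.
(* [N >= 8 A / tau] makes the outer ratio 8 A / N at most [tau]; the successor makes [N]
   positive. *)
pose N := (Num.bound (8 * A / tau)).+1.
have N0 : 0 < N%:R :> R by rewrite ltr0n.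
have AN : 8 * A / tau <= N%:R.
  have := archi_boundP (_ : 0 <= 8 * A / tau); rewrite divr_ge0 ?mulr_ge0 ?(ltW t0) ?(ltW A0) // => /(_ isT) h.
  by apply: le_trans (ltW h) _; rewrite ler_nat.
pose rho := 8 * A / N%:R; pose rho1 := alpha / (8 * N%:R).
have rho0 : 0 < rho by rewrite divr_gt0 ?mulr_gt0.
have rho10 : 0 < rho1 by rewrite divr_gt0 ?mulr_gt0.
have rhot : rho <= tau.
  by rewrite /rho ler_pdivrMr // (mulrC tau) -ler_pdivrMr.
have rho1N : rho1 * N%:R = 8^-1 * alpha by rewrite /rho1; field; rewrite gt_eqF.
have rhoN : rho * N%:R = 8 * A by rewrite /rho divfK // gt_eqF.
have rr : rho1 <= rho.
  rewrite -(ler_pM2r N0) rho1N rhoN; lra.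
pose W k := rho1 ^+ minn k N * rho ^+ (k - N).
have WS1 k : (k < N)%N -> W k.+1 = rho1 * W k.
  move=> kN; rewrite /W (minn_idPl kN) (minn_idPl (ltnW kN)) exprS -mulrA.
  by move: (kN) (ltnW kN); rewrite -!subn_eq0 => /eqP -> /eqP ->.
have WS2 k : (N <= k)%N -> W k.+1 = rho * W k.
  by move=> Nk; rewrite /W (minn_idPr Nk) (minn_idPr (leqW Nk)) subSn // exprS mulrCA.
have W0 k : 0 < W k by rewrite mulr_gt0 ?exprn_gt0.
have WS k : W k.+1 <= rho * W k.
  by case: (ltnP k N) => [/WS1|/WS2] -> //; rewrite ler_wpM2r // ltW.
have WS' k : rho1 * W k <= W k.+1.
  by case: (ltnP k N) => [/WS1|/WS2] -> //; rewrite ler_wpM2r // ltW.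
have W00 : W 0%N = 1 by rewrite /W min0n sub0n !expr0 mulr1.
have Wsub k l : W (k + l)%N <= rho ^+ k * W l.
  elim: k => [|k IH]; first by rewrite mul1r.
  apply: le_trans (WS _) _; rewrite exprS -mulrA ler_wpM2l //.
  exact: ltW.
(* The second entry keeps eps (k+1) u_(k+1) small below N in spite of the small ratio [rho1]; the
   third keeps eps (k+2) u_(k+2) small from N on, where 24 is 8 times the 3 in k + 2 <= 3 k. *)
pose sg := Num.min (Num.min rho (alpha * rho1 / (8 * N%:R))) (rho ^+ 2 / 24).
have sg0 : 0 < sg.
  rewrite !lt_min rho0 /=; apply/andP; split.
    by apply: divr_gt0; apply: mulr_gt0.
  by apply: divr_gt0 => //; apply: exprn_gt0.
have sg1 : sg * N%:R <= 8^-1 * alpha * rho1.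
  have : sg <= alpha * rho1 / (8 * N%:R) by rewrite !ge_min lexx !orbT.
  rewrite ler_pdivlMr ?mulr_gt0 // => h; lra.
have sg2 : 24 * sg <= rho ^+ 2.
  have : sg <= rho ^+ 2 / 24 by rewrite !ge_min lexx !orbT.
  lra.
exists N; exists sg; exists rho; exists rho1; exists W; split=> //.
- by split=> //; rewrite !ge_min lexx.
- elim=> [|k IH]; first by rewrite W00.
  by apply: le_trans (WS' k); rewrite exprS ler_wpM2l // ltW.
- by move=> k; have := Wsub k 0%N; rewrite addn0 W00 mulr1.
move=> kap kap' eta eta' k0 k0' ks ks' et et'.
have eta0' := rsum_ge0 ks'.
split=> //; try exact: ltW.
- move=> k kN; rewrite WS1 ?(ltnW kN) // mulrAC ler_wpM2r ?(ltW (W0 k)) //.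
  rewrite -rho1N ler_wpM2l ?(ltW rho10) // ler_nat.
  exact: ltnW (ltnW kN).
- move=> k kN; rewrite WS1 // (mulrC (W k)) [X in _ <= X]mulrA ler_wpM2r ?(ltW (W0 k)) //.
  by apply: le_trans sg1; rewrite ler_wpM2l ?(ltW sg0) // ler_nat.
- move=> k Nk; rewrite WS2 // (mulrC (W k)) [X in _ <= X]mulrA ler_wpM2r ?(ltW (W0 k)) //.
  have : N%:R <= k%:R :> R by rewrite ler_nat.
  by move=> /(ler_wpM2l (ltW rho0)); rewrite rhoN; lra.
- move=> k Nk; rewrite WS2 ?leqW // WS2 // (mulrC (W k)) 2![X in _ <= X]mulrA ler_wpM2r ?(ltW (W0 k)) //.
  have k3 : k.+2%:R <= 3 * k%:R :> R.
    by rewrite -natrM ler_nat mulSn -addn2 leq_add2l (leq_trans _ (leq_pmulr 2 _)) // (leq_trans _ Nk).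
  apply: le_trans (ler_wpM2l (ltW sg0) k3) _.
  have kk : 0 <= k%:R :> R by [].
  have := ler_wpM2l kk sg2; rewrite expr2; lra.
- move=> k Nk; rewrite WS2 // (mulrC (W k)) [X in _ <= X]mulrA ler_wpM2r ?(ltW (W0 k)) //.
  have : N%:R <= k%:R :> R by rewrite ler_nat.
  by move=> /(ler_wpM2l (ltW rho0)); rewrite rhoN; lra.
by apply: le_trans et'; rewrite ler_wpM2r.
Qed.

(** The l1-norm over m of each column is an infinite sum of moduli. It is obtained as the limit of a
    complex series with nonnegative real terms, and the bound on squares then controls the weighted
    total of these norms. *)
Lemma col_norms (c : nat -> nat -> R[i]) (sg rho M : R) : 0 <= sg -> 0 < rho ->
  (forall K : nat, \sum_(m < K) \sum_(k < K) cabs (c m k) * sg ^+ m * rho ^+ k <= M) ->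
  exists qb : nat -> R, [/\ forall k, asumr (c ^~ k) sg (qb k),
    forall k, 0 <= qb k & rsum (fun k => qb k * rho ^+ k) M].
Proof.
move=> sg0 rho0 cM.
pose w m k := (cabs (c m k) * sg ^+ m * rho ^+ k)%:C : R[i].
have w0 m k : 0 <= cabs (c m k) * sg ^+ m * rho ^+ k.
  by rewrite !mulr_ge0 ?exprn_ge0 ?cabs_ge0 // ltW.
have wM (K : nat) : \sum_(m < K) \sum_(k < K) cabs (w m k) <= M.
  apply: le_trans (cM K); apply: ler_sum => m _; apply: ler_sum => k _.
  by rewrite /w cabsR ger0_norm.
have /choice[g wg] k : exists S, sums (fun m => w m k) S.
  exact: asum_sums (square_col k wM).
have part k K : \sum_(m < K) cabs (w m k) <= cabs (g k).
  apply/ler_addgt0Pr => e /(wg k)[K' /(_ _ (leq_maxr K K'))].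
  have -> : \sum_(m < maxn K K') w m k = (\sum_(m < maxn K K') cabs (w m k))%:C.
    rewrite rmorph_sum; apply: eq_bigr => m _.
    by rewrite /w cabsR ger0_norm.
  have h1 := @psum_mono _ (fun m => cabs (w m k)) (fun=> cabs_ge0 _) _ _ (leq_maxl K K').
  set S := \sum_(m < maxn K K') _ in h1 *.
  have := cabs_triangle_rev S%:C (g k); rewrite cabsR.
  by have := ler_norm S; lra.
exists (fun k => cabs (g k) / rho ^+ k); split=> [k K|k|K].
- rewrite ler_pdivlMr ?exprn_gt0 // mulr_suml; apply: le_trans (part k K).
  apply: ler_sum => m _; rewrite /w cabsM cabs_realexp // cabsR ger0_norm //.
- by rewrite divr_ge0 ?cabs_ge0 // exprn_ge0 // ltW.
apply: le_trans (square_asum wM wg K); apply: ler_sum => k _.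
by rewrite divfK // gt_eqF // exprn_gt0.
Qed.

End Weights.

(** * Recursion of coefficients and differential equation *)

Section Equations.
Variable R : realType.
Variables (n : nat) (j : 'I_n) (a : 'I_n -> R[i]) (N : nat) (e : R[i]).
Variables (qe : R[i] -> 'I_n -> 'I_n -> nat -> R[i]) (pe : R[i] -> 'I_n -> nat -> R[i]).
Variables (s : R) (Mf : 'I_n -> 'I_n -> R[i] -> R[i]) (Rf : 'I_n -> R[i] -> R[i]).
Hypotheses (Mf_ps : forall i l, i != j ->
    ps (Mf i l) (fun k => qe e i l k + (if (k == 0%N) && (i == l) then a i else 0)) s)
  (Rf_ps : forall l, ps (Rf l) (pe e l) s)
  (Mf_j : forall l x, Mf j l x = (x ^+ 2 - e) * Rf l x).

Lemma rowsum_diag (d : 'I_n -> nat -> R[i]) i k :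
  rowsum (fun l k => qe e i l k + (if (k == 0%N) && (i == l) then a i else 0)) d k
  = a i * d i k + rowsum (qe e i) d k.
Proof.
rewrite /rowsum (bigD1 i) //= [X in _ = _ + X](bigD1 i) //= addrA; congr (_ + _).
  rewrite /cprod big_ord_recl [in RHS]big_ord_recl eqxx /= subn0 mulrDl.
  rewrite [X in X + _]addrC -addrA; congr (_ + (_ + _)).
  by apply: eq_bigr => b _; rewrite addr0.
apply: eq_bigr => l li; rewrite /cprod; apply: eq_bigr => b _.
by rewrite [i == l]eq_sym (negPf li) andbF addr0.
Qed.

Lemma ps_singular_deriv f1 (d : nat -> R[i]) s1 :
  ps f1 (fun k => k.+1%:R * d k.+1) s1 ->
  ps (fun x => (x ^+ 2 - e) * f1 x)
     (fun k => k.-1%:R * d k.-1 - e * (k.+1%:R * d k.+1)) s1.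
Proof.
move=> f1c; apply: (eq_ps _ (ps_ext _ (psB (ps_mulx (ps_mulx f1c)) (psZ e f1c)))).
  by case=> [|[|k]] //=; rewrite mul0r.
by move=> x _; rewrite mulrBl mulrA.
Qed.

(** Comparison of coefficients. In row j both sides carry the factor x^2 - e, which does not vanish
    near the origin for e <> 0; cancelling it leaves a regular equation for the derivative of
    v_j. *)
Lemma ode_recursion (v : 'I_n -> R[i] -> R[i]) d s1 : e != 0 ->
  (forall i, ps (v i) (d i) s1) ->
  (forall x, cabs x < s1 -> forall i, exists dv, is_derive x 1 (v i) dv /\
     (x ^+ 2 - e) * dv = \sum_l Mf i l x * v l x) ->
  recursion j a N qe pe e false d.
Proof.
move=> e0 vd ode.
have [s0 _ _] := Rf_ps j; have [s10 _ _] := vd j.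
pose s2 := Num.min s s1.
have s20 : 0 < s2 by rewrite lt_min s0.
have vd2 i : ps (v i) (d i) s2 by apply: ps_weaken (vd i) _; rewrite s20 ge_min lexx orbT.
have eqd x i f1 : cabs x < s2 -> is_derive x 1 (v i) f1 ->
    (x ^+ 2 - e) * f1 = \sum_l Mf i l x * v l x.
  rewrite lt_min => /andP[_ xs] [_ <-].
  by have [dv [[_ <-] ->]] := ode x xs i.
have s28 : 0 < s2 / 8 by rewrite divr_gt0.
have s22 : 0 < s2 / 2 <= s2 by rewrite divr_gt0 //=; lra.
split=> [i k ij _|k].
  have [f1 f1c f1d] := ps_deriv (vd2 i).
  have lhs := ps_singular_deriv f1c.
  have rhs : ps (fun x => \sum_l Mf i l x * v l x)
     (rowsum (fun l k => qe e i l k + (if (k == 0%N) && (i == l) then a i else 0)) d) (s2 / 2).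
    apply: ps_weaken s22; apply: ps_big => // l; apply: psM => //.
    by apply: ps_weaken (Mf_ps l ij) _; rewrite s20 ge_min lexx.
  rewrite -rowsum_diag; apply: (ps_uniq lhs rhs s28) => y ys.
  by apply: eqd (f1d y ys); lra.
have [f1 f1c f1d] := ps_deriv (vd2 j).
have rhs : ps (fun x => \sum_l Rf l x * v l x) (rowsum (pe e) d) (s2 / 2).
  apply: ps_weaken s22; apply: ps_big => // l; apply: psM => //.
  by apply: ps_weaken (Rf_ps l) _; rewrite s20 ge_min lexx.
(* The bounds 1 and |e| give |y^2| < |e|, so y^2 - e does not vanish. *)
have m0 : 0 < Num.min (s2 / 8) (Num.min 1 (cabs e)).
  by rewrite !lt_min s28 ltr01 cabs_gt0.
apply: (ps_uniq f1c rhs m0) => y; rewrite !lt_min => /and3P[ys y1 ye].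
have ye0 : y ^+ 2 - e != 0.
  apply/eqP => /subr0_eq E; have : cabs e < cabs e; last by rewrite ltxx.
  rewrite -{1}E cabsX expr2; apply: le_lt_trans ye.
  by rewrite ler_piMl ?cabs_ge0 // ltW.
have ys2 : cabs y < s2 by lra.
apply: (mulfI ye0); rewrite mulr_sumr (eqd y j _ ys2 (f1d y ys)).
by apply: eq_bigr => l _; rewrite Mf_j mulrA.
Qed.

Lemma recursion_ode (v : 'I_n -> R[i] -> R[i]) d s1 : s1 <= s ->
  (forall i, ps (v i) (d i) s1) -> recursion j a N qe pe e false d ->
  forall x, cabs x < s1 / 8 -> forall i, exists dv, is_derive x 1 (v i) dv /\
     (x ^+ 2 - e) * dv = \sum_l Mf i l x * v l x.
Proof.
move=> s1s vd [r1 r2] x xs i; have [s10 _ _] := vd j.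
have s12 : 0 < s1 / 2 <= s1 by rewrite divr_gt0 //=; lra.
have s1s' : 0 < s1 <= s by rewrite s10.
have xs2 : cabs x < s1 / 2 by lra.
have [f1 f1c f1d] := ps_deriv (vd i); exists (f1 x); split; first exact: f1d.
have [ij|ij] := eqVneq i j; last first.
  have [_ _ lhs] := ps_singular_deriv f1c.
  have : ps (fun x => \sum_l Mf i l x * v l x)
     (rowsum (fun l k => qe e i l k + (if (k == 0%N) && (i == l) then a i else 0)) d) (s1 / 2).
    apply: ps_weaken s12; apply: ps_big => // l; apply: psM => //.
    exact: ps_weaken (Mf_ps l ij) _.
  move=> [_ _ /(_ x xs2) rhs]; apply: (sums_unique (lhs x xs2)).
  by apply: eq_sums rhs => k; rewrite rowsum_diag r1.
have : ps (fun x => \sum_l Rf l x * v l x) (rowsum (pe e) d) (s1 / 2).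
  apply: ps_weaken s12; apply: ps_big => // l; apply: psM => //.
  exact: ps_weaken (Rf_ps l) _.
move=> [_ _ /(_ x xs2) rhs].
have [_ _ /(_ x xs2) lhs] := f1c.
have -> : f1 x = \sum_l Rf l x * v l x.
  by apply: (sums_unique lhs); apply: eq_sums rhs => k; rewrite ij r2.
by rewrite mulr_sumr; apply: eq_bigr => l _; rewrite ij Mf_j mulrA.
Qed.

End Equations.

(** * The analytic solution of the shifted system *)

Section AnalyticSolution.
Variable R : realType.
Variables (n : nat) (Y : ode_family R n) (j : 'I_n).

(** The matrix B - lambda_j: if (x^2 - e) f' = lambda_j f and y = f v solves the family, then v
    solves the system with this matrix. *)
Definition shifted (e x : R[i]) (i l : 'I_n) : R[i] :=
  sysmx Y e x i l - lam Y e x 0 j *+ (i == l).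

Definition shifted_ode (e : R[i]) (v : 'I_n -> R[i] -> R[i]) (x : R[i]) (i : 'I_n) :=
  exists dv, is_derive x 1 (v i) dv /\
    (x ^+ 2 - e) * dv = \sum_l shifted e x i l * v l x.

Lemma shiftedE e x i l : shifted e x i l =
  (lam Y e x 0 i - lam Y e x 0 j) *+ (i == l) + (x ^+ 2 - e) * remx Y e x i l.
Proof.
by rewrite /shifted /sysmx !mxE mulrnBl addrAC; congr (_ - _ + _).
Qed.

Lemma shifted_j e x l : shifted e x j l = (x ^+ 2 - e) * remx Y e x j l.
Proof. by rewrite shiftedE subrr mul0rn add0r. Qed.

Hypothesis hY : prenormal Y.

Lemma analytic20_lam i : analytic20 (fun e x => lam Y e x 0 i).
Proof.
have [h0 h1 _ _] := hY.
have [c0 [s0 /analytic20_fst a0]] := analytic_at0_ps (h0 i).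
have [c1 [s1 /analytic20_fst a1]] := analytic_at0_ps (h1 i).
apply: (@analytic20_ext _ _ _ 1 ltr01 _
  (analytic20D a0 (analytic20M (analytic20_x R) a1))) => e x _ _.
by rewrite /lam !mxE.
Qed.

Lemma analytic20_remx i l : analytic20 (fun e x => remx Y e x i l).
Proof. by have [_ _ h _] := hY; apply/analytic2_at_ds; apply: h. Qed.

Lemma analytic20_shifted i l : analytic20 (fun e x => shifted e x i l).
Proof.
pose b := (((i == l)%:R : R[i])).
have lamB := analytic20B (analytic20_lam i) (analytic20_lam j).
have x2e := analytic20B (analytic20M (analytic20_x R) (analytic20_x R)) (analytic20_e R).
apply: (@analytic20_ext _ _ _ 1 ltr01 _ (analytic20D
  (analytic20M lamB (analytic20_cst b)) (analytic20M x2e (analytic20_remx i l)))).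
by move=> e x _ _; rewrite shiftedE expr2 /b mulr_natr.
Qed.

Lemma ds_family (I : finType) (F : I -> R[i] -> R[i] -> R[i]) :
  (forall i, analytic20 (F i)) ->
  exists s c, 0 < s /\ forall i, ds (F i) (c i) s.
Proof.
move=> Fa; have /choice[c Hc] i : exists c, exists s, ds (F i) c s by exact: Fa.
have /choice[s Hs] := Hc.
have s0 i : 0 < s i by case: (Hs i).
pose s' := \big[Num.min/1]_i s i.
have s'0 : 0 < s' by rewrite /s'; elim/big_ind: _ => // x y x0 y0; rewrite lt_min x0.
exists s', c; split=> // i; apply: ds_weaken (Hs i) _; rewrite s'0 /s'.
by rewrite (bigD1 i) //= ge_min lexx.
Qed.

Lemma sqsum_common (I : finType) (c : I -> nat -> nat -> R[i]) s : 0 < s ->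
  (forall i, exists M, sqsum (c i) s M) -> exists M, forall i, sqsum (c i) s M.
Proof.
move=> s0 /choice[M HM]; exists (\sum_i M i) => i K; apply: le_trans (HM i K) _.
rewrite (bigD1 i) //= lerDl sumr_ge0 // => k _.
by have := HM k 0%N; rewrite big_ord0.
Qed.

Lemma lam_diff_neq0 i : i != j -> lam Y 0 0 0 i - lam Y 0 0 0 j != 0.
Proof.
have [_ _ _ h] := hY; rewrite neq_ltn => /orP[/h|/h]; rewrite /lam_diff => H.
  by apply/eqP => E; move: H; rewrite E ltxx.
by rewrite subr_eq0 eq_sym -subr_eq0; apply/eqP => E; move: H; rewrite E ltxx.
Qed.

(** The form in which the Stokes hypothesis enters at a fixed eps. [B] and [s] may depend on eps;
    the rate 4 / r may not, since the weights are chosen from it. *)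
Definition entire_data (r : R) (e : R[i]) := exists (v : 'I_n -> R[i] -> R[i])
    (d : 'I_n -> nat -> R[i]) (s B : R),
  [/\ forall i, ps (v i) (d i) s, forall i k, cabs (d i k) <= B * (4 / r) ^+ k,
      exists i, v i 0 != 0
    & forall x, cabs x < s -> forall i, shifted_ode e v x i].

Lemma analytic_solution (r e0 : R) : 0 < r -> 0 < e0 ->
  (forall y : R, 0 < y < e0 -> entire_data r y%:C) ->
  exists (u : 'I_n -> R[i] -> R[i] -> R[i]) (s : R),
  [/\ forall i, analytic20 (u i), u j 0 0 = 1, 0 < s
    & forall e x, cabs e < s -> cabs x < s -> forall i, shifted_ode e (fun i => u i e) x i].
Proof.
move=> r0 e00 data.
(* All the functions involved are indexed by one finite type, which yields a common radius and a
   common bound. *)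
pose F (x : ('I_n * 'I_n) + 'I_n) (e y : R[i]) : R[i] :=
  match x with inl p => shifted e y p.1 p.2 | inr l => remx Y e y j l end.
have [s [c [s0 Fc]]] : exists s c, 0 < s /\ forall i, ds (F i) (c i) s.
  apply: ds_family => -[[i l]|l]; [exact: analytic20_shifted|exact: analytic20_remx].
have [M cM] : exists M, forall x, sqsum (c x) s M.
  by apply: sqsum_common => // x; case: (Fc x).
have M0 : 0 <= M by have := cM (inr j) 0%N; rewrite big_ord0.
pose mu i l := c (inl (i, l)); pose p l := c (inr l).
pose a i := lam Y 0 0 0 i - lam Y 0 0 0 j.
have mu0 i l : mu i l 0%N 0%N = a i *+ (i == l).
  have /ds_rows[_ _ /(_ 0)] := Fc (inl (i, l)); rewrite cabs0 => /(_ s0)[g gs gps].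
  have g0 : g 0%N = mu i l 0%N 0%N.
    apply: (sums_unique (gs 0%N)).
    have : sums (fun k => mu i l k 0%N * (0 : R[i]) ^+ k)
       (\sum_(k < 1) mu i l k 0%N * (0 : R[i]) ^+ k).
      by apply: sums_finite => -[//|k] _; rewrite expr0n /= mulr0.
    by rewrite big_ord1 expr0 mulr1.
  by rewrite -g0 -(ps_at0 gps) /= shiftedE expr0n /= subrr mul0r addr0.
have [alpha al0 a_ge] : exists2 alpha : R, 0 < alpha & forall i, i != j -> alpha <= cabs (a i).
  exists (\big[Num.min/1]_(i | i != j) cabs (a i)).
    elim/big_ind: _ => //= [x y x0 y0|i ij]; first by rewrite lt_min x0.
    by rewrite cabs_gt0 lam_diff_neq0.
  by move=> i ij; rewrite (bigD1 i) //= ge_min lexx.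
pose A := alpha + \sum_i cabs (a i).
have Sa0 : 0 <= \sum_i cabs (a i) by rewrite sumr_ge0 // => i _; apply: cabs_ge0.
have alA : alpha <= A by rewrite lerDl.
have a_le i : i != j -> cabs (a i) <= A.
  move=> _; rewrite /A (bigD1 i) //= addrCA lerDl addr_ge0 ?(ltW al0) //.
  by rewrite sumr_ge0 // => l _; apply: cabs_ge0.
pose nR : R := n%:R; have nR0 : 0 <= nR by [].
pose c1 := 8 * (nR * (nR * M)) + 1; pose c2 := 8 * (nR * M) + 1.
have c10 : 0 < c1 by rewrite ltr_pwDr // !mulr_ge0.
have c20 : 0 < c2 by rewrite ltr_pwDr // !mulr_ge0.
(* Upper bound for [rho]: [s] for convergence, r / 8 so that the weights times (4 / r)^k are at most
   2^-k, and the last two entries for the smallness of [eta] and [eta']. *)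
pose tau := Num.min (Num.min s (r / 8)) (Num.min (alpha * s / c1) (c2^-1)).
have tau0 : 0 < tau.
  by rewrite !lt_min s0 invr_gt0 c20 !divr_gt0 ?mulr_gt0.
have taus : tau <= s by rewrite !ge_min lexx.
have taur : tau <= r / 8 by rewrite !ge_min lexx !orbT.
have tau1 : tau * c1 <= alpha * s by rewrite -ler_pdivlMr // !ge_min lexx !orbT.
have tau2 : tau * c2 <= 1 by rewrite -ler_pdivlMr // mul1r !ge_min lexx !orbT.
have [N [sg [rho [rho1 [W [[sg0 sgrho rhotau rho10] W_ge W_le Wok]]]]]] :=
  weights_exist al0 alA tau0.
have rho0 : 0 < rho := lt_le_trans sg0 sgrho.
have rhos : rho <= s := le_trans rhotau taus.
have sgs : sg <= s := le_trans sgrho rhos.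
(* The constant term is the diagonal a_i, which [fixop] treats separately as a main term. Every
   other monomial has positive degree and gains a factor rho / s. *)
pose q i l m k := if (m == 0%N) && (k == 0%N) then 0 else mu i l m k.
have q_small i l (K : nat) :
    \sum_(m < K) \sum_(k < K) cabs (q i l m k) * sg ^+ m * rho ^+ k <= rho / s * M.
  apply: le_trans (ler_wpM2l _ (cM (inl (i, l)) K)); last by rewrite divr_ge0 ?ltW.
  rewrite mulr_sumr; apply: ler_sum => m _; rewrite mulr_sumr; apply: ler_sum => k _.
  rewrite /q; case: ifP => [_|mk].
    by rewrite cabs0 !mul0r !mulr_ge0 ?cabs_ge0 ?invr_ge0 ?exprn_ge0 ?ltW.
  rewrite -mulrA [X in _ <= X]mulrCA ler_wpM2l ?cabs_ge0 //.
  have mk1 : (0 < m + k)%N by rewrite lt0n addn_eq0 mk.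
  apply: (@le_trans _ _ (rho ^+ (m + k))).
    rewrite exprD ler_wpM2r ?exprn_ge0 ?(ltW rho0) //.
    by rewrite lerXn2r ?nnegrE ?(ltW sg0) ?(ltW rho0).
  rewrite -(prednK mk1) !exprS mulrA divfK ?gt_eqF // ler_wpM2l ?(ltW rho0) //.
  by rewrite lerXn2r ?nnegrE ?(ltW s0) ?(ltW rho0).
have p_small l (K : nat) :
    \sum_(m < K) \sum_(k < K) cabs (p l m k) * sg ^+ m * rho ^+ k <= M.
  apply: le_trans (cM (inr l) K); apply: ler_sum => m _; apply: ler_sum => k _.
  rewrite -mulrA ler_wpM2l ?cabs_ge0 // exprD; apply: ler_pM;
    rewrite ?exprn_ge0 ?(ltW sg0) ?(ltW rho0) //;
    by rewrite lerXn2r ?nnegrE ?(ltW sg0) ?(ltW rho0) ?(ltW s0).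
have /choice[qb0 Hqb] (x : 'I_n * 'I_n) := col_norms (ltW sg0) rho0 (q_small x.1 x.2).
pose qb i l := qb0 (i, l).
have /choice[pb Hpb] l := col_norms (ltW sg0) rho0 (p_small l).
have q_sum i l k : asumr (q i l ^~ k) sg (qb i l k).
  by have [h _ _] := Hqb (i, l); exact: h.
have qb0' i l k : 0 <= qb i l k by have [_ h _] := Hqb (i, l); exact: h.
have p_sum l k : asumr (p l ^~ k) sg (pb l k) by have [h _ _] := Hpb l; exact: h.
have pb0' l k : 0 <= pb l k by have [_ h _] := Hpb l; exact: h.
pose kap k := \sum_i \sum_l qb i l k; pose kap' k := \sum_l pb l k.
have kap0 k : 0 <= kap k by rewrite sumr_ge0 // => i _; rewrite sumr_ge0.
have kap0' k : 0 <= kap' k by rewrite sumr_ge0.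
have q_le i k : i != j -> \sum_l qb i l k <= kap k.
  move=> _; rewrite /kap [X in _ <= X](bigD1 i) //= lerDl sumr_ge0 // => i' _.
  by rewrite sumr_ge0.
have p_le k : \sum_l pb l k <= kap' k by [].
have kapS : rsum (fun k => kap k * rho ^+ k) (nR * (nR * (rho / s * M))).
  move=> K; rewrite /kap.
  under eq_bigr do rewrite mulr_suml; rewrite exchange_big /=.
  apply: (@le_trans _ _ (\sum_(i < n) nR * (rho / s * M))); last first.
    by rewrite sumr_const card_ord -[_ *+ n]mulr_natl.
  apply: ler_sum => i _; under eq_bigr do rewrite mulr_suml; rewrite exchange_big /=.
  apply: (@le_trans _ _ (\sum_(i < n) rho / s * M)); last first.
    by rewrite sumr_const card_ord -[_ *+ n]mulr_natl.
  by apply: ler_sum => l _; have [_ _ ] := Hqb (i, l); apply.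
have kapS' : rsum (fun k => kap' k * rho ^+ k) (nR * M).
  move=> K; rewrite /kap'.
  under eq_bigr do rewrite mulr_suml; rewrite exchange_big /=.
  apply: (@le_trans _ _ (\sum_(i < n) M)); last first.
    by rewrite sumr_const card_ord -[_ *+ n]mulr_natl.
  by apply: ler_sum => l _; have [_ _ ] := Hpb l; apply.
have ok : weights_ok N alpha A sg rho (nR * (nR * (rho / s * M))) (nR * M) kap kap' W.
  apply: Wok => //.
    have -> : nR * (nR * (rho / s * M)) = rho * (nR * (nR * M)) / s by field; rewrite gt_eqF.
    rewrite ler_pdivrMr //.
    have : rho * (nR * (nR * M)) <= tau * (nR * (nR * M)) by rewrite ler_wpM2r ?mulr_ge0.
    by move: tau1; rewrite /c1; lra.
  by move: tau2; rewrite /c2; lra.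
have [U [U_fix U_sum]] := formal_solution q_sum p_sum q_le p_le a_ge a_le sg0 ok.
have cvg_at (z : nat -> R[i]) : (exists B, asumr z sg B) -> exists g : R[i] -> R[i],
    forall e, cabs e <= sg -> sums (fun m => z m * e ^+ m) (g e).
  move=> [B zB].
  have /choice[g Hg] (e : R[i]) : exists S, cabs e <= sg -> sums (fun m => z m * e ^+ m) S.
    case: (leP (cabs e) sg) => [es|_]; last by exists 0.
    by have [S HS] := asum_sums (asumr_le zB es); exists S.
  by exists g.
have /choice[qe0 Hqe] (x : 'I_n * 'I_n * nat) : exists g : R[i] -> R[i],
    forall e, cabs e <= sg -> sums (fun m => q x.1.1 x.1.2 m x.2 * e ^+ m) (g e).
  by apply: cvg_at; eexists; apply: q_sum.
pose qe e i l k := qe0 (i, l, k) e.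
have qe_sum e i l k : cabs e <= sg -> sums (fun m => q i l m k * e ^+ m) (qe e i l k).
  exact: (Hqe (i, l, k)).
have /choice[pe0 Hpe] (x : 'I_n * nat) : exists g : R[i] -> R[i],
    forall e, cabs e <= sg -> sums (fun m => p x.1 m x.2 * e ^+ m) (g e).
  by apply: cvg_at; eexists; apply: p_sum.
pose pe e l k := pe0 (l, k) e.
have pe_sum e l k : cabs e <= sg -> sums (fun m => p l m k * e ^+ m) (pe e l k).
  exact: (Hpe (l, k)).
have U_asum' i k : asumr (U i k) sg (8 * W 0%N / W k).
  exact: (U_asum sg0 ok U_sum).
have /choice[ue0 Hue] (x : 'I_n * nat) : exists g : R[i] -> R[i],
    forall e, cabs e <= sg -> sums (fun m => U x.1 x.2 m * e ^+ m) (g e).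
  by apply: cvg_at; eexists; apply: U_asum'.
pose ue e i k := ue0 (i, k) e.
have ue_sum e i k : cabs e <= sg -> sums (fun m => U i k m * e ^+ m) (ue e i k).
  exact: (Hue (i, k)).
have Mf_ps e i l : cabs e < sg -> i != j -> ps (fun x => shifted e x i l)
    (fun k => qe e i l k + (if (k == 0%N) && (i == l) then a i else 0)) s.
  move=> es _; have /ds_rows[_ _ /(_ e (lt_le_trans es sgs))] := Fc (inl (i, l)).
  move=> [g gs gps]; apply: eq_ps gps => k; apply: (sums_unique (gs k)).
  have := sumsD (qe_sum e i l k (ltW es)) (_ : sums (fun m => (if (m == 0%N) && (k == 0%N)
    then a i *+ (i == l) else 0) * e ^+ m) (if (k == 0%N) && (i == l) then a i else 0)).
  move=> H; apply: eq_sums (H _) => [m|].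
    rewrite -mulrDl /q; case: ifP => [/andP[/eqP -> /eqP ->]|]; last by rewrite addr0.
    by rewrite add0r -mu0.
  have : sums (fun m => (if (m == 0%N) && (k == 0%N) then a i *+ (i == l) else 0) * e ^+ m)
     (\sum_(m < 1) (if (val m == 0%N) && (k == 0%N) then a i *+ (i == l) else 0) * e ^+ m).
    by apply: sums_finite => -[//|m] _; rewrite mul0r.
  rewrite big_ord1 expr0 mulr1 /=.
  by case: (k == 0%N); case: (i == l).
have Rf_ps e l : cabs e < sg -> ps (fun x => remx Y e x j l) (pe e l) s.
  move=> es; have /ds_rows[_ _ /(_ e (lt_le_trans es sgs))] := Fc (inr l).
  move=> [g gs gps]; apply: eq_ps gps => k; apply: (sums_unique (gs k)).
  exact: (pe_sum e l k (ltW es)).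
have sol : forall y : R, 0 < y < Num.min e0 sg -> exists d B,
    [/\ recursion j a N qe pe y%:C false d, rsum (fun k => W k * \sum_i cabs (d i k)) B
      & exists i k, d i k != 0].
  move=> y; rewrite lt_min => /and3P[y0 ye ys].
  have [|v [d [s1 [B [vd dB [i0 vi0] ode]]]]] := data y; first by rewrite y0.
  have yc : cabs y%:C < sg by rewrite cabsR gtr0_norm.
  have yn0 : y%:C != 0 by rewrite -cabs_gt0 cabsR gtr0_norm.
  exists d, (nR * (B * 2)); split.
  - exact: (@ode_recursion R n j a N y%:C qe pe s (fun i l x => shifted y%:C x i l)
      (fun l x => remx Y y%:C x j l) (fun i l => Mf_ps y%:C i l yc)
      (fun l => Rf_ps y%:C l yc) (fun l x => shifted_j y%:C x l) v d s1 yn0 vd ode).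
  - have B0 : 0 <= B by have := dB i0 0%N; rewrite expr0 mulr1; apply: le_trans; apply: cabs_ge0.
    have half k : W k * (4 / r) ^+ k <= 2^-1 ^+ k.
      apply: (@le_trans _ _ (rho ^+ k * (4 / r) ^+ k)).
        by rewrite ler_wpM2r // exprn_ge0 // divr_ge0 // ltW.
      have r40 : 0 <= 4 / r by rewrite divr_ge0 // ltW.
      have rhor : rho * (4 / r) <= 2^-1.
        by rewrite mulrA ler_pdivrMr //; move: rhotau taur; lra.
      rewrite -exprMn; apply: lerXn2r rhor; rewrite nnegrE ?invr_ge0 //.
      exact: mulr_ge0 (ltW rho0) r40.
    move=> K; apply: (@le_trans _ _ (\sum_(k < K) nR * (B * 2^-1 ^+ k))).
      apply: ler_sum => k _; rewrite mulr_sumr.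
      apply: (@le_trans _ _ (\sum_(i < n) B * 2^-1 ^+ k)); last first.
        by rewrite sumr_const card_ord -[_ *+ n]mulr_natl.
      apply: ler_sum => i _; apply: le_trans (ler_wpM2l B0 (half k)).
      by rewrite mulrCA ler_wpM2l ?dB // ltW // (w_gt0 ok).
    by rewrite -mulr_sumr -mulr_sumr !ler_wpM2l // geo_half.
  - by exists i0, 0%N; rewrite -(ps_at0 (vd i0)).
have m0 : 0 < Num.min e0 sg by rewrite lt_min e00.
have main := ue_recursion q_sum p_sum q_le p_le a_ge a_le sg0 ok qe_sum pe_sum
  U_fix U_sum ue_sum m0 sol.
(* Since [W k >= rho1 ^+ k], the weighted bound on the coefficients gives absolute convergence in x
   at the radius [rho1]. *)
pose s1 := Num.min sg rho1.
have s10 : 0 < s1 by rewrite lt_min sg0.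
have s1sg : s1 <= sg by rewrite ge_min lexx.
have s1rho : s1 <= rho1 by rewrite ge_min lexx orbT.
have cU i : sqsum (fun m k => U i k m) s1 (8 * W 0%N).
  move=> K; apply: le_trans (U_sum i K); apply: ler_sum => m _; apply: ler_sum => k _.
  rewrite -mulrA ler_wpM2l ?cabs_ge0 // exprD.
  apply: ler_pM; rewrite ?exprn_ge0 ?(ltW s10) //.
    by rewrite lerXn2r ?nnegrE ?(ltW s10) ?(ltW sg0).
  apply: le_trans (W_ge k); by rewrite lerXn2r ?nnegrE ?(ltW s10) ?(ltW rho10).
have /choice[u Hu] i := ds_exists s10 (cU i).
have u_ps e i : cabs e < s1 -> ps (u i e) (ue e i) s1.
  move=> es; have /ds_rows[_ _ /(_ e es)[g gs gps]] := Hu i.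
  apply: eq_ps gps => k; apply: (sums_unique (gs k)); apply: ue_sum.
  by apply: ltW; apply: lt_le_trans s1sg.
have s18 : s1 / 8 <= s1 by lra.
exists u, (s1 / 8); split.
- by move=> i; exists (fun m k => U i k m), s1.
- have z0 : cabs (0 : R[i]) < s1 by rewrite cabs0.
  rewrite (ps_at0 (u_ps 0 j z0)).
  by have [] := main 0 _; rewrite ?cabs0 ?(ltW sg0).
- by rewrite divr_gt0.
move=> e x es xs i.
have es1 : cabs e < s1 := lt_le_trans es s18.
have essg : cabs e < sg := lt_le_trans es1 s1sg.
have [rec _] := main e (ltW essg).
have s1s : s1 <= s := le_trans s1sg sgs.
exact: (@recursion_ode R n j a N e qe pe s (fun i l x => shifted e x i l)
  (fun l x => remx Y e x j l) (fun i l => Mf_ps e i l essg)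
  (fun l => Rf_ps e l essg) (fun l x => shifted_j e x l) (fun i => u i e) (ue e) s1
  s1s (fun i => u_ps e i es1) rec x xs i).
Qed.

End AnalyticSolution.

(** * The equivalent family *)

Section MatrixFunctions.
Variable R : realType.

Lemma cvg_mx_coord (T : Type) (F : set_system T) (FF : ProperFilter F) m n
    (f : T -> 'M[R[i]]_(m, n)) (L : 'M[R[i]]_(m, n)) :
  f @ F --> L <-> forall i k, f t i k @[t --> F] --> L i k.
Proof.
split=> [fL i k|fL].
  exact: (cvg_comp _ _ fL (@coord_continuous _ m n i k L)).
apply/cvg_ballP => e e0.
have : forall p : 'I_m * 'I_n, \forall t \near F, ball (L p.1 p.2) e (f t p.1 p.2).
  by move=> [i k] /=; move/cvg_ballP: (fL i k) => /(_ e e0).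
move=> /filter_forall H; apply: filterS H => t H.
by split=> // i k; apply: (H (i, k)).
Qed.

Lemma is_derive_mx m n (M : R[i] -> 'M[R[i]]_(m, n))
    (x : R[i]) (D : 'M[R[i]]_(m, n)) :
  is_derive x 1 M D <-> forall i k, is_derive x 1 (fun t => M t i k) (D i k).
Proof.
have E i k : (fun h : R[i] => h^-1 *: (((fun t => M t i k) \o shift x) (h *: 1) - M x i k))
   = (fun h => (h^-1 *: ((M \o shift x) (h *: 1) - M x)) i k).
  by apply/funext => h; rewrite !mxE.
split=> [[dM DM] i k|H].
  have c : h^-1 *: ((M \o shift x) (h *: 1) - M x) @[h --> 0^'] --> D.
    by rewrite -DM; exact: dM.
  have ci : h^-1 *: (((fun t => M t i k) \o shift x) (h *: 1) - M x i k) @[h --> 0^'] --> D i k.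
    by rewrite E; exact: ((cvg_mx_coord _ _ _).1 c i k).
  apply: DeriveDef; first by apply/cvg_ex; exists (D i k).
  exact: (cvg_lim (@norm_hausdorff _ _) ci).
have c : h^-1 *: ((M \o shift x) (h *: 1) - M x) @[h --> 0^'] --> D.
  apply/cvg_mx_coord => i k; have [dM DM] := H i k.
  by rewrite -E -DM; exact: dM.
apply: DeriveDef; first by apply/cvg_ex; exists D.
exact: (cvg_lim (@norm_hausdorff _ _) c).
Qed.

End MatrixFunctions.

(** * Reciprocal of an analytic germ *)

Section Inverse.
Variable R : realType.

(** Partial sums of the Neumann series of 1 / (1 - h). When h has no constant term, the coefficient
    of index (k, l) is final after k + l + 1 steps. *)
Fixpoint geom_iter (h : nat -> nat -> R[i]) (t : nat) : nat -> nat -> R[i] :=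
  if t is t'.+1 then fun k l => ((k == 0%N) && (l == 0%N))%:R + cprod2 h (geom_iter h t') k l
  else fun _ _ => 0.

Lemma geom_iter_stable h : h 0%N 0%N = 0 -> forall t u k l,
  (k + l < t)%N -> (k + l < u)%N -> geom_iter h t k l = geom_iter h u k l.
Proof.
move=> h0; elim=> [//|t IH] [//|u] k l kt ku /=; congr (_ + _).
apply: eq_bigr => a _; apply: eq_bigr => b _.
have [ab|ab] := posnP (a + b)%N.
  by move/eqP: ab; rewrite addn_eq0 => /andP[/eqP -> /eqP ->]; rewrite h0 !mul0r.
have lt : (k - a + (l - b) < k + l)%N.
  have ak : (a <= k)%N by rewrite -ltnS.
  have bl : (b <= l)%N by rewrite -ltnS.
  have E : (k + l = (k - a + (l - b)) + (a + b))%N by rewrite addnACA !subnK.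
  by rewrite [X in (_ < X)%N]E -[X in (X < _)%N]addn0 ltn_add2l.
by congr (_ * _); apply: IH; apply: leq_trans lt _.
Qed.

Lemma analytic20_inv (f : R[i] -> R[i] -> R[i]) : analytic20 f -> f 0 0 = 1 ->
  exists g s, [/\ analytic20 g, 0 < s &
    forall e x, cabs e < s -> cabs x < s -> f e x * g e x = 1].
Proof.
move=> [c [s fc]] f00; have [s0 [M cM] fs] := fc.
have c00 : c 0%N 0%N = 1.
  have := fs 0 0; rewrite cabs0 f00 => /(_ s0 s0) H.
  apply: (cvgs_unique _ H); apply: (cvgs_near (N := 1)) (cvgs_cst (c 0%N 0%N)).
  move=> [//|m] _; rewrite big_ord_recl [X in _ = _ + X]big1 ?addr0 => [|k _]; last first.
    by rewrite big1 // => l _; rewrite expr0n /= mulr0 mul0r.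
  rewrite big_ord_recl [X in _ = _ + X]big1 ?addr0 => [|l _]; last first.
    by rewrite [X in _ * X]expr0n /= mulr0.
  by rewrite !expr0 !mulr1.
pose h k l := if (k == 0%N) && (l == 0%N) then 0 else - c k l.
have M0 : 0 <= M by have := cM 0%N; rewrite big_ord0.
(* Passing from [s] to [r] shrinks every monomial of positive degree by at least r / s, so h has
   norm at most 1/2. *)
pose r := s / (2 * M + 1).
have den0 : 0 < 2 * M + 1 by lra.
have r0 : 0 < r by rewrite divr_gt0.
have rs : r <= s by rewrite ler_pdivrMr // ler_peMr ?(ltW s0) //; lra.
have h_small (K : nat) : \sum_(k < K) \sum_(l < K) cabs (h k l) * r ^+ (k + l) <= 2^-1.
  apply: (@le_trans _ _ (r / s * M)); last first.
    have -> : r / s * M = M / (2 * M + 1) by rewrite /r; field; rewrite !gt_eqF.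
    rewrite ler_pdivrMr //; lra.
  have rs0 : 0 <= r / s by rewrite divr_ge0 // ltW.
  apply: le_trans (ler_wpM2l rs0 (cM K)); rewrite mulr_sumr; apply: ler_sum => k _.
  rewrite mulr_sumr; apply: ler_sum => l _; rewrite /h; case: ifP => [_|kl].
    rewrite cabs0 mul0r mulr_ge0 // mulr_ge0 ?cabs_ge0 // exprn_ge0 // ltW //.
  rewrite cabsN [X in _ <= X]mulrCA ler_wpM2l ?cabs_ge0 //.
  have kl1 : (0 < k + l)%N by rewrite lt0n addn_eq0 kl.
  rewrite -(prednK kl1) !exprS mulrA divfK ?gt_eqF // ler_wpM2l ?(ltW r0) //.
  by rewrite lerXn2r ?nnegrE ?(ltW s0) ?(ltW r0).
have h00 : h 0%N 0%N = 0 by [].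
pose g k l := geom_iter h (k + l).+1 k l.
have gE k l : g k l = ((k == 0%N) && (l == 0%N))%:R + cprod2 h g k l.
  rewrite /g /=; congr (_ + _); apply: eq_bigr => a _; apply: eq_bigr => b _.
  have [ab|ab] := posnP (a + b)%N.
    by move/eqP: ab; rewrite addn_eq0 => /andP[/eqP -> /eqP ->]; rewrite h00 !mul0r.
  congr (_ * _); rewrite -[RHS]/(geom_iter h (k - a + (l - b)).+1 _ _).
  apply: geom_iter_stable => //.
  have ak : (a <= k)%N by rewrite -ltnS.
  have bl : (b <= l)%N by rewrite -ltnS.
  have E : (k + l = (k - a + (l - b)) + (a + b))%N by rewrite addnACA !subnK.
  by rewrite [X in (_ < X)%N]E -[X in (X < _)%N]addn0 ltn_add2l.
have gM : sqsum g r 2.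
  move=> K; set G := (X in X <= _).
  have G0 : 0 <= G.
    rewrite sumr_ge0 // => k _; rewrite sumr_ge0 // => l _.
    by rewrite mulr_ge0 ?cabs_ge0 ?exprn_ge0 ?(ltW r0).
  (* The finite partial sum is bounded through its own recursion, without any prior knowledge of
     convergence. *)
  suff : G <= 1 + 2^-1 * G by lra.
  apply: (@le_trans _ _ ((\sum_(k < K) \sum_(l < K) ((k == 0%N :> nat) && (l == 0%N :> nat))%:R)
     + \sum_(k < K) \sum_(l < K) cabs (cprod2 h g k l) * r ^+ (k + l))).
    rewrite /G -big_split /=; apply: ler_sum => k _; rewrite -big_split /=.
    apply: ler_sum => l _; rewrite {1}gE.
    apply: le_trans (ler_wpM2r _ (cabsD _ _)) _; first by rewrite exprn_ge0 ?(ltW r0).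
    rewrite mulrDl lerD2r cabs_nat; case: (altP andP) => [[/eqP -> /eqP ->]|_].
      by rewrite expr0 mulr1.
    by rewrite mul0r.
  apply: lerD.
    case: (K) => [|K']; first by rewrite big_ord0.
    rewrite big_ord_recl [X in _ + X]big1 ?addr0 => [|k _]; last by rewrite big1.
    by rewrite big_ord_recl big1 ?addr0.
  apply: le_trans (square_cprod2 h g K (ltW r0)) _.
  by rewrite ler_wpM2r.
have [G Gg] := ds_exists r0 gM.
exists G, r; split=> //; first by exists g, r.
have fr : ds f c r by apply: ds_weaken fc _; rewrite r0.
have [_ _ fG] := dsM fr Gg.
move=> e x er xr; apply: (cvgs_unique (fG e x er xr)).
have cg k l : cprod2 c g k l = ((k == 0%N) && (l == 0%N))%:R.
  apply: (addIr (cprod2 h g k l)); rewrite -gE /cprod2 -big_split /=.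
  have ch a b : c a b * g (k - a)%N (l - b)%N + h a b * g (k - a)%N (l - b)%N
      = if (a == 0%N) && (b == 0%N) then g (k - a)%N (l - b)%N else 0.
    rewrite /h; case: ifP => [/andP[/eqP -> /eqP ->]|_].
      by rewrite c00 mul1r mul0r addr0.
    by rewrite mulNr subrr.
  rewrite big_ord_recl [X in _ + X]big1 ?addr0 => [|a _]; last first.
    by rewrite -big_split big1 // => b _; rewrite /= ch.
  rewrite -big_split big_ord_recl big1 ?addr0 => [|b _]; last by rewrite /= ch.
  by rewrite /= ch /= !subn0 addr0.
apply: (cvgs_near (N := 1)) (cvgs_cst 1) => -[//|m] _.
rewrite big_ord_recl [X in _ = _ + X]big1 ?addr0 => [|k _]; last first.
  by rewrite big1 // => l _; rewrite cg !mul0r.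
rewrite big_ord_recl [X in _ = _ + X]big1 ?addr0 => [|l _]; last by rewrite cg !mul0r.
by rewrite cg !expr0 !mulr1.
Qed.

End Inverse.

Section Assembly.
Variable R : realType.
Variables (n : nat) (Y : ode_family R n) (j : 'I_n).
Hypothesis hY : prenormal Y.

Lemma near00 (r : R) (P : R[i] * R[i] -> Prop) : 0 < r ->
  (forall e x, cabs e < r -> cabs x < r -> P (e, x)) ->
  \forall p \near ((0, 0) : R[i] * R[i]), P p.
Proof.
move=> r0 H; have N : nbhs (0 : R[i]) [set x | cabs x < r].
  by apply/nbhs_cabs; exists r => // y; rewrite subr0.
exists ([set x | cabs x < r], [set x | cabs x < r]) => // -[e x] [/=].
exact: H.
Qed.

Lemma sum_replaced_col (a : R[i]) (X : 'I_n -> R[i]) i :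
  \sum_l (if l == j then a else (i == l)%:R) * X l = a * X j + (i != j)%:R * X i.
Proof.
rewrite (bigD1 j) //= eqxx; congr (_ + _).
have [->|ij] := eqVneq i j.
  rewrite big1 ?mul0r // => l lj.
  by rewrite (negPf lj) eq_sym (negPf lj) mul0r.
rewrite (bigD1 i) //= (negPf ij) eqxx big1 ?addr0 // => l /andP[lj li].
by rewrite (negPf lj) eq_sym (negPf li) mul0r.
Qed.

(** With T the identity whose j-th column is replaced by u, the j-th column of the transformed
    matrix is T^-1 (B u - (x^2-e) u') = T^-1 (lambda_j u) = lambda_j e_j. So Lambda is kept, and the
    new remainder has zero j-th column. *)
Lemma invariant_subsystem (u : 'I_n -> R[i] -> R[i] -> R[i]) (s : R) :
  (forall i, analytic20 (u i)) -> u j 0 0 = 1 -> 0 < s ->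
  (forall e x, cabs e < s -> cabs x < s -> forall i,
     shifted_ode Y j e (fun i => u i e) x i) ->
  exists Z : ode_family R n,
    [/\ prenormal Z, analytically_equivalent Y Z
      & \forall p \near ((0, 0) : R[i] * R[i]),
          forall i : 'I_n, i != j -> sysmx Z p.1 p.2 i j = 0].
Proof.
move=> ua u1 s0 ode.
have [g [r [ga r0 gu]]] := analytic20_inv (ua j) u1.
(* For k <> j this is column k of T^-1 R, where T^-1 has row j equal to g e_j and row i equal to e_i
   - u_i g e_j, with g = 1 / u_j. *)
pose RZ e x : 'M[R[i]]_n := \matrix_(i, k)
  if k == j then 0 else
  (i != j)%:R * remx Y e x i k + ((i == j)%:R - (i != j)%:R * u i e x) * (g e x * remx Y e x j k).
pose Z := Family (lam0 Y) (lam1 Y) RZ.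
have ZE : remx Z = RZ by [].
pose T e x : 'M[R[i]]_n := \matrix_(i, k) if k == j then u i e x else (i == k)%:R.
have [h0 h1 h2 h3] := hY.
have a_cst := @analytic20_cst R.
have a_rem i k := analytic20_remx hY i k.
exists Z; split.
- split; [exact: h0 | exact: h1 | move=> i k; apply/analytic2_at_ds | exact: h3].
  apply: (@analytic20_ext _ (if k == j then fun _ _ => 0 else fun e x =>
      (i != j)%:R * remx Y e x i k + ((i == j)%:R - (i != j)%:R * u i e x) *
        (g e x * remx Y e x j k)) _ 1 ltr01).
    by move=> e x _ _; rewrite mxE; case: ifP.
  case: ifP => _; first exact: a_cst.
  apply: analytic20D; first by apply: analytic20M => //; apply: a_cst.
  apply: analytic20M; last by apply: analytic20M.
  apply: analytic20B; first exact: a_cst.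
  by apply: analytic20M => //; apply: a_cst.
- exists T; split.
  + move=> i k; apply/analytic2_at_ds.
    apply: (@analytic20_ext _ (if k == j then u i else fun _ _ => (i == k)%:R) _ 1 ltr01).
      by move=> e x _ _; rewrite mxE; case: ifP.
    by case: ifP => _.
  (* The inverse of T at the origin, where u_j = 1. *)
  + pose T' : 'M[R[i]]_n := \matrix_(i, k) if k == j then
      (i == j)%:R - (i != j)%:R * u i 0 0 else (i == k)%:R.
    suff TT : T 0 0 *m T' = 1%:M by have [] := mulmx1_unit TT.
    apply/matrixP => i k; rewrite !mxE.
    under eq_bigr do rewrite [T 0 0 _ _]mxE.
    rewrite (sum_replaced_col (u i 0 0) (fun l => T' l k)) !mxE.
    have [->|kj] := eqVneq k j.
      rewrite eqxx /= mul0r subr0 mulr1.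
      by have [->|ij] := eqVneq i j; rewrite /= ?u1 ?mul0r ?addr0 // sub0r !mul1r subrr.
    rewrite mulr0 add0r.
    by have [->|ij] := eqVneq i j; rewrite ?mul1r //= mul0r [j == k]eq_sym (negPf kj).
  + have m0 : 0 < Num.min r s by rewrite lt_min r0.
    apply: (near00 m0) => e x; rewrite !lt_min => /andP[er es] /andP[xr xs] /=.
    have /choice[du Hdu] := ode e x es xs.
    pose D : 'M[R[i]]_n := \matrix_(i, k) if k == j then du i else 0.
    have [_ ->] : is_derive x 1 (T e) D.
      apply/is_derive_mx => i k; rewrite mxE.
      rewrite (_ : (fun t => T e t i k) = if k == j then u i e else fun=> (i == k)%:R).
        case: ifP => _; first by case: (Hdu i).
        exact: is_derive_cst.
      by apply/funext => t; rewrite mxE; case: ifP.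
    apply/matrixP => i k; rewrite !mxE.
    under eq_bigr do rewrite [T e x _ _]mxE.
    rewrite (sum_replaced_col (u i e x) (fun l => sysmx Z e x l k)).
    have gux := gu e x er xr.
    have [kj|kj] := eqVneq k j.
      have [_ du2] := Hdu i; rewrite du2.
      have -> : \sum_l sysmx Y e x i l * T e x l k = \sum_l sysmx Y e x i l * u l e x.
        by apply: eq_bigr => l _; rewrite [T e x _ _]mxE kj eqxx.
      have -> : \sum_l shifted Y j e x i l * u l e x
          = \sum_l sysmx Y e x i l * u l e x - lam Y e x 0 j * u i e x.
        rewrite (bigD1 i) //= [in RHS](bigD1 i) //= /shifted eqxx mulr1n mulrBl.
        rewrite addrAC; congr (_ + _ - _); apply: eq_bigr => l li.
        by rewrite eq_sym (negPf li) mulr0n subr0.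
      have SZ l : sysmx Z e x l k = lam Y e x 0 j *+ (l == j).
        rewrite /sysmx ZE !mxE kj eqxx mulr0 addr0.
        by have [->|] := eqVneq l j.
      rewrite !SZ eqxx mulr1n (mulrC (u i e x)).
      by have [->|ij] := eqVneq i j; rewrite /= ?mul0r ?mulr0 addr0 subrK.
    have SZ l : sysmx Z e x l k = lam Y e x 0 l *+ (l == k) + (x ^+ 2 - e) *
        ((l != j)%:R * remx Y e x l k + ((l == j)%:R - (l != j)%:R * u l e x) *
          (g e x * remx Y e x j k)).
      by rewrite /sysmx ZE !mxE (negPf kj).
    have SY l : sysmx Y e x l k = lam Y e x 0 l *+ (l == k) + (x ^+ 2 - e) * remx Y e x l k.
      by rewrite /sysmx !mxE.
    have -> : \sum_l sysmx Y e x i l * T e x l k = sysmx Y e x i k.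
      rewrite (bigD1 k) //= [T e x _ _]mxE (negPf kj) eqxx mulr1 big1 ?addr0 // => l lk.
      by rewrite [T e x _ _]mxE (negPf kj) (negPf lk) mulr0.
    rewrite !SZ SY eqxx /= [j == k]eq_sym (negPf kj) mulr0 add0r mulr0n.
    have [->|ij] := eqVneq i j; rewrite /=.
      rewrite [j == k]eq_sym (negPf kj) !mul0r add0r mulr0n add0r subr0 mul1r addr0.
      by rewrite add0r mulrCA (mulrA (u j e x)) gux mul1r.
    by ring.
- apply: (near00 r0) => e x _ _ i ij /=.
  by rewrite /sysmx ZE !mxE eqxx (negPf ij) mulr0n mulr0 addr0.
Qed.

End Assembly.

(** * Cauchy estimates *)

Section MaximumPrinciple.
Variable R : realType.
Implicit Types (f g G : R[i] -> R[i]) (x y : R[i]) (S M r : R).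

Definition cts f x := forall e : R, 0 < e -> exists2 d : R, 0 < d &
  forall y, cabs (y - x) < d -> cabs (f y - f x) < e.

Definition rcts (F : R[i] -> R) x := forall e : R, 0 < e -> exists2 d : R, 0 < d &
  forall y, cabs (y - x) < d -> `|F y - F x| < e.

(** A square serves in place of a disc because it is a product of two segments, from which it
    inherits compactness. *)
Definition square S : set R[i] := [set x | `|Re x| <= S /\ `|Im x| <= S].

Lemma square_max (F : R[i] -> R) S : 0 <= S ->
  (forall x, square S x -> rcts F x) ->
  exists2 x, square S x & forall y, square S y -> F y <= F x.
Proof.
move=> S0 Fc; pose A : set (R * R) := `[- S, S] `*` `[- S, S].
have AE p : A p <-> square S (p.1 +i* p.2).
  by rewrite /A /square /= !in_itv /= !ler_norml; split=> [[]|[]].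
have A0 : A !=set0 by exists (0, 0); apply/AE; rewrite /square /= normr0.
have cA : compact A by apply: compact_setX; apply: segment_compact.
have cF : {within A, continuous (fun p => F (p.1 +i* p.2))}.
  apply: continuous_in_subspaceT => p; rewrite inE => /AE/Fc Fp.
  apply/cvgrPdist_lt => e /Fp[d d0 Hd].
  have d20 : 0 < d / 2 by rewrite divr_gt0.
  exists (ball p.1 (d / 2), ball p.2 (d / 2)).
    by split; apply: nbhsx_ballx.
  move=> q [] /=; rewrite -!ball_normE /= => h1 h2; rewrite distrC.
  apply: Hd; apply: le_lt_trans (cabs_le _) _ => /=.
  rewrite distrC [X in _ + X]distrC; lra.
have [p pA pmax] := compact_EVT_max A0 cA cF.
exists (p.1 +i* p.2); first by apply/AE; rewrite inE in pA.
move=> y ys; have := pmax (Re y, Im y); rewrite inE /=.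
have -> : Re y +i* Im y = y by case: (y).
by apply; apply/AE => /=; case: (y) ys.
Qed.

Definition la f x := exists c s, ps (fun h => f (x + h)) c s.

Lemma la_cts f x : la f x -> cts f x.
Proof.
move=> [c [s fc]] e e0; have [B B0 HB] := ps_lin fc; have [s0 _ _] := fc.
have B1 : 0 < B + 1 by lra.
exists (Num.min s (e / (B + 1))); first by rewrite lt_min s0 divr_gt0.
move=> y; rewrite lt_min => /andP[ys]; rewrite ltr_pdivlMr // => ye.
have := HB _ ys; rewrite -(ps_at0 fc) addr0 (addrC x) subrK => /le_lt_trans; apply.
by have := cabs_ge0 (y - x); lra.
Qed.

Lemma sqr_le_sqrD (p g b : R) : 0 <= p -> 0 <= g -> 0 <= b -> p <= g + b ->
  p ^+ 2 <= g ^+ 2 + 2 * p * b.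
Proof.
move=> p0 g0 b0 pgb; case: (leP p b) => [pb|bp]; first by nra.
have : (p - b) ^+ 2 <= g ^+ 2 by rewrite lerXn2r ?nnegrE //; lra.
by rewrite !expr2; nra.
Qed.

(* Averaging |G|^2 over the points x + t, x + it, x - t, x - it cancels the
   mixed terms of the Taylor polynomial of order 2. *)
Lemma la_no_max G x (d eta : R) : 0 < d -> 0 < eta -> la G x ->
  ~ (forall y, cabs (y - x) < eta ->
       cabs (G y) ^+ 2 + d * cabs y ^+ 2 <= cabs (G x) ^+ 2 + d * cabs x ^+ 2).
Proof.
move=> d0 eta0 [c [s Gc]] H; have [B B0 HB] := ps_cubic Gc; have [s0 _ _] := Gc.
pose K := cabs (c 0%N) + cabs (c 1%N) + cabs (c 2%N).
have K0 : 0 <= K by rewrite !addr_ge0 ?cabs_ge0.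
have KB1 : 0 < 2 * (K * B) + 1 by have := mulr_ge0 K0 B0; lra.
(* The four inequalities add up to 4 d t^2 <= 8 K B t^3, which t (2 K B + 1) < d excludes. *)
pose t := Num.min (Num.min 1 (d / (2 * (K * B) + 1) / 2)) (Num.min (s / 2) (eta / 2)).
have t0 : 0 < t by rewrite !lt_min ltr01 !divr_gt0.
have t1 : t <= 1 by rewrite !ge_min lexx.
have ts : t < s.
  have : t <= s / 2 by rewrite !ge_min lexx !orbT.
  lra.
have te : t < eta.
  have : t <= eta / 2 by rewrite !ge_min lexx !orbT.
  lra.
have td : t * (2 * (K * B) + 1) < d.
  have : t <= d / (2 * (K * B) + 1) / 2 by rewrite !ge_min lexx !orbT.
  rewrite ler_pdivlMr // ler_pdivlMr // => h; have := mulr_gt0 t0 KB1; lra.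
pose P h := c 0%N + c 1%N * h + c 2%N * h ^+ 2.
have est h : cabs h = t -> cabs (P h) ^+ 2 + d * cabs (x + h) ^+ 2
    <= cabs (G x) ^+ 2 + d * cabs x ^+ 2 + 2 * K * (B * t ^+ 3).
  move=> ht; have Hh := H (x + h); rewrite (addrC x) addrK ht -(addrC x) in Hh.
  have {}Hh := Hh te.
  have PK : cabs (P h) <= K.
    apply: le_trans (cabsD _ _) _; apply: lerD.
      apply: le_trans (cabsD _ _) _; rewrite lerD2l cabsM ht.
      by rewrite ler_piMr ?cabs_ge0.
    by rewrite cabsM cabsX ht ler_piMr ?cabs_ge0 // exprn_ile1 // ltW.
  have t30 : 0 <= B * t ^+ 3 by rewrite mulr_ge0 // exprn_ge0 // ltW.
  have PG : cabs (P h) <= cabs (G (x + h)) + B * t ^+ 3.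
    have := HB h; rewrite ht => /(_ ts).
    have := cabs_triangle_rev (P h) (G (x + h)).
    by rewrite cabsB /P !opprD !addrA; lra.
  have := sqr_le_sqrD (cabs_ge0 _) (cabs_ge0 _) t30 PG.
  have : 2 * cabs (P h) * (B * t ^+ 3) <= 2 * K * (B * t ^+ 3).
    by rewrite ler_wpM2r // ler_wpM2l.
  by lra.
have G0 : G x = c 0%N by rewrite -(ps_at0 Gc) addr0.
have sqE (a b : R) : cabs (a +i* b) ^+ 2 = a ^+ 2 + b ^+ 2 by rewrite cabs_sqr.
have ct (a b : R) : a ^+ 2 + b ^+ 2 = t ^+ 2 -> cabs (a +i* b) = t.
  by move=> E; apply: (pexpIrn (n := 2)) => //; rewrite ?nnegrE ?cabs_ge0 ?(ltW t0) // sqE.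
have := est (t +i* 0) (ct _ _ _); rewrite expr0n addr0 => /(_ erefl) h1.
have := est (0 +i* t) (ct _ _ _); rewrite expr0n add0r => /(_ erefl) h2.
have := est ((- t) +i* 0) (ct _ _ _); rewrite sqrrN expr0n addr0 => /(_ erefl) h3.
have := est (0 +i* (- t)) (ct _ _ _); rewrite sqrrN expr0n add0r => /(_ erefl) h4.
have c1t : 0 <= cabs (c 1%N) ^+ 2 * t ^+ 2 by rewrite mulr_ge0 ?exprn_ge0 ?cabs_ge0 // ltW.
have c2t : 0 <= cabs (c 2%N) ^+ 2 * t ^+ 4 by rewrite mulr_ge0 ?exprn_ge0 ?cabs_ge0 // ltW.
have E1 : cabs (P (t +i* 0)) ^+ 2 + cabs (P (0 +i* t)) ^+ 2 + cabs (P ((- t) +i* 0)) ^+ 2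
   + cabs (P (0 +i* (- t))) ^+ 2 = 4 * (cabs (c 0%N) ^+ 2 + cabs (c 1%N) ^+ 2 * t ^+ 2
      + cabs (c 2%N) ^+ 2 * t ^+ 4).
  rewrite /P; case: (c 0%N) (c 1%N) (c 2%N) => [a0 b0] [a1 b1] [a2 b2].
  by rewrite ![(_ +i* _) ^+ 2]expr2; simpc; rewrite !sqE; ring.
have E2 : cabs (x + (t +i* 0)) ^+ 2 + cabs (x + (0 +i* t)) ^+ 2 +
   cabs (x + ((- t) +i* 0)) ^+ 2 + cabs (x + (0 +i* (- t))) ^+ 2
   = 4 * (cabs x ^+ 2 + t ^+ 2).
  by case: (x) => [a b]; simpc; rewrite !sqE; ring.
have t20 : 0 < t ^+ 2 by rewrite exprn_gt0.
have : 4 * d * t ^+ 2 <= 8 * K * (B * t ^+ 3).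
  have E3 := congr1 (fun z => d * z) E2; rewrite /= !mulrDr in E3.
  rewrite G0 in h1 h2 h3 h4; move: h1 h2 h3 h4 E1 E3 c1t c2t.
  clearbody K t P; lra.
have : 8 * K * (B * t ^+ 3) = 4 * t ^+ 2 * (t * (2 * (K * B))) by ring.
move=> ->; rewrite (mulrAC 4) ler_pM2l ?mulr_gt0 //; lra.
Qed.

Lemma cabs_lip x y : `|cabs x - cabs y| <= cabs (x - y).
Proof.
rewrite ler_norml; have := cabs_triangle_rev x y; have := cabs_triangle_rev y x.
by rewrite cabsB; lra.
Qed.

Lemma rcts_sqr g x : cts g x -> rcts (fun y => cabs (g y) ^+ 2) x.
Proof.
move=> gx e e0; have m0 := cabs_ge0 (g x).
have den0 : 0 < 2 * cabs (g x) + 1 by lra.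
have [|d d0 Hd] := gx (Num.min 1 (e / (2 * cabs (g x) + 1))).
  by rewrite lt_min ltr01 divr_gt0.
exists d => // y /Hd; rewrite lt_min ltr_pdivlMr // => /andP[h1 h2].
have := cabs_lip (g y) (g x); rewrite subr_sqr normrM.
rewrite [X in _ * X]ger0_norm ?addr_ge0 ?cabs_ge0 //.
move: (normr_ge0 (cabs (g y) - cabs (g x))) (ler_norm (cabs (g y) - cabs (g x))).
have := cabs_ge0 (g y); move: h1 h2 m0 den0.
move: (cabs (g y - g x)) (`|cabs (g y) - cabs (g x)|) (cabs (g y)) (cabs (g x)) => u v p q.
move=> *; apply: (@le_lt_trans _ _ (u * (2 * q + 1))); nra.
Qed.

Lemma cts_id x : cts id x.
Proof. by move=> e e0; exists e. Qed.

Lemma rctsD (F1 F2 : R[i] -> R) x : rcts F1 x -> rcts F2 x ->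
  rcts (fun y => F1 y + F2 y) x.
Proof.
move=> h1 h2 e e0; have e20 : 0 < e / 2 by rewrite divr_gt0.
have [d1 d10 H1] := h1 _ e20; have [d2 d20 H2] := h2 _ e20.
exists (Num.min d1 d2); first by rewrite lt_min d10.
move=> y; rewrite lt_min => /andP[/H1 g1 /H2 g2].
rewrite opprD addrACA; apply: le_lt_trans (ler_normD _ _) _; lra.
Qed.

Lemma rctsZ (a : R) (F1 : R[i] -> R) x : rcts F1 x -> rcts (fun y => a * F1 y) x.
Proof.
move=> h1 e e0; have a0 := normr_ge0 a.
have a1 : 0 < `|a| + 1 by lra.
have [|d d0 Hd] := h1 (e / (`|a| + 1)); first by rewrite divr_gt0.
exists d => // y /Hd; rewrite ltr_pdivlMr // -mulrBr normrM => h.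
apply: le_lt_trans h; rewrite mulrC ler_wpM2l //; lra.
Qed.

(** With a small multiple of |x|^2 added, |G|^2 has no interior local maximum where G is analytic.
    At the maximum point of the sum |G| > M, so the point is interior and G does not vanish there;
    hence analyticity is required only off the zeros of G. *)
Lemma max_square G S M : 0 < S -> 0 <= M ->
  (forall x, square S x -> cts G x) ->
  (forall x, `|Re x| < S -> `|Im x| < S -> G x != 0 -> la G x) ->
  (forall x, square S x -> `|Re x| = S \/ `|Im x| = S -> cabs (G x) <= M) ->
  cabs (G 0) <= M.
Proof.
move=> S0 M0 Gc Gla Gb; rewrite leNgt; apply/negP => MG.
(* On the square |x|^2 <= 2 S^2, so the added term uses at most half of the gap between |G(0)|^2 and
   M^2. *)
pose d := (cabs (G 0) ^+ 2 - M ^+ 2) / (4 * S ^+ 2).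
have S20 : 0 < S ^+ 2 by rewrite exprn_gt0.
have gap : 0 < cabs (G 0) ^+ 2 - M ^+ 2.
  by rewrite subr_gt0 ltrXn2r ?nnegrE ?cabs_ge0.
have d0 : 0 < d by rewrite divr_gt0 // mulr_gt0.
have dE : d * (4 * S ^+ 2) = cabs (G 0) ^+ 2 - M ^+ 2 by rewrite /d divfK // gt_eqF // mulr_gt0.
pose F x := cabs (G x) ^+ 2 + d * cabs x ^+ 2.
have [|x xS xmax] := @square_max F S (ltW S0).
  move=> x xS; apply: rctsD; first exact: rcts_sqr (Gc x xS).
  by apply: rctsZ; apply: rcts_sqr (@cts_id x).
have F0 : F 0 = cabs (G 0) ^+ 2 by rewrite /F cabs0 expr0n mulr0 addr0.
have sq0 : square S 0 by split; rewrite normr0 ltW.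
have F0x : cabs (G 0) ^+ 2 <= F x by rewrite -F0; apply: xmax.
have x2 : cabs x ^+ 2 <= 2 * S ^+ 2.
  have [xr xi] := xS; rewrite cabs_sqr mulr2n mulrDl mul1r lerD //.
    by rewrite -(real_normK (num_real (Re x))) lerXn2r ?nnegrE // ltW.
  by rewrite -(real_normK (num_real (Im x))) lerXn2r ?nnegrE // ltW.
have dx2 : d * cabs x ^+ 2 <= (cabs (G 0) ^+ 2 - M ^+ 2) / 2.
  by have := ler_wpM2l (ltW d0) x2; lra.
have GxM : M ^+ 2 < cabs (G x) ^+ 2 by move: F0x; rewrite /F; lra.
have Gx0 : G x != 0.
  rewrite -cabs_gt0 lt0r cabs_ge0 andbT; apply/eqP => E.
  by move: GxM; rewrite E expr0n /= ltNge sqr_ge0.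
have xint : `|Re x| < S /\ `|Im x| < S.
  have [xr xi] := xS.
  have nb : ~ (`|Re x| = S \/ `|Im x| = S).
    move=> /(Gb x xS) GM; move: GxM; rewrite ltNge lerXn2r ?nnegrE ?cabs_ge0 //.
  by rewrite !lt_neqAle xr xi !andbT; split; apply/eqP => E; apply: nb; [left|right].
have [xr xi] := xint.
have eta0 : 0 < Num.min (S - `|Re x|) (S - `|Im x|) by rewrite lt_min !subr_gt0 xr.
apply: (la_no_max d0 eta0 (Gla x xr xi Gx0)) => y; rewrite lt_min => /andP[y1 y2].
apply: xmax; split.
  have := cabs_Re (y - x); rewrite raddfB /=.
  by have := ler_normD (Re y - Re x) (Re x); rewrite subrK; lra.
have := cabs_Im (y - x); rewrite raddfB /=.
by have := ler_normD (Im y - Im x) (Im x); rewrite subrK; lra.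
Qed.

End MaximumPrinciple.

(** * Cauchy estimates across two exceptional points *)

Section LocallyAnalytic.
Variable R : realType.
Implicit Types (f g : R[i] -> R[i]) (x y q : R[i]) (r S M B : R).

Lemma la_common f g x : la f x -> la g x -> exists c d s,
  ps (fun h => f (x + h)) c s /\ ps (fun h => g (x + h)) d s.
Proof.
move=> [c [s fc]] [d [r gd]]; exists c, d, (Num.min s r).
have [s0 _ _] := fc; have [r0 _ _] := gd.
by split; [apply: ps_weaken fc _|apply: ps_weaken gd _];
  rewrite lt_min s0 r0 ge_min lexx // orbT.
Qed.

Lemma laM f g x : la f x -> la g x -> la (fun y => f y * g y) x.
Proof.
move=> fa ga; have [c [d [s [fc gd]]]] := la_common fa ga.
by exists (cprod c d), s; apply: psM.
Qed.

Lemma laB f g x : la f x -> la g x -> la (fun y => f y - g y) x.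
Proof.
move=> fa ga; have [c [d [s [fc gd]]]] := la_common fa ga.
by exists (fun k => c k - d k), s; apply: psB.
Qed.

Lemma la_cst (a : R[i]) x : la (fun=> a) x.
Proof. by exists (fun k => if k == 0%N then a else 0), 1; apply: ps_cst. Qed.

Lemma la_id x : la id x.
Proof.
have p := psD (ps_cst x ltr01) (ps_id ltr01).
by eexists; exists 1; apply: p.
Qed.

Lemma laX f x n : la f x -> la (fun y => f y ^+ n) x.
Proof.
move=> fa; elim: n => [|n IH]; first exact: la_cst.
have := laM fa IH; rewrite (_ : (fun y => f y * f y ^+ n) = fun y => f y ^+ n.+1) //.
by apply/funext => y; rewrite exprS.
Qed.

Lemma la_ext f g x r : 0 < r -> (forall y, cabs (y - x) < r -> f y = g y) ->
  la f x -> la g x.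
Proof.
move=> r0 fg [c [s fc]]; have [s0 _ _] := fc.
exists c, (Num.min s r); apply: (ps_ext (f := fun h => f (x + h))).
  by move=> h; rewrite lt_min => /andP[_ hr]; apply: fg; rewrite (addrC x) addrK.
by apply: ps_weaken fc _; rewrite lt_min s0 r0 ge_min lexx.
Qed.

(** 1 / (x + h) is x^-1 times the reciprocal of the germ 1 + x^-1 h, regarded as a germ in two
    variables that is constant in the first. *)
Lemma la_inv x : x != 0 -> la (fun y => y^-1) x.
Proof.
move=> x0; pose F (e h : R[i]) := 1 + x^-1 * h.
have Fa : analytic20 F.
  apply: analytic20D; first exact: analytic20_cst.
  by apply: analytic20M; [apply: analytic20_cst | apply: analytic20_x].
have F0 : F 0 0 = 1 by rewrite /F mulr0 addr0.
have [G [s [[c [r Gc]] s0 FG]]] := analytic20_inv Fa F0.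
have /ds_rows[r0 _ /(_ 0)] := Gc; rewrite cabs0 => /(_ r0)[g _ gps].
have m0 : 0 < Num.min s r by rewrite lt_min s0.
exists (fun k => x^-1 * g k), (Num.min s r).
apply: (ps_ext (f := fun h => x^-1 * G 0 h)); last first.
  by apply: psZ; apply: ps_weaken gps _; rewrite m0 ge_min lexx orbT.
move=> h; rewrite lt_min => /andP[hs _].
have := FG 0 h; rewrite cabs0 => /(_ s0 hs) E.
have Fn0 : F 0 h != 0 by apply: contra_eq_neq E => ->; rewrite mul0r eq_sym oner_eq0.
have -> : G 0 h = (F 0 h)^-1 by rewrite -[LHS](mulKf Fn0) E mulr1.
by rewrite -invfM /F mulrDr mulr1 mulVKf.
Qed.

Lemma ctsM f g x : cts f x -> cts g x -> cts (fun y => f y * g y) x.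
Proof.
move=> fx gx e e0; set K := 1 + cabs (f x) + cabs (g x).
have K0 : 0 < K by have := cabs_ge0 (f x); have := cabs_ge0 (g x); rewrite /K; lra.
have d0 : 0 < Num.min 1 (e / (2 * K)) by rewrite lt_min ltr01 divr_gt0 ?mulr_gt0.
have [d1 d10 H1] := fx _ d0; have [d2 d20 H2] := gx _ d0.
exists (Num.min d1 d2); first by rewrite lt_min d10.
move=> y; rewrite lt_min => /andP[/H1 + /H2 +].
rewrite !lt_min !ltr_pdivlMr ?mulr_gt0 // => /andP[h1 h2] /andP[h3 h4].
have -> : f y * g y - f x * g x = (f y - f x) * (g y - g x) + f x * (g y - g x)
   + (f y - f x) * g x by ring.
have := cabsD ((f y - f x) * (g y - g x) + f x * (g y - g x)) ((f y - f x) * g x).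
have := cabsD ((f y - f x) * (g y - g x)) (f x * (g y - g x)).
rewrite !cabsM; move: h1 h2 h3 h4; rewrite /K.
have := cabs_ge0 (f x); have := cabs_ge0 (g x).
have := cabs_ge0 (f y - f x); have := cabs_ge0 (g y - g x).
move: (cabs (f x)) (cabs (g x)) (cabs (f y - f x)) (cabs (g y - g x)) => a b c d.
move=> *; nra.
Qed.

Lemma ctsX f x n : cts f x -> cts (fun y => f y ^+ n) x.
Proof.
move=> fa; elim: n => [|n IH]; first exact: la_cts (la_cst 1 x).
have := ctsM fa IH; rewrite (_ : (fun y => f y * f y ^+ n) = fun y => f y ^+ n.+1) //.
by apply/funext => y; rewrite exprS.
Qed.

Lemma cts_subc f (a : R[i]) x : cts f x -> cts (fun y => f y - a) x.
Proof.
move=> fx e /fx[d d0 Hd]; exists d => // y /Hd.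
by rewrite opprB addrA subrK.
Qed.

Lemma cts_ext f g x r : 0 < r -> (forall y, cabs (y - x) < r -> f y = g y) ->
  cts f x -> cts g x.
Proof.
move=> r0 fg fx e /fx[d d0 Hd]; exists (Num.min d r); first by rewrite lt_min d0.
move=> y; rewrite lt_min => /andP[/Hd h yr].
by rewrite -!fg // subrr cabs0.
Qed.

(** The class of the glued columns, with q = sqrt(eps). It is stable under the division by x on
    which the Cauchy estimates are based. *)
Definition holo f r q :=
  (forall x, cabs x < r -> x ^+ 2 != q ^+ 2 -> la f x) /\
  (forall x, cabs x < r -> cts f x).

Lemma square_lt S r x : 0 < r -> S = r / 2 -> square S x -> cabs x < r.
Proof.
move=> r0 -> [xr xi]; rewrite -(@ltr_pXn2r _ 2) ?nnegrE ?cabs_ge0 ?(ltW r0) // cabs_sqr.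
rewrite -(real_normK (num_real (Re x))) -(real_normK (num_real (Im x))).
have r20 : 0 <= r / 2 by rewrite divr_ge0 // ltW.
have h1 : `|Re x| ^+ 2 <= (r / 2) ^+ 2 by rewrite lerXn2r ?nnegrE.
have h2 : `|Im x| ^+ 2 <= (r / 2) ^+ 2 by rewrite lerXn2r ?nnegrE.
apply: le_lt_trans (lerD h1 h2) _; rewrite !expr2; nra.
Qed.

Definition bounded_on_boundary f S M :=
  forall x, square S x -> `|Re x| = S \/ `|Im x| = S -> cabs (f x) <= M.

(* The factor x^2 - q^2 kills the exceptional points +-q; taking high powers of
   f makes its contribution to the estimate negligible. *)
Lemma holo_max f r q M : 0 < r -> q != 0 -> 0 <= M -> holo f r q ->
  bounded_on_boundary f (r / 2) M -> cabs (f 0) <= M.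
Proof.
move=> r0 q0 M0 [fla fct] fM; rewrite leNgt; apply/negP => Mf.
have S0 : 0 < r / 2 by rewrite divr_gt0.
pose b := r ^+ 2 + cabs q ^+ 2.
have qq : 0 < cabs q ^+ 2 by rewrite exprn_gt0 // cabs_gt0.
have b0 : 0 < b by have : 0 <= r ^+ 2; [exact: sqr_ge0 | rewrite /b; lra].
have f00 : 0 < cabs (f 0) := le_lt_trans M0 Mf.
have pw p : cabs (f 0) ^+ p * cabs q ^+ 2 <= M ^+ p * b.
  have := @max_square R (fun x => f x ^+ p * (x ^+ 2 - q ^+ 2)) (r / 2) (M ^+ p * b) S0 _ _ _ _.
  rewrite expr0n sub0r cabsM cabsN !cabsX; apply.
  - by rewrite mulr_ge0 ?exprn_ge0 // ltW.
  - move=> x /(square_lt r0 erefl) xr; apply: ctsM; first exact/ctsX/fct.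
    exact/cts_subc/ctsX/cts_id.
  - move=> x xr xi; rewrite mulf_eq0 negb_or subr_eq0 => /andP[_ xq].
    have xr' : cabs x < r by apply: (square_lt r0 erefl); split; apply: ltW.
    apply: laM; first exact/laX/fla.
    by apply: laB; [apply/laX/la_id | apply: la_cst].
  - move=> x xS xb; rewrite cabsM cabsX; apply: ler_pM; rewrite ?exprn_ge0 ?cabs_ge0 //.
      by rewrite lerXn2r ?nnegrE ?cabs_ge0 // fM.
    apply: le_trans (cabsD _ _) _; rewrite cabsN !cabsX lerD2r.
    by rewrite lerXn2r ?nnegrE ?cabs_ge0 ?(ltW r0) // ltW // (square_lt r0 erefl).
pose z := M / cabs (f 0).
have z0 : 0 <= z by rewrite divr_ge0 // cabs_ge0.
have z1 : z < 1 by rewrite ltr_pdivrMr // mul1r.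
have : z ^+ t @[t --> \oo] --> (0 : R) by apply: cvg_expr; rewrite ger0_norm.
move=> /cvgrPdist_lt /(_ (cabs q ^+ 2 / b)); rewrite divr_gt0 // => /(_ isT)[p _].
move=> /(_ p (leqnn p)); rewrite sub0r normrN ger0_norm ?exprn_ge0 //.
rewrite ltr_pdivlMr // /z expr_div_n mulrAC ltr_pdivrMr ?exprn_gt0 //.
by rewrite ltNge mulrC; have := pw p; rewrite mulrC => ->.
Qed.

Lemma boundary_bound f r q : 0 < r -> holo f r q ->
  exists2 M, 0 <= M & bounded_on_boundary f (r / 2) M.
Proof.
move=> r0 [_ fct]; have S0 : 0 <= r / 2 by rewrite divr_ge0 // ltW.
have [|x _ xmax] := @square_max R (fun x => cabs (f x) ^+ 2) (r / 2) S0.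
  by move=> x /(square_lt r0 erefl) xr; apply: rcts_sqr; apply: fct.
exists (cabs (f x)); first exact: cabs_ge0.
by move=> y yS _; have := xmax y yS; rewrite ler_pXn2r ?nnegrE ?cabs_ge0.
Qed.

Definition quotient0 f (c : nat -> R[i]) x :=
  if x == 0 then c 1%N else (f x - c 0%N) / x.

Lemma holo_quotient0 f c s r q : q != 0 -> holo f r q -> ps f c s ->
  holo (quotient0 f c) r q.
Proof.
move=> q0 [fla fct] fc.
have at0 : la (quotient0 f c) 0.
  exists (fun k => c k.+1), s; apply: ps_ext (ps_shift fc) => h _.
  by rewrite add0r.
have near x : x != 0 -> forall y, cabs (y - x) < cabs x ->
    (f y - c 0%N) * y^-1 = quotient0 f c y.
  move=> x0 y yx; rewrite /quotient0; case: eqVneq => // y0.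
  by move: yx; rewrite y0 sub0r cabsN ltxx.
split=> x xr => [xq|]; have [->//|x0] := eqVneq x 0.
- apply: (la_ext _ (near x x0)); first by rewrite cabs_gt0.
  by apply: laM (la_inv x0); apply: laB (la_cst _ _); apply: fla.
- exact: la_cts.
apply: (cts_ext _ (near x x0)); first by rewrite cabs_gt0.
by apply: ctsM (la_cts (la_inv x0)); apply: cts_subc; apply: fct.
Qed.

(** Iterated Schwarz lemma: g is replaced by (g - g(0)) / x. On the boundary |x| >= r / 2 and |g -
    g(0)| is at most twice the bound, so each step costs a factor 4 / r that depends on neither f
    nor q. *)
Lemma cauchy_bound f c s r q : 0 < r -> q != 0 -> holo f r q -> ps f c s ->
  exists B, forall k, cabs (c k) <= B * (4 / r) ^+ k.
Proof.
move=> r0 q0 fh fc; have [B B0 fB] := boundary_bound r0 fh; exists B => k.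
have r40 : 0 <= 4 / r by rewrite divr_ge0 // ltW.
have S0 : 0 < r / 2 by rewrite divr_gt0.
suff [g [gh gB gc]] : exists g, [/\ holo g r q,
    bounded_on_boundary g (r / 2) (B * (4 / r) ^+ k) & ps g (fun i => c (k + i)%N) s].
  have := holo_max r0 q0 _ gh gB; rewrite (ps_at0 gc) addn0; apply.
  by rewrite mulr_ge0 // exprn_ge0.
elim: k => [|k [g [gh gB gc]]].
  by exists f; split=> //; rewrite expr0 mulr1.
exists (quotient0 g (fun i => c (k + i)%N)); split.
- exact: holo_quotient0 gh gc.
- have Bk0 : 0 <= B * (4 / r) ^+ k by rewrite mulr_ge0 // exprn_ge0.
  have g0 : cabs (c (k + 0)%N) <= B * (4 / r) ^+ k.
    by have := holo_max r0 q0 Bk0 gh gB; rewrite (ps_at0 gc).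
  move=> x xS xb; have xge : r / 2 <= cabs x.
    by case: xb => <-; [apply: cabs_Re | apply: cabs_Im].
  have x0 : x != 0 by rewrite -cabs_gt0; apply: lt_le_trans xge.
  rewrite /quotient0 (negPf x0) cabsM cabsV ler_pdivrMr ?cabs_gt0 //.
  have gx := gB x xS xb.
  apply: le_trans (cabsD _ _) _; rewrite cabsN.
  apply: (@le_trans _ _ (2 * (B * (4 / r) ^+ k))); first lra.
  have -> : B * (4 / r) ^+ k.+1 * cabs x = B * (4 / r) ^+ k * (4 / r * cabs x).
    by rewrite exprSr !mulrA.
  rewrite mulrC ler_wpM2l //.
  have : 2 = 4 / r * (r / 2) by field; rewrite gt_eqF.
  by move=> {1}->; rewrite ler_wpM2l.
apply: (eq_ps _ (ps_shift gc)) => i; by rewrite addSnnS.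
Qed.

End LocallyAnalytic.

(** * Complex derivatives and the exponential *)

Section Caratheodory.
Variable R : realType.
Implicit Types (f g : R[i] -> R[i]) (x d : R[i]).

(* Caratheodory's form of complex differentiability: the difference quotient
   extends continuously. *)
Definition cara f x d := exists phi, [/\ phi x = d, cts phi x &
  exists2 r : R, 0 < r & forall y, cabs (y - x) < r -> f y - f x = phi y * (y - x)].

Lemma cara_is_derive f x d : cara f x d <-> is_derive x 1 f d.
Proof.
split=> [[phi [phid phic [r r0 H]]]|/is_derive_cabs H].
  apply/is_derive_cabs => e /phic[s s0 Hs]; exists (Num.min r s).
    by rewrite lt_min r0.
  move=> h; rewrite lt_min => /andP[hr hs].
  have xh : x + h - x = h by rewrite addrC addKr.
  rewrite H ?xh // -mulrBl cabsM ler_wpM2r ?cabs_ge0 // ltW //.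
  by rewrite -phid; apply: Hs; rewrite xh.
exists (fun y => if y == x then d else (f y - f x) / (y - x)); split.
- by rewrite eqxx.
- move=> e e0; have e20 : 0 < e / 2 by rewrite divr_gt0.
  have [r r0 Hr] := H _ e20; exists r => // y yr; rewrite eqxx.
  case: eqVneq => [_|yx]; first by rewrite subrr cabs0.
  have := Hr _ yr; rewrite (addrC x) subrK => {}Hr.
  have yx0 : y - x != 0 by rewrite subr_eq0.
  have -> : (f y - f x) / (y - x) - d = (f y - f x - d * (y - x)) / (y - x) by field.
  rewrite cabsM cabsV ltr_pdivrMr ?cabs_gt0 //; apply: le_lt_trans Hr _.
  by rewrite ltr_pM2r ?cabs_gt0 //; lra.
exists 1 => // y _; case: eqVneq => [->|yx]; first by rewrite !subrr mulr0.
by rewrite divfK // subr_eq0.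
Qed.

Lemma cara_unique f x d d' : cara f x d -> cara f x d' -> d = d'.
Proof. by move=> /cara_is_derive[_ <-] /cara_is_derive[_ <-]. Qed.

Lemma cara_cts f x d : cara f x d -> cts f x.
Proof.
move=> [phi [_ phic [r r0 H]]].
have : cts (fun y => phi y * (y - x)) x by apply: ctsM => //; apply: cts_subc; apply: cts_id.
move=> c e /c[s s0 Hs]; exists (Num.min r s); first by rewrite lt_min r0.
move=> y; rewrite lt_min => /andP[/H -> /Hs].
by rewrite subrr mulr0 subr0.
Qed.

Lemma cara_ext f g x d (r : R) : 0 < r -> (forall y, cabs (y - x) < r -> f y = g y) ->
  cara f x d -> cara g x d.
Proof.
move=> r0 fg [phi [phid phic [s s0 H]]]; exists phi; split=> //.
exists (Num.min r s); first by rewrite lt_min r0.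
move=> y; rewrite lt_min => /andP[yr /H <-].
by rewrite !fg // subrr cabs0.
Qed.

Lemma cts_comp f g x : cts g x -> cts f (g x) -> cts (fun y => f (g y)) x.
Proof.
move=> gx fx e /fx[r r0 Hr]; have [s s0 Hs] := gx _ r0.
by exists s => // y /Hs /Hr.
Qed.

Lemma ctsD f g x : cts f x -> cts g x -> cts (fun y => f y + g y) x.
Proof.
move=> h1 h2 e e0; have e20 : 0 < e / 2 by rewrite divr_gt0.
have [d1 d10 H1] := h1 _ e20; have [d2 d20 H2] := h2 _ e20.
exists (Num.min d1 d2); first by rewrite lt_min d10.
move=> y; rewrite lt_min => /andP[/H1 g1 /H2 g2].
rewrite opprD addrACA; apply: le_lt_trans (cabsD _ _) _; lra.
Qed.

Lemma cts_cst (a : R[i]) x : cts (fun=> a) x.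
Proof. exact: la_cts (la_cst a x). Qed.

Lemma cts_inv f x : cts f x -> f x != 0 -> cts (fun y => (f y)^-1) x.
Proof. by move=> fx f0; apply: (cts_comp (f := fun y => y^-1)) fx _; apply: la_cts (la_inv f0). Qed.

Lemma cts_neq0 f x : cts f x -> f x != 0 ->
  exists2 r : R, 0 < r & forall y, cabs (y - x) < r -> f y != 0.
Proof.
move=> fx f0; have [|r r0 Hr] := fx (cabs (f x)); first by rewrite cabs_gt0.
exists r => // y /Hr; apply: contraTneq => ->.
by rewrite sub0r cabsN ltxx.
Qed.

Lemma cara_cst (a : R[i]) x : cara (fun=> a) x 0.
Proof.
exists (fun=> 0); split=> //; first exact: cts_cst.
by exists 1 => // y _; rewrite subrr mul0r.
Qed.

Lemma cara_id x : cara id x 1.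
Proof.
exists (fun=> 1); split=> //; first exact: cts_cst.
by exists 1 => // y _; rewrite mul1r.
Qed.

Lemma caraD f g x d d' : cara f x d -> cara g x d' -> cara (fun y => f y + g y) x (d + d').
Proof.
move=> [p [<- pc [r r0 H]]] [q [<- qc [s s0 H']]]; exists (fun y => p y + q y); split=> //.
  exact: ctsD.
exists (Num.min r s); first by rewrite lt_min r0.
by move=> y; rewrite lt_min => /andP[/H h1 /H' h2]; rewrite opprD addrACA h1 h2 mulrDl.
Qed.

Lemma caraM f g x d d' : cara f x d -> cara g x d' ->
  cara (fun y => f y * g y) x (d * g x + f x * d').
Proof.
move=> fd gd; have gc := cara_cts gd; move: fd gd.
move=> [p [<- pc [r r0 H]]] [q [<- qc [s s0 H']]].
exists (fun y => p y * g y + f x * q y); split=> //.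
  by apply: ctsD; apply: ctsM => //; apply: cts_cst.
exists (Num.min r s); first by rewrite lt_min r0.
move=> y; rewrite lt_min => /andP[/H h1 /H' h2].
rewrite mulrDl mulrAC -h1 -(mulrA (f x)) -h2; ring.
Qed.

Lemma caraZ (a : R[i]) f x d : cara f x d -> cara (fun y => a * f y) x (a * d).
Proof.
by move=> fd; have := caraM (cara_cst a x) fd; rewrite mul0r add0r.
Qed.

Lemma cara_comp f g x d d' : cara g x d -> cara f (g x) d' ->
  cara (fun y => f (g y)) x (d' * d).
Proof.
move=> gd [q [<- qc [s s0 H']]]; have gc := cara_cts gd; move: gd => [p [<- pc [r r0 H]]].
exists (fun y => q (g y) * p y); split=> //.
  by apply: ctsM => //; apply: (cts_comp (f := q)).
have [t t0 Ht] := gc _ s0.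
exists (Num.min r t); first by rewrite lt_min r0.
by move=> y; rewrite lt_min => /andP[/H h1 /Ht /H' ->]; rewrite h1 mulrA.
Qed.

Lemma caraV f x d : cara f x d -> f x != 0 -> cara (fun y => (f y)^-1) x (- d / f x ^+ 2).
Proof.
move=> fd f0; have fc := cara_cts fd; move: fd => [p [<- pc [r r0 H]]].
exists (fun y => - p y * ((f y)^-1 * (f x)^-1)); split.
- by rewrite expr2 invfM.
- apply: ctsM.
    apply: (cts_ext (f := fun y => -1 * p y) (r := 1)) => //; first by move=> y _; rewrite mulN1r.
    by apply: ctsM => //; apply: cts_cst.
  by apply: ctsM; [apply: cts_inv|apply: cts_cst].
have [t t0 Ht] := cts_neq0 fc f0.
exists (Num.min r t); first by rewrite lt_min r0.
move=> y; rewrite lt_min => /andP[/H h1 /Ht fy].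
have -> : - p y * ((f y)^-1 / f x) * (y - x) = - (p y * (y - x)) * ((f y)^-1 / f x) by ring.
by rewrite -h1; field; rewrite fy f0.
Qed.

Lemma la_cara f x : la f x -> exists d, cara f x d.
Proof.
move=> [c [s fc]]; have [f1 _ /(_ 0)] := ps_deriv fc.
have [s0 _ _] := fc; rewrite cabs0 divr_gt0 // => /(_ isT) /cara_is_derive.
move=> [p [p0 pc [r r0 H]]]; exists (f1 0), (fun y => p (y - x)); split.
- by rewrite subrr.
- by apply: (cts_comp (f := p)); [apply: cts_subc; apply: cts_id | rewrite subrr].
exists r => // y yr; have := H (y - x); rewrite subr0 addr0 (addrC x) subrK.
by apply.
Qed.

(* A continuous branch of log f is differentiable, with derivative f'/f. *)
Lemma cara_preimage (E l f : R[i] -> R[i]) x d d' (r : R) : 0 < r ->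
  (forall y, cabs (y - x) < r -> E (l y) = f y) -> cts l x ->
  cara E (l x) d -> d != 0 -> cara f x d' -> cara l x (d' / d).
Proof.
move=> r0 El lc [q [<- qc [s s0 H]]] d0 [p [<- pc [t t0 H']]].
have qlc : cts (fun y => q (l y)) x by apply: cts_comp.
have [u u0 Hu] := cts_neq0 qlc d0.
have [v v0 Hv] := lc _ s0.
exists (fun y => p y / q (l y)); split=> //.
  by apply: ctsM => //; apply: cts_inv.
exists (Num.min (Num.min r t) (Num.min u v)); first by rewrite !lt_min r0 t0 u0.
move=> y; rewrite !lt_min => /andP[/andP[yr yt] /andP[yu yv]].
apply: (mulfI (Hu y yu)); rewrite -H; last exact: Hv.
rewrite El // El ?subrr ?cabs0 // H' //.
by rewrite [RHS]mulrA [q _ * (_ / _)]mulrC divfK ?Hu.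
Qed.

End Caratheodory.

(** * The complex exponential and its logarithms *)

Section ComplexExponential.
Variable R : realType.
Implicit Types (z w : R[i]).

Lemma cexpE z : cexp z = (expR (Re z) * cos (Im z)) +i* (expR (Re z) * sin (Im z)).
Proof. by []. Qed.

Lemma cexpD z w : cexp (z + w) = cexp z * cexp w.
Proof.
case: z w => [a b] [c d]; rewrite /cexp; simpc.
by rewrite expRD cosD sinD; congr (_ +i* _); ring.
Qed.

Lemma cexp0 : cexp 0 = 1 :> R[i].
Proof. by rewrite /cexp /= expR0 cos0 sin0 mulr1 mulr0. Qed.

Lemma cexp_neq0 z : cexp z != 0.
Proof.
have : cexp z * cexp (- z) = 1 by rewrite -cexpD subrr cexp0.
by apply: contra_eq_neq => ->; rewrite mul0r eq_sym oner_eq0.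
Qed.

Lemma cexpN z : cexp (- z) = (cexp z)^-1.
Proof. by apply: (mulfI (cexp_neq0 z)); rewrite -cexpD subrr cexp0 divff // cexp_neq0. Qed.

Lemma real_derive_eps (f : R -> R) (x d : R) : is_derive x 1 f d ->
  forall e : R, 0 < e -> exists2 r : R, 0 < r &
    forall a, `|a| < r -> `|f (x + a) - f x - d * a| <= e * `|a|.
Proof.
move=> [df fd] e e0.
have : h^-1 *: ((f \o shift x) (h *: 1) - f x) @[h --> 0^'] --> d.
  by rewrite -fd; exact: df.
move=> /cvgrPdist_lt/(_ e e0) /nbhs_ballP[r /= r0 Hr].
exists r => // a ar; have [->|a0] := eqVneq a 0.
  by rewrite addr0 mulr0 !subrr normr0 mulr0.
have := Hr a; rewrite -ball_normE /= sub0r normrN => /(_ ar a0).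
rewrite -[a *: 1]/(a * 1) mulr1 (addrC a) distrC -[_ *: _]/(_ * _) => /ltW H.
have -> : f (x + a) - f x - d * a = a * (a^-1 * (f (x + a) - f x) - d) by field.
by rewrite normrM mulrC ler_wpM2r.
Qed.

Lemma cexp_sub1_est (e : R) : 0 < e -> exists2 r : R, 0 < r &
  forall h : R[i], cabs h < r -> cabs (cexp h - 1 - h) <= e * cabs h.
Proof.
(* The real and the imaginary part contribute 4 e' |h| and 5 e' |h|. [e'] also bounds |h|, to absorb
   the quadratic product of two first-order errors. *)
move=> e0; pose e' := Num.min 1 (e / 9).
have e'0 : 0 < e' by rewrite lt_min ltr01 divr_gt0.
have e'1 : e' <= 1 by rewrite ge_min lexx.
have e'9 : 9 * e' <= e by have : e' <= e / 9; [rewrite ge_min lexx orbT | lra].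
clearbody e'; have [r1 r10 H1] := real_derive_eps (is_derive_expR 0) e'0.
have [r2 r20 H2] := real_derive_eps (is_derive_cos 0) e'0.
have [r3 r30 H3] := real_derive_eps (is_derive_sin 0) e'0.
exists (Num.min (Num.min r1 r2) (Num.min r3 e')); first by rewrite !lt_min r10 r20 r30 e'0.
move=> h; rewrite !lt_min => /andP[/andP[h1 h2] /andP[h3 h4]].
have a1 := cabs_Re h; have b1 := cabs_Im h.
have := H1 (Re h) (le_lt_trans a1 h1); have := H2 (Im h) (le_lt_trans b1 h2).
have := H3 (Im h) (le_lt_trans b1 h3).
rewrite !add0r expR0 cos0 sin0 oppr0 mul0r !mul1r !subr0 addr0 => s3 s2 s1.
apply: le_trans (cabs_le _) _; rewrite !raddfB /= subr0.
move: s1 s2 s3 a1 b1 h4; set a := Re h; set b := Im h; set m := cabs h.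
set E := expR a; set C := cos b; set S := sin b => s1 s2 s3 a1 b1 h4.
have m0 : 0 <= m := le_trans (normr_ge0 _) a1.
have am : e' * `|a| <= e' * m by rewrite ler_wpM2l // ltW.
have bm : e' * `|b| <= e' * m by rewrite ler_wpM2l // ltW.
have em : e' * m <= m by rewrite ler_piMl.
have E1 : `|E - 1| <= 2 * m.
  have -> : E - 1 = (E - 1 - a) + a by ring.
  apply: le_trans (ler_normD _ _) _; lra.
have En : `|E| <= 3.
  have -> : E = (E - 1) + 1 by ring.
  apply: le_trans (ler_normD _ _) _; rewrite normr1; lra.
have S1 : `|S| <= 2 * m.
  have -> : S = (S - b) + b by ring.
  apply: le_trans (ler_normD _ _) _.
  lra.
have re : `|E * C - 1 - a| <= 4 * (e' * m).
  have -> : E * C - 1 - a = E * (C - 1) + (E - 1 - a) by ring.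
  apply: le_trans (ler_normD _ _) _; rewrite normrM.
  have : `|E| * `|C - 1| <= 3 * (e' * m) by apply: ler_pM => //; lra.
  lra.
have im : `|E * S - b| <= 5 * (e' * m).
  have -> : E * S - b = (E - 1) * S + (S - b) by ring.
  apply: le_trans (ler_normD _ _) _; rewrite normrM.
  have : `|E - 1| * `|S| <= (2 * m) * (2 * m) by apply: ler_pM.
  have : m * m <= e' * m by rewrite ler_wpM2r // ltW.
  lra.
have : 9 * e' * m <= e * m by rewrite ler_wpM2r.
lra.
Qed.

Lemma cexp_cara z : cara cexp z (cexp z).
Proof.
apply/cara_is_derive/is_derive_cabs => e e0.
have c0 : 0 < cabs (cexp z) by rewrite cabs_gt0 cexp_neq0.
have [|r r0 Hr] := @cexp_sub1_est (e / cabs (cexp z)); first by rewrite divr_gt0.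
exists r => // h /Hr H.
have -> : cexp (z + h) - cexp z - cexp z * h = cexp z * (cexp h - 1 - h).
  by rewrite cexpD; ring.
by rewrite cabsM -ler_pdivlMl // mulrA [_^-1 * _]mulrC.
Qed.

Lemma cabs_cexp z : cabs (cexp z) = expR (Re z).
Proof.
apply: (pexpIrn (n := 2)) => //; rewrite ?nnegrE ?cabs_ge0 ?expR_ge0 //.
by rewrite cabs_sqr /= !exprMn -mulrDr cos2Dsin2 mulr1.
Qed.

Lemma sin_zero (x : R) : - (2 * pi) < x < pi -> sin x = 0 -> x = 0 \/ x = - pi.
Proof.
move=> /andP[x1 x2] sx; have p0 := pi_gt0 R.
case: (ltrgtP x 0) => [xn|xp|]; last by left.
  right; case: (ltrgtP x (- pi)) => [xl|xg|//].
    have : 0 < sin (x + 2 * pi) by apply: sin_gt0_pi; apply/andP; split; lra.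
    by rewrite mulr_natl sinD2pi sx ltxx.
  have : 0 < sin (- x) by apply: sin_gt0_pi; apply/andP; split; lra.
  by rewrite sinN sx oppr0 ltxx.
have : 0 < sin x by apply: sin_gt0_pi; apply/andP; split.
by rewrite sx ltxx.
Qed.

(** The window is the range of 2 [rt y] (t1 - t2) for times t1 of the domain D and t2 of the domain
    U; the only periods in it are 0 and -2 pi i. *)
Lemma cexp_eq1 z : cexp z = 1 -> - (4 * pi) < Im z < 2 * pi ->
  z = 0 \/ z = (- (2 * pi)) *i.
Proof.
move=> z1 /andP[h1 h2].
have r0 : Re z = 0.
  by have := cabs_cexp z; rewrite z1 cabs1 -expR0 => /expR_inj.
have c1 : cos (Im z) = 1.
  by move: z1; rewrite /cexp r0 expR0 !mul1r => -[].
have s0 : sin (Im z / 2) = 0.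
  have := cos_mulr2n (Im z / 2); have := cos2Dsin2 (Im z / 2).
  have -> : (Im z / 2) *+ 2 = Im z by rewrite -[_ *+ 2]mulr_natr divfK.
  rewrite c1 -[_ *+ 2]mulr_natr => E1 E2.
  by apply/eqP; rewrite -sqrf_eq0; apply/eqP; lra.
have [|E|E] := sin_zero _ s0; first by apply/andP; split; lra.
  by left; rewrite [z]complexE r0 (_ : Im z = 0) ?mulr0 ?addr0 //; lra.
right.
have : Im z = - (2 * pi) by lra.
by move: r0; case: (z) => a b /= -> ->.
Qed.

(** Near 1 the logarithm ln |Z| + i asin (Im Z / |Z|) is small by continuity of ln and asin. It
    lifts small displacements of x to small displacements of t. *)
Lemma cexp_local (e : R) : 0 < e -> exists2 r : R, 0 < r &
  forall Z : R[i], cabs (Z - 1) < r -> exists2 z : R[i], cabs z < e & cexp z = Z.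
Proof.
move=> e0; have e20 : 0 < e / 2 by rewrite divr_gt0.
have [r1 r10 H1] : exists2 r : R, 0 < r & forall x : R, `|x - 1| < r -> `|ln x| < e / 2.
  have /cvgrPdist_lt/(_ _ e20)/nbhs_ballP[r /= r0 Hr] := @continuous_ln R 1 ltr01.
  exists r => // x xr; have := Hr x; rewrite -ball_normE /= distrC => /(_ xr).
  by rewrite ln1 sub0r normrN.
have asin0 : asin (0 : R) = 0.
  by have := @sinK R 0; rewrite sin0; apply; rewrite in_itv /= lerNl oppr0 divr_ge0 ?pi_ge0.
have [r2 r20 H2] : exists2 r : R, 0 < r & forall x : R, `|x| < r -> `|asin x| < e / 2.
  have z1 : -1 < (0 : R) < 1 by rewrite ltrN10 ltr01.
  have /cvgrPdist_lt/(_ _ e20)/nbhs_ballP[r /= r0 Hr] := continuous_asin z1.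
  exists r => // x xr; have := Hr x; rewrite -ball_normE /= sub0r normrN => /(_ xr).
  by rewrite asin0 sub0r normrN.
exists (Num.min (Num.min r1 (r2 / 2)) 2^-1).
  by rewrite !lt_min r10 divr_gt0 //= invr_gt0 ltr0n.
move=> Z; rewrite !lt_min => /andP[/andP[Z1 Z2] Z3].
have lip := cabs_lip Z 1; rewrite cabs1 in lip.
have Zhalf : 2^-1 < cabs Z by move: lip; rewrite ler_norml => /andP[]; lra.
have Z0 : 0 < cabs Z by apply: lt_trans Zhalf; rewrite invr_gt0.
have ReZ : 0 < Re Z.
  have := cabs_Re (Z - 1); rewrite raddfB /= ler_norml => /andP[]; lra.
have ImZ : `|Im Z| <= cabs (Z - 1) by have := cabs_Im (Z - 1); rewrite raddfB /= subr0.
pose u := Im Z / cabs Z; pose v := Re Z / cabs Z.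
have uv : u ^+ 2 + v ^+ 2 = 1.
  by rewrite /u /v !expr_div_n -mulrDl addrC -cabs_sqr divff // gt_eqF // exprn_gt0.
have v0 : 0 < v by rewrite divr_gt0.
have u1 : -1 <= u <= 1 by apply/andP; split; nra.
have ur : `|u| < r2.
  rewrite /u normrM normfV (gtr0_norm Z0) ltr_pdivrMr //.
  have : r2 / 2 < r2 * cabs Z by rewrite ltr_pM2l.
  lra.
exists (ln (cabs Z) +i* asin u).
  apply: le_lt_trans (cabs_le _) _ => /=.
  have := H1 (cabs Z) (le_lt_trans lip Z1); have := H2 u ur; lra.
rewrite cexpE /= lnK ?posrE // asinK ?in_itv //= cos_asin //.
have -> : Num.sqrt (1 - u ^+ 2) = v.
  by rewrite -uv addrAC subrr add0r sqrtr_sqr gtr0_norm.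
rewrite /u /v ![cabs Z * _]mulrC !divfK ?gt_eqF //.
by case: (Z).
Qed.

(** The argument is the arc cosine of Re Z / |Z|, taken with the sign of Im Z. *)
Lemma cexp_surj (Z : R[i]) : Z != 0 ->
  exists2 z : R[i], - pi < Im z <= pi & cexp z = Z.
Proof.
rewrite -cabs_gt0 => Z0.
pose u := Im Z / cabs Z; pose v := Re Z / cabs Z.
have uv : u ^+ 2 + v ^+ 2 = 1.
  by rewrite /u /v !expr_div_n -mulrDl addrC -cabs_sqr divff // gt_eqF // exprn_gt0.
have v1 : -1 <= v <= 1 by apply/andP; split; nra.
have p0 := pi_gt0 R.
have su : Num.sqrt (1 - v ^+ 2) = `|u| by rewrite -uv addrK sqrtr_sqr.
have E : forall t, cos t = v -> sin t = u -> cexp (ln (cabs Z) +i* t) = Z.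
  move=> t ct st; rewrite cexpE /= lnK ?posrE // ct st.
  by rewrite /u /v ![cabs Z * _]mulrC !divfK ?gt_eqF //; case: (Z).
have [a0 ap] : 0 <= acos v /\ acos v <= pi by rewrite acos_ge0 ?acos_lepi.
case: (leP 0 u) => u0.
  exists (ln (cabs Z) +i* acos v) => /=; first by apply/andP; split; lra.
  by apply: E; [rewrite acosK ?in_itv | rewrite sin_acos // su ger0_norm].
exists (ln (cabs Z) +i* (- acos v)) => /=.
  have : acos v < pi by apply: acos_ltpi; apply/andP; split; nra.
  by move=> h; apply/andP; split; lra.
apply: E; first by rewrite cosN acosK ?in_itv.
by rewrite sinN sin_acos // su ltr0_norm // opprK.
Qed.

End ComplexExponential.

(** * The sectorial domains above positive parameters *)

Section PositiveEpsilon.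
Variable R : realType.
Variables (K : constants R) (y : R).
Hypotheses (y0 : 0 < y) (yrho : y < crho K) (g0 : 0 < cgam K).
Hypotheses (kap0 : 0 < ckap K) (kap1 : ckap K < 2^-1) (h0 : 0 < ch K).

(* The point of the universal covering above the positive number y at which
   the strips bounding the sectorial domains are horizontal. *)
Definition wpos : R[i] := ln y +i* (2 * pi).
Definition rt : R := Num.sqrt y.

Hypothesis rth : 2 * (rt * ch K) < pi.

Let twoC : 2%:R = (2 : R)%:C :> R[i]. Proof. by rewrite rmorph_nat. Qed.

Lemma rt_gt0 : 0 < rt. Proof. by rewrite sqrtr_gt0. Qed.

Lemma rt_sqr : rt ^+ 2 = y. Proof. by rewrite sqr_sqrtr // ltW. Qed.

Let rtC0 : rt%:C != 0 :> R[i].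
Proof. by rewrite -cabs_gt0 cabsR gtr0_norm ?rt_gt0. Qed.

Lemma csector_wpos : csector K wpos.
Proof.
have p0 := pi_gt0 R.
by rewrite /csector /sector /wpos /= lnK ?posrE //; split=> //; move: g0; lra.
Qed.

Lemma eps_wpos : eps wpos = y%:C.
Proof.
rewrite /eps cexpE /= lnK ?posrE // mulr_natl.
by rewrite cos2pi sin2pi mulr1 mulr0.
Qed.

Lemma sqeps_wpos : sqeps wpos = - rt%:C.
Proof.
rewrite /sqeps.
have -> : wpos / 2%:R = (ln y / 2) +i* pi.
  apply: (mulIf (_ : 2%:R != 0 :> R[i])); first by rewrite pnatr_eq0.
  rewrite divfK ?pnatr_eq0 // twoC /wpos; simpc.
  by congr (_ +i* _); [field | ring].
rewrite cexpE /= cospi sinpi mulr0 mulrN1.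
have -> : expR (ln y / 2) = rt.
  apply: (pexpIrn (n := 2)) => //; rewrite ?nnegrE ?expR_ge0 ?(ltW rt_gt0) //.
  by rewrite rt_sqr expr2 -expRD -splitr lnK ?posrE.
by apply/eqP; rewrite eq_complex /= oppr0 !eqxx.
Qed.

Lemma xL_wpos : xL wpos = - rt%:C. Proof. exact: sqeps_wpos. Qed.
Lemma xR_wpos : xR wpos = rt%:C. Proof. by rewrite /xR sqeps_wpos opprK. Qed.

Lemma period_wpos : period wpos = (pi / rt) *i.
Proof.
rewrite /period sqeps_wpos invrN mulrNN; apply: (mulIf rtC0).
rewrite divfK //; simpc.
by congr (_ +i* _); rewrite divfK // gt_eqF ?rt_gt0.
Qed.

Lemma that_wpos : that (cgam K) wpos = 0.
Proof.
rewrite /that /wpos /=; have -> : 2 * pi / 2 = pi :> R by field.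
by rewrite subrr mulr0.
Qed.

Lemma sigma_wpos u : sigma K wpos u = 0.
Proof. by rewrite /sigma that_wpos tan0 mulr0 if_same. Qed.

(** At this parameter x(t) is a Moebius function of this exponential: zt = (x - sqrt y) / (x + sqrt
    y). The values 0, infinity and 1 of zt correspond to xR, xL and x = infinity. *)
Definition zt (t : R[i]) : R[i] := cexp (2 * rt%:C * t).

Lemma zt_neq0 t : zt t != 0. Proof. exact: cexp_neq0. Qed.

Lemma Im_zt t : Im (2 * rt%:C * t) = 2 * rt * Im t.
Proof.
case: t => a b; rewrite twoC; simpc.
by rewrite /=; ring.
Qed.

Let half (E : R[i]) : E != 0 -> (E^-1 - E) / 2%:R = (1 - E ^+ 2) / (2%:R * E).
Proof. by move=> E0; field. Qed.

Let ztE t : zt t = cexp (rt%:C * t) ^+ 2.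
Proof. by rewrite /zt expr2 -cexpD; congr cexp; ring. Qed.

Let csinhE t : csinh (sqeps wpos * t) = (1 - zt t) / (2%:R * cexp (rt%:C * t)).
Proof.
by rewrite /csinh sqeps_wpos mulNr opprK cexpN ztE half // cexp_neq0.
Qed.

Let ccoshE t : ccosh (sqeps wpos * t) = (1 + zt t) / (2%:R * cexp (rt%:C * t)).
Proof.
rewrite /ccosh sqeps_wpos mulNr opprK cexpN ztE.
by have := cexp_neq0 (rt%:C * t); move: (cexp _) => E E0; field.
Qed.

Lemma csinh_eq0 t : (csinh (sqeps wpos * t) == 0) = (zt t == 1).
Proof.
rewrite csinhE mulf_eq0 invr_eq0 mulf_eq0 pnatr_eq0 (negPf (cexp_neq0 _)) !orbF.
by rewrite subr_eq0 eq_sym.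
Qed.

Lemma xtimeE t : zt t != 1 -> xtime wpos t = rt%:C * (1 + zt t) / (1 - zt t).
Proof.
move=> z1; rewrite /xtime csinhE ccoshE sqeps_wpos opprK.
have d : 1 - zt t != 0 by rewrite subr_eq0 eq_sym.
have := cexp_neq0 (rt%:C * t); move: (cexp _) => E E0.
by field; rewrite E0 d.
Qed.

Lemma zt_xtime t : zt t != 1 -> zt t = (xtime wpos t - rt%:C) / (xtime wpos t + rt%:C).
Proof.
move=> z1; rewrite xtimeE //.
have d : 1 - zt t != 0 by rewrite subr_eq0 eq_sym.
move: (zt t) d => z d; field; rewrite d /=.
have -> : rt%:C * (1 + z) + rt%:C * (1 - z) = 2%:R * rt%:C :> R[i] by ring.
by rewrite mulf_neq0 ?pnatr_eq0 ?rtC0.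
Qed.

Lemma xtime_zt x t : x + rt%:C != 0 -> zt t = (x - rt%:C) / (x + rt%:C) ->
  zt t != 1 /\ xtime wpos t = x.
Proof.
move=> xr zE.
have z1 : zt t != 1.
  rewrite zE; apply/eqP => /(congr1 (fun z => z * (x + rt%:C))).
  rewrite divfK // mul1r => E; have : 2%:R * rt%:C = 0 :> R[i].
    have -> : 2%:R * rt%:C = (x + rt%:C) - (x - rt%:C) :> R[i] by ring.
    by rewrite E subrr.
  by move/eqP; rewrite mulf_eq0 pnatr_eq0 (negPf rtC0).
split=> //; rewrite xtimeE // zE.
field; rewrite xr /=; have -> : x + rt%:C - (x - rt%:C) = 2%:R * rt%:C by ring.
by rewrite mulf_neq0 ?pnatr_eq0 ?rtC0.
Qed.

Lemma xtimeB t : zt t != 1 ->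
  xtime wpos t - rt%:C != 0 /\ xtime wpos t + rt%:C != 0.
Proof.
move=> z1; rewrite xtimeE //.
have d : 1 - zt t != 0 by rewrite subr_eq0 eq_sym.
have z0 := zt_neq0 t; move: (zt t) d z0 => z d z0; split.
  have -> : rt%:C * (1 + z) / (1 - z) - rt%:C = 2%:R * rt%:C * z / (1 - z) by field.
  by rewrite !mulf_neq0 ?pnatr_eq0 ?invr_eq0 ?rtC0.
have -> : rt%:C * (1 + z) / (1 - z) + rt%:C = 2%:R * rt%:C / (1 - z) by field.
by rewrite !mulf_neq0 ?pnatr_eq0 ?invr_eq0 ?rtC0.
Qed.

Lemma zt_cara t : cara zt t (2 * rt%:C * zt t).
Proof.
have := cara_comp (caraZ (2 * rt%:C) (cara_id t)) (cexp_cara _).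
by rewrite mulr1 => H; rewrite mulrC; exact: H.
Qed.

Lemma xtime_cara t : zt t != 1 -> cara (xtime wpos) t (xtime wpos t ^+ 2 - y%:C).
Proof.
move=> z1; have zc := zt_cara t.
have d : 1 - zt t != 0 by rewrite subr_eq0 eq_sym.
have n1 := caraD (cara_cst 1 t) (caraZ (-1) zc).
have nE : 1 + -1 * zt t != 0 by rewrite mulN1r.
have n2 := caraM (caraZ rt%:C (caraD (cara_cst 1 t) zc)) (caraV n1 nE).
have [r r0 Hr] := cts_neq0 (cara_cts n1) nE.
have -> : xtime wpos t ^+ 2 - y%:C = (rt%:C * (0 + 2 * rt%:C * zt t)) * (1 + -1 * zt t)^-1
   + rt%:C * (1 + zt t) * (- (0 + -1 * (2 * rt%:C * zt t)) / (1 + -1 * zt t) ^+ 2).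
  rewrite xtimeE // -rt_sqr rmorphXn /= mulN1r; field.
  by rewrite d.
apply: (cara_ext r0 _ n2) => s sr; rewrite xtimeE ?mulN1r //.
by have := Hr s sr; rewrite mulN1r subr_eq0 eq_sym.
Qed.

Let lo := - ((2^-1 + ckap K) * (pi / rt)).
Let hi := (2^-1 + ckap K) * (pi / rt).

Let pr0 : 0 < pi / rt. Proof. by rewrite divr_gt0 ?pi_gt0 ?rt_gt0. Qed.

Let kp : 0 < ckap K * pi < 2^-1 * pi.
Proof. by rewrite mulr_gt0 ?pi_gt0 //= ltr_pM2r ?pi_gt0. Qed.

Let kpr : 0 < ckap K * (pi / rt) < 2^-1 * (pi / rt).
Proof. by rewrite mulr_gt0 //= ltr_pM2r. Qed.

Let rtpi : 2 * rt * (pi / rt) = 2 * pi.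
Proof. by rewrite -mulrA [rt * _]mulrC divfK // gt_eqF ?rt_gt0. Qed.

Lemma above_line_wpos t :
  above_line (- ((2^-1 + ckap K)%:C * period wpos)) (that (cgam K) wpos) t <-> lo < Im t.
Proof.
rewrite that_wpos period_wpos /above_line /cis cos0 sin0 /lo; simpc.
split=> [[s [v [v0 ->]]]|H] /=.
  by simpc; rewrite /=; lra.
exists (Re t), (Im t - lo); rewrite subr_gt0; split=> //.
by case: t {H} => a b; rewrite /lo; simpc; congr (_ +i* _); rewrite /=; lra.
Qed.

Lemma below_line_wpos t :
  below_line ((2^-1 + ckap K)%:C * period wpos) (that (cgam K) wpos) t <-> Im t < hi.
Proof.
rewrite that_wpos period_wpos /below_line /cis cos0 sin0 /hi; simpc.
split=> [[s [v [v0 ->]]]|H] /=.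
  by simpc; rewrite /=; lra.
exists (Re t), (Im t - hi); rewrite subr_lt0; split=> //.
by case: t {H} => a b; rewrite /hi; simpc; congr (_ +i* _); rewrite /=; lra.
Qed.

Lemma not_Nhole t : zt t != 1 -> cabs (xtime wpos t) < crad K -> ~ Nhole (crad K) wpos t.
Proof.
move=> z1 xr /connected_component_sub /= [/eqP|].
  by rewrite csinh_eq0 (negPf z1).
by rewrite normcabs lecR leNgt xr.
Qed.

Lemma Nhole0 : Nhole (crad K) wpos 0.
Proof.
by apply: connected_component_refl; left; apply/eqP; rewrite csinh_eq0 /zt mulr0 cexp0.
Qed.

(** x(t) is infinite exactly at the multiples of i pi / sqrt(y). Those other than 0 lie outside the
    strip, because [ckap K < 1/2] and [2 * (rt * ch K) < pi], and 0 lies in [Nhole]. *)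
Lemma Gamma_D_wpos t : Gamma_D K wpos t -> zt t != 1 /\ lo < Im t < ch K.
Proof.
move=> [tN th /above_line_wpos tl]; rewrite sigma_wpos addr0 in th.
split; last by rewrite tl th.
apply/eqP => z1; have p0 := pi_gt0 R; have r0 := rt_gt0.
have [|t0|tp] := cexp_eq1 z1.
- rewrite Im_zt; apply/andP; split.
    have : 2 * rt * lo < 2 * rt * Im t by rewrite ltr_pM2l ?mulr_gt0.
    rewrite /lo mulrN mulrCA rtpi; move: kp kpr pr0 => /andP[k1 k2] /andP[k3 k4] k5; lra.
  have : 2 * rt * Im t < 2 * rt * ch K by rewrite ltr_pM2l ?mulr_gt0.
  by move: rth; lra.
- move/eqP: t0; rewrite mulf_eq0 mulf_eq0 pnatr_eq0 (negPf rtC0) /= => /eqP t0.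
  by apply: tN; rewrite t0; exact: Nhole0.
have := congr1 (@complex.Im R) tp; rewrite Im_zt /= -rtpi -mulrN => /mulfI.
rewrite mulf_eq0 pnatr_eq0 /= => /(_ (lt0r_neq0 r0)) E.
by move: tl; rewrite E /lo; move: kp kpr pr0 => /andP[k1 k2] /andP[k3 k4] k5; lra.
Qed.

Lemma Gamma_U_wpos t : Gamma_U K wpos t -> zt t != 1 /\ - ch K < Im t < hi.
Proof.
move=> [tN th /below_line_wpos tl]; rewrite sigma_wpos addr0 in th.
split; last by rewrite tl th.
apply/eqP => z1; have p0 := pi_gt0 R; have r0 := rt_gt0.
have z1' : cexp (- (2 * rt%:C * t)) = 1 by rewrite cexpN -/(zt t) z1 invr1.
have [|t0|tp] := cexp_eq1 z1'.
- rewrite raddfN /= Im_zt; apply/andP; split.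
    have : 2 * rt * Im t < 2 * rt * hi by rewrite ltr_pM2l ?mulr_gt0.
    rewrite /hi mulrCA rtpi; move: kp kpr pr0 => /andP[k1 k2] /andP[k3 k4] k5; lra.
  have : 2 * rt * (- ch K) < 2 * rt * Im t by rewrite ltr_pM2l ?mulr_gt0.
  by move: rth; lra.
- move/eqP: t0; rewrite oppr_eq0 mulf_eq0 mulf_eq0 pnatr_eq0 (negPf rtC0) /= => /eqP t0.
  by apply: tN; rewrite t0; exact: Nhole0.
have := congr1 (@complex.Im R) tp; rewrite raddfN /= Im_zt -rtpi => /oppr_inj/mulfI.
rewrite mulf_eq0 pnatr_eq0 /= => /(_ (lt0r_neq0 r0)) E.
by move: tl; rewrite E /hi; move: kp kpr pr0 => /andP[k1 k2] /andP[k3 k4] k5; lra.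
Qed.

Lemma Gamma_D_intro t : zt t != 1 -> cabs (xtime wpos t) < crad K ->
  lo < Im t < ch K -> Gamma_D K wpos t.
Proof.
move=> z1 xr /andP[tl th]; split; first exact: not_Nhole.
  by rewrite sigma_wpos addr0.
exact/above_line_wpos.
Qed.

Lemma Gamma_U_intro t : zt t != 1 -> cabs (xtime wpos t) < crad K ->
  - ch K < Im t < hi -> Gamma_U K wpos t.
Proof.
move=> z1 xr /andP[tl th]; split; first exact: not_Nhole.
  by rewrite sigma_wpos addr0.
exact/below_line_wpos.
Qed.

(** A logarithm of (x - sqrt y) / (x + sqrt y) with imaginary part in (-pi, pi] yields a time t. If
    that part is at most 0, t lies in the strip of D, otherwise in that of U; the margin
    [ckap K > 0] admits the end pi. *)
Lemma strips_cover x : cabs x < crad K -> x ^+ 2 != rt%:C ^+ 2 ->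
  Omega_D K wpos x \/ Omega_U K wpos x.
Proof.
move=> xr; rewrite -subr_eq0 subr_sqr mulf_eq0 negb_or => /andP[xm xp].
have p0 := pi_gt0 R; have r0 := rt_gt0.
have z0 : (x - rt%:C) / (x + rt%:C) != 0 by rewrite mulf_neq0 ?invr_eq0.
have [z /andP[zl zu] zE] := cexp_surj z0.
have r2 : 2 * rt%:C != 0 :> R[i] by rewrite mulf_neq0 ?pnatr_eq0.
pose t := z / (2 * rt%:C).
have tz : 2 * rt%:C * t = z by rewrite /t mulrC divfK.
have [z1 xt] : zt t != 1 /\ xtime wpos t = x by apply: xtime_zt; rewrite // /zt tz.
have It : 2 * rt * Im t = Im z by rewrite -Im_zt tz.
have rr : 0 < 2 * rt by rewrite mulr_gt0.
case: (leP (Im z) 0) => zs; [left|right]; exists t => //.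
  apply: Gamma_D_intro; rewrite ?xt //; apply/andP; split.
    by rewrite -(ltr_pM2l rr) It /lo mulrN mulrCA rtpi; move: kp kpr pr0 => /andP[k1 k2] /andP[k3 k4] k5; lra.
  by rewrite -(ltr_pM2l rr) It; have : 0 < 2 * rt * ch K; [rewrite mulr_gt0|lra].
apply: Gamma_U_intro; rewrite ?xt //; apply/andP; split.
  by rewrite -(ltr_pM2l rr) It; have : 0 < 2 * rt * ch K; [rewrite mulr_gt0|lra].
by rewrite -(ltr_pM2l rr) It /hi mulrCA rtpi; move: kp kpr pr0 => /andP[k1 k2] /andP[k3 k4] k5; lra.
Qed.

End PositiveEpsilon.

Lemma analytic2_at_la (R : realType) (f : R[i] -> R[i] -> R[i]) a b :
  analytic2_at f a b -> la (f a) b.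
Proof.
move=> [c [s [M [s0 cM fc]]]].
have /analytic2_at_ds[c' [s' /ds_rows[s'0 _ H]]] :
    analytic2_at (fun e x => f (a + e) (b + x)) 0 0.
  exists c, s, M; split=> // e x; rewrite !subr0 => es xs.
  have := fc (a + e) (b + x); rewrite ![_ + _ - _]addrC !addKr; exact.
have [|g _ gp] := H 0; first by rewrite cabs0.
by exists g, s'; move: gp; rewrite addr0.
Qed.

(** * One horizontal strip of times and its image in the x-plane *)

Section Strip.
Variables (R : realType) (n : nat) (Y : ode_family R n) (j : 'I_n).
Variables (K : constants R) (y : R).
Hypotheses (y0 : 0 < y).
Let w : R[i] := wpos y.
Let q : R[i] := (rt y)%:C.
Hypothesis wK : csector K w.
Variables (G : R[i] -> set R[i]) (lo hi : R).
Hypothesis GE : forall t, G w t -> zt y t != 1 /\ lo < Im t < hi.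
Hypothesis GI : forall t, zt y t != 1 -> cabs (xtime w t) < crad K ->
  lo < Im t < hi -> G w t.
Variable l : R[i] -> R[i] -> R[i].
Hypothesis lb : log_branch K G l.
Variables (F H : R[i] -> R[i] -> 'M[R[i]]_n) (kL kR : R[i] -> 'rV[R[i]]_n).
Hypothesis FE : forall t, G w t -> F w (xtime w t) = model_sol Y l w t.
Let Om : R[i] -> set R[i] := fun v => xtime v @` G v.
Hypothesis sc : sectorial_conjugation Y K Om F H kL kR.

Let r0 : 0 < rt y := rt_gt0 y0.
Let q0 : q != 0.
Proof. by rewrite -cabs_gt0 cabsR gtr0_norm. Qed.

(** A point x near x(t0) is reached from t0 by adding a multiple of a small logarithm of the
    quotient of the two values of [zt], small enough to remain in the strip. *)
Lemma strip_image_open t0 (e : R) : G w t0 -> cabs (xtime w t0) < crad K -> 0 < e ->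
  exists2 r : R, 0 < r & forall x, cabs (x - xtime w t0) < r ->
    cabs x < crad K /\ exists t, [/\ G w t, xtime w t = x & cabs (t - t0) < e].
Proof.
move=> Gt0 xr e0; have [z1 /andP[tl th]] := GE Gt0.
have [_ xp] := xtimeB y0 z1; set x0 := xtime w t0 in xr xp *.
pose m := Num.min e (Num.min (Im t0 - lo) (hi - Im t0)).
have m0 : 0 < m by rewrite !lt_min e0 !subr_gt0 tl.
have [r1 r10 Hr1] := @cexp_local R (2 * rt y * m) (mulr_gt0 (mulr_gt0 (ltr0Sn _ 1) r0) m0).
have cp : cts (fun x => x + q) x0 by apply: ctsD; [apply: cts_id|apply: cts_cst].
have cZ : cts (fun x => (x - q) * (x + q)^-1 * (zt y t0)^-1) x0.
  apply: ctsM; last exact: cts_cst.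
  by apply: ctsM; [apply: cts_subc; apply: cts_id|apply: cts_inv].
have [r2 r20 Hr2] := cZ _ r10; have [r3 r30 Hr3] := cts_neq0 cp xp.
have Z1 : (x0 - q) * (x0 + q)^-1 * (zt y t0)^-1 = 1.
  by rewrite -(zt_xtime y0 z1) divff // zt_neq0.
exists (Num.min (crad K - cabs x0) (Num.min r2 r3)).
  by rewrite !lt_min subr_gt0 xr r20.
move=> x; rewrite !lt_min => /and3P[x1 /Hr2 x2 /Hr3 x3]; rewrite Z1 in x2.
have xK : cabs x < crad K.
  by have := cabsD (x - x0) x0; rewrite subrK; move: x1; lra.
split=> //; have [z zm zE] := Hr1 _ x2.
have tq : 2 * q != 0 by rewrite mulf_neq0 ?pnatr_eq0.
have [] := @xtime_zt R y y0 x (t0 + z / (2 * q)) x3.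
  rewrite /zt mulrDr cexpD -/(zt y t0) [2 * q * (_ / _)]mulrC divfK // zE.
  by rewrite mulrC divfK // zt_neq0.
move=> zt1 xE; exists (t0 + z / (2 * q)).
have tm : cabs (z / (2 * q)) < m.
  rewrite cabsM cabsV ltr_pdivrMr ?cabs_gt0 // mulrC cabsM cabs_nat cabsR gtr0_norm //.
have tI := cabs_Im (z / (2 * q)).
move: tm; rewrite !lt_min => /and3P[te tm1 tm2].
split=> //; last by rewrite addrC addKr.
apply: GI => //; first by rewrite xE.
rewrite raddfD /=; move: (le_lt_trans tI tm1) (le_lt_trans tI tm2).
by rewrite !ltr_norml => /andP[? ?] /andP[? ?]; apply/andP; split; lra.
Qed.

Lemma strip_open t0 : G w t0 -> cabs (xtime w t0) < crad K ->
  exists2 r : R, 0 < r & forall t, cabs (t - t0) < r -> G w t.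
Proof.
move=> Gt0 xr; have [z1 /andP[tl th]] := GE Gt0.
have cx := cara_cts (xtime_cara y0 z1).
have cz : cts (fun t => zt y t - 1) t0 by apply: cts_subc; apply: cara_cts (zt_cara _ _).
have [|r1 r10 Hr1] := cts_neq0 cz; first by rewrite subr_eq0.
have [|r2 r20 Hr2] := cx (crad K - cabs (xtime w t0)); first by rewrite subr_gt0.
exists (Num.min (Num.min r1 r2) (Num.min (Im t0 - lo) (hi - Im t0))).
  by rewrite !lt_min r10 r20 !subr_gt0 tl.
move=> t; rewrite !lt_min => /andP[/andP[/Hr1 t1 /Hr2 t2] /andP[t3 t4]].
apply: GI.
- by rewrite -subr_eq0.
- by have := cabsD (xtime w t - xtime w t0) (xtime w t0); rewrite subrK; move: t2; lra.
have := cabs_Im (t - t0); rewrite raddfB /= => tI.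
move: (le_lt_trans tI t3) (le_lt_trans tI t4).
by rewrite !ltr_norml => /andP[? ?] /andP[? ?]; apply/andP; split; lra.
Qed.

Lemma strip_la x0 i k : Om w x0 -> la (fun x => H w x i k) x0.
Proof. by move=> Ox; apply: (@analytic2_at_la _ (fun v x => H v x i k)); apply: (sc_analytic sc). Qed.

(** Differentiating exp l = x^2 - y along x' = x^2 - y gives l' = 2 x x' / (x^2 - y) = 2 x. *)
Lemma strip_log t0 : G w t0 -> cabs (xtime w t0) < crad K ->
  cara (l w) t0 (2 * xtime w t0).
Proof.
move=> Gt0 xr; have [z1 _] := GE Gt0.
have [r rp Hr] := strip_open Gt0 xr; have [lE lc] := lb.
have cl : cts (l w) t0.
  move=> e e0.
  have P0 : [set p : R[i] * R[i] | csector K p.1 /\ G p.1 p.2] (w, t0) by [].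
  have /cvgrPdist_lt/(_ e%:C) := (subspace_continuousP _ _).1 lc _ P0.
  rewrite ltcR => /(_ e0) [[A B] /= [nA nB] AB].
  have [d d0 Hd] := (nbhs_cabs _ _).1 nB.
  exists (Num.min r d); first by rewrite lt_min rp.
  move=> t; rewrite lt_min => /andP[/Hr Gt /Hd Bt].
  have := AB (w, t) (conj (nbhs_singleton nA) Bt) (conj wK Gt).
  by rewrite /= distrC ltcabs.
have [xm xp] := xtimeB y0 z1.
have xy : xtime w t0 ^+ 2 - y%:C != 0.
  by rewrite -(rt_sqr y0) rmorphXn subr_sqr mulf_neq0.
have cE : cara cexp (l w t0) (xtime w t0 ^+ 2 - y%:C).
  by rewrite -[y%:C](eps_wpos y0) -lE //; apply: cexp_cara.
have xc := xtime_cara y0 z1.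
have := cara_preimage rp _ cl cE xy (caraD (caraM xc xc) (cara_cst (- y%:C) t0)).
have -> : ((xtime w t0 ^+ 2 - y%:C) * xtime w t0 + xtime w t0 * (xtime w t0 ^+ 2 - y%:C) + 0) /
    (xtime w t0 ^+ 2 - y%:C) = 2 * xtime w t0 by field.
by apply=> t /Hr Gt; rewrite lE // eps_wpos.
Qed.

(** F is diagonal, so the j-th column of H F is that of H times a scalar E with dE/dt = lambda_j E.
    Computing the t-derivative of this column in two ways, from the family and by the product rule,
    and cancelling E gives the shifted system. *)
Lemma strip_ode x0 : Om w x0 -> cabs x0 < crad K -> forall i,
  shifted_ode Y j y%:C (fun i x => H w x i j) x0 i.
Proof.
move=> Ox0 xr0 i; have [t0 Gt0 xE] := Ox0.
have xr : cabs (xtime w t0) < crad K by rewrite xE.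
have [z1 _] := GE Gt0; have [r rp Hr] := strip_open Gt0 xr.
pose a := lam0 Y y%:C 0 j; pose b := lam1 Y y%:C 0 j.
pose E t := cexp (t * a + b / 2%:R * l w t).
have cE : cara E t0 (lam Y y%:C x0 0 j * E t0).
  have c1 : cara (fun t => t * a + b / 2%:R * l w t) t0 (a + b * x0).
    have := caraD (caraZ a (cara_id t0)) (caraZ (b / 2%:R) (strip_log Gt0 xr)).
    have -> : a * 1 + b / 2 * (2 * xtime w t0) = a + b * x0 by rewrite xE; field.
    by apply: (cara_ext rp) => t _; rewrite (mulrC a).
  have -> : lam Y y%:C x0 0 j = a + b * x0 by rewrite /lam !mxE mulrC.
  by rewrite [_ * E t0]mulrC; exact: cara_comp c1 (cexp_cara _).
have WE t : G w t -> forall k, (H w (xtime w t) *m F w (xtime w t)) k j = H w (xtime w t) k j * E t.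
  by move=> Gt k; rewrite FE // /model_sol mul_mx_diag !mxE eps_wpos.
have [_ Wd WO] := sc_fundamental sc wK Ox0.
have [d cd] := la_cara (strip_la i j Ox0).
exists d; split; first exact/cara_is_derive.
have E0 : E t0 != 0 by exact: cexp_neq0.
apply: (mulIf E0); rewrite mulr_suml.
have wy : eps w = y%:C by exact: eps_wpos.
have := congr1 (fun M : 'M[R[i]]_n => M i j) WO; rewrite wy mxE.
set D := derive _ _ _ => WO'.
have cD : cara (fun x => (H w x *m F w x) i j) x0 (D i j).
  by apply/cara_is_derive; move/is_derive_mx: (DeriveDef Wd erefl); apply.
have xc : cara (xtime w) t0 (x0 ^+ 2 - y%:C) by rewrite -xE; apply: xtime_cara.
rewrite -xE in cD cd.
have h1 := cara_comp xc cD; have h2 := caraM (cara_comp xc cd) cE.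
have h3 := cara_ext rp (fun t tr => WE t (Hr t tr) i) h1.
have := cara_unique h3 h2; rewrite mulrC WO' => h4.
have -> : \sum_k shifted Y j y%:C x0 i k * H w x0 k j * E t0 =
    \sum_k sysmx Y y%:C x0 i k * (H w x0 k j * E t0) - lam Y y%:C x0 0 j * (H w x0 i j * E t0).
  rewrite [X in _ = _ - X](_ : _ = \sum_k (lam Y y%:C x0 0 j *+ (i == k)) * (H w x0 k j * E t0)).
    by rewrite -sumrB; apply: eq_bigr => k _; rewrite -mulrBl mulrA.
  rewrite (bigD1 i) //= eqxx mulr1n big1 ?addr0 // => k /negPf ki.
  by rewrite eq_sym ki mulr0n mul0r.
have -> : \sum_k sysmx Y y%:C x0 i k * (H w x0 k j * E t0) =
   (sysmx Y y%:C x0 *m (H w x0 *m F w x0)) i j.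
  by rewrite mxE; apply: eq_bigr => k _; rewrite -xE WE.
rewrite h4 xE; ring.
Qed.

End Strip.

(** * Gluing the columns *)

Section Gluing.
Variables (R : realType) (n : nat) (Y : ode_family R n) (j : 'I_n).
Implicit Types (f g v : 'I_n -> R[i] -> R[i]) (x q e : R[i]) (A B : set R[i]).

Lemma shifted_ode_ext e f v x (r : R) : 0 < r ->
  (forall x' i, cabs (x' - x) < r -> f i x' = v i x') ->
  (forall i, shifted_ode Y j e f x i) -> forall i, shifted_ode Y j e v x i.
Proof.
move=> r0 fv H i; have [d [fd E]] := H i; exists d; split.
  by apply/cara_is_derive/(cara_ext r0 (fun x' => fv x' i)); apply/cara_is_derive.
by rewrite E; apply: eq_bigr => l _; rewrite fv // subrr cabs0.
Qed.

Lemma common_radius (P : 'I_n -> R -> Prop) :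
  (forall i r s, P i r -> 0 < s <= r -> P i s) ->
  (forall i, exists2 r, 0 < r & P i r) ->
  exists2 r, 0 < r & forall i, P i r.
Proof.
move=> Pw PE; have /choice[d Hd] i : exists d, 0 < d /\ P i d.
  by have [d] := PE i; exists d.
exists (\big[Order.min/1]_i d i).
  by apply: lt_bigmin => // i _; have [] := Hd i.
move=> i; have [d0 Pd] := Hd i; apply: (Pw _ _ _ Pd).
rewrite bigmin_le_cond // andbT; apply: lt_bigmin => // k _.
by have [] := Hd k.
Qed.

(** What either domain contributes to the gluing: [A] is the domain, [f] the j-th column of H on it,
    [kp] and [km] the limits of that column at q and -q. *)
Definition piece e (r : R) q A f (kp km : 'I_n -> R[i]) :=
  [/\ forall x, A x -> x ^+ 2 != q ^+ 2,
      forall x, A x -> cabs x < r ->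
        exists2 d : R, 0 < d & forall x', cabs (x' - x) < d -> A x',
      forall x, A x -> cabs x < r -> forall i,
        la (f i) x /\ shifted_ode Y j e f x i,
      A 0 -> exists i, f i 0 != 0
    & forall i (s : R), 0 < s -> exists2 d : R, 0 < d & forall x, A x ->
        (cabs (x - q) < d -> cabs (f i x - kp i) < s) /\
        (cabs (x + q) < d -> cabs (f i x - km i) < s)].

(** The two columns agree on the intersection and share their limits at q and -q. Together they form
    functions continuous on the whole disc, to which the Cauchy estimates apply. *)
Lemma pieces_entire_data e (r : R) q A B f g kp km : 0 < r -> q != 0 ->
  piece e r q A f kp km -> piece e r q B g kp km ->
  (forall x, cabs x < r -> x ^+ 2 != q ^+ 2 -> A x \/ B x) ->
  (forall x, cabs x < r -> A x -> B x -> forall i, f i x = g i x) ->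
  entire_data Y j r e.
Proof.
move=> r0 q0 [Aq Ao Ar A0 Al] [Bq Bo Br B0 Bl] cover fg.
pose v i x := if x == q then kp i else if x == - q then km i
   else if pselect (A x) then f i x else g i x.
have vA x i : A x -> v i x = f i x.
  move=> Ax; have := Aq _ Ax; rewrite eqf_sqr negb_or => /andP[/negPf h1 /negPf h2].
  by rewrite /v h1 h2; case: pselect.
have vB x i : cabs x < r -> B x -> v i x = g i x.
  move=> xr Bx; have := Bq _ Bx; rewrite eqf_sqr negb_or => /andP[/negPf h1 /negPf h2].
  by rewrite /v h1 h2; case: pselect => // Ax; apply: fg.
have near_ext x : cabs x < r -> x ^+ 2 != q ^+ 2 -> exists2 d : R, 0 < d &
    (A x /\ forall x' i, cabs (x' - x) < d -> f i x' = v i x') \/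
    (B x /\ forall x' i, cabs (x' - x) < d -> g i x' = v i x').
  move=> xr xq; have [Ax|Bx] := cover _ xr xq.
    have [d d0 Hd] := Ao _ Ax xr; exists d => //; left; split=> // x' i /Hd Ax'.
    by rewrite vA.
  (* The agreement of f and g is known only inside the disc, hence the second bound. *)
  have [d d0 Hd] := Bo _ Bx xr; exists (Num.min d (r - cabs x)).
    by rewrite lt_min d0 subr_gt0.
  right; split=> // x' i; rewrite lt_min => /andP[/Hd Bx' xx'].
  by rewrite vB //; have := cabsD (x' - x) x; rewrite subrK; move: xx'; lra.
have vla i x : cabs x < r -> x ^+ 2 != q ^+ 2 -> la (v i) x.
  move=> xr xq; have [d d0 [[Ax E]|[Bx E]]] := near_ext _ xr xq.
    by apply: (la_ext d0 (fun x' => E x' i)); have [] := Ar _ Ax xr i.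
  by apply: (la_ext d0 (fun x' => E x' i)); have [] := Br _ Bx xr i.
have vode x : cabs x < r -> x ^+ 2 != q ^+ 2 -> forall i, shifted_ode Y j e v x i.
  move=> xr xq; have [d d0 [[Ax E]|[Bx E]]] := near_ext _ xr xq.
    by apply: (shifted_ode_ext d0 E) => i; have [] := Ar _ Ax xr i.
  by apply: (shifted_ode_ext d0 E) => i; have [] := Br _ Bx xr i.
have qN : q != - q by rewrite -subr_eq0 opprK -mulr2n -mulr_natl mulf_neq0 ?pnatr_eq0.
have q2 : 0 < cabs (q - - q) by rewrite cabs_gt0 subr_eq0.
have vcts i x : cabs x < r -> cts (v i) x.
  move=> xr; have [/eqP|xq] := eqVneq (x ^+ 2) (q ^+ 2); last exact: la_cts (vla _ _ xr xq).
  rewrite eqf_sqr => xq s s0.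
  have [d1 d10 H1] := Al i _ s0; have [d2 d20 H2] := Bl i _ s0.
  (* The bound by |q - (-q)| keeps x' away from the other exceptional point. *)
  exists (Num.min (Num.min d1 d2) (Num.min (cabs (q - - q)) (r - cabs x))).
    by rewrite !lt_min d10 d20 q2 subr_gt0.
  move=> x'; rewrite !lt_min => /andP[/andP[x1 x2] /andP[xqq x3]].
  have [->|xx'] := eqVneq x' x; first by rewrite subrr cabs0.
  have x'r : cabs x' < r.
    by have := cabsD (x' - x) x; rewrite subrK; move: x3; lra.
  have x'q : x' ^+ 2 != q ^+ 2.
    rewrite eqf_sqr; apply/norP; case/orP: xq xqq xx' => /eqP-> xqq xx'; split=> //.
      by apply: contraTneq xqq => ->; rewrite -cabsN opprB ltxx.
    by apply: contraTneq xqq => ->; rewrite ltxx.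
  have vx : v i x = if x == q then kp i else km i.
    by rewrite /v; case: ifP xq => //= _ ->.
  rewrite vx; have [Ax|Bx] := cover _ x'r x'q.
    rewrite vA //; have [h1 h2] := H1 _ Ax.
    case/orP: xq x1 => /eqP-> x1; first by rewrite eqxx h1.
    by rewrite eq_sym (negPf qN) h2 // -[q]opprK.
  rewrite vB //; have [h1 h2] := H2 _ Bx.
  case/orP: xq x2 => /eqP-> x2; first by rewrite eqxx h1.
  by rewrite eq_sym (negPf qN) h2 // -[q]opprK.
have z0 : cabs 0 < r by rewrite cabs0.
have zq : 0 ^+ 2 != q ^+ 2 by rewrite expr0n /= eq_sym expf_neq0.
have /choice[d Hd] i : exists d : nat -> R[i], exists s, ps (v i) d s.
  have [d [s ds]] := vla i _ z0 zq; exists d, s.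
  by apply: ps_ext ds => x _; rewrite add0r.
have [s s0 Hs] : exists2 s : R, 0 < s & forall i, ps (v i) (d i) s.
  apply: (@common_radius (fun i s => ps (v i) (d i) s)) => [i r1 s1 p /andP[? ?]|i].
    by apply: ps_weaken p _; apply/andP.
  by have [s p] := Hd i; have [s0 _ _] := p; exists s.
have /choice[B' HB] i := cauchy_bound r0 q0 (conj (vla i) (vcts i)) (Hs i).
have [m m0 Hm] : exists2 m : R, 0 < m & forall x, cabs x < m -> cabs x < r /\ x ^+ 2 != q ^+ 2.
  exists (Num.min r (cabs q)); first by rewrite lt_min r0 cabs_gt0.
  move=> x; rewrite lt_min => /andP[xr xq]; split=> //.
  by apply: contraTneq xq => E; rewrite -leNgt -(@ler_pXn2r _ 2) ?nnegrE ?cabs_ge0 // -!cabsX E.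
exists v, d, (Num.min s m), (\sum_i `|B' i|); split.
- by move=> i; apply: ps_weaken (Hs i) _; rewrite lt_min s0 m0 ge_min lexx.
- move=> i k; apply: le_trans (HB i k) _; rewrite ler_wpM2r ?exprn_ge0 ?divr_ge0 ?(ltW r0) //.
  apply: le_trans (ler_norm _) _; rewrite (bigD1 i) //= lerDl.
  by apply: sumr_ge0 => ? _.
- have [Ax|Bx] := cover _ z0 zq.
    by have [i fi] := A0 Ax; exists i; rewrite vA.
  by have [i gi] := B0 Bx; exists i; rewrite vB.
by move=> x; rewrite lt_min => /andP[_ /Hm[xr xq]]; apply: vode.
Qed.

End Gluing.

Lemma norm_sin_le (R : realType) (u : R) : `|sin u| <= `|u|.
Proof.
wlog u0 : u / 0 < u.
  move=> H; have [u0|u0|->] := ltgtP u 0; last by rewrite sin0.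
    by rewrite -normrN -sinN -[X in _ <= X]normrN; apply: H; rewrite oppr_gt0.
  exact: H.
have [|c _] := @MVT R sin cos 0 u u0 (fun x _ => is_derive_sin x).
  by apply: continuous_subspaceT => x; exact: continuous_sin.
rewrite sin0 !subr0 => ->; rewrite normrM ler_piMl //.
by rewrite ler_norml cos_geN1 cos_le1.
Qed.

(** Conjugation by a diagonal matrix preserves a trivial j-th column, so the j-th column of A^-1 B
    is e_j. *)
Lemma unipotent_col (R : realType) n (j : 'I_n) (A B C F : 'M[R[i]]_n) (f : 'rV[R[i]]_n) :
  A \in unitmx -> F \in unitmx -> F = diag_mx f ->
  invmx A *m B = F *m C *m invmx F -> col j C = col j 1%:M ->
  forall i, A i j = B i j.
Proof.
move=> uA uF FE ABC Cj i.
have E : B *m F = A *m F *m C.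
  by rewrite -(mulKVmx uA B) ABC -!mulmxA mulVmx // mulmx1.
have fj : f 0 j != 0.
  by move: uF; rewrite FE unitmxE det_diag unitfE => /prodf_neq0; apply.
apply: (mulIf fj); have := congr1 (fun M : 'M[R[i]]_n => M i j) E.
rewrite FE mul_mx_diag mxE => ->; rewrite -mulmxA.
rewrite mxE (bigD1 j) //= mul_diag_mx mxE.
have CE k : C k j = (k == j)%:R.
  by have := congr1 (fun M : 'cV[R[i]]_n => M k 0) Cj; rewrite !mxE.
rewrite CE eqxx mulr1 big1 ?addr0 // => k /negPf kj.
by rewrite mxE CE kj !mulr0.
Qed.

Lemma unitmx_col_neq0 (R : realType) n (j : 'I_n) (A : 'M[R[i]]_n) :
  A \in unitmx -> exists i, A i j != 0.
Proof.
move=> uA; apply/existsP; apply: contraT; rewrite negb_exists => /forallP A0.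
have /(congr1 (fun M : 'M[R[i]]_n => M j j)) := mulVmx uA.
rewrite !mxE eqxx big1 => [/eqP|k _]; first by rewrite eq_sym oner_eq0.
by have := A0 k; rewrite negbK => /eqP ->; rewrite mulr0.
Qed.

(** * Overlaps of the two domains and the final assembly *)

Section Overlap.
Variable R : realType.
Variables (K : constants R) (y : R).
Hypotheses (y0 : 0 < y) (kap0 : 0 < ckap K) (kap1 : ckap K < 2^-1).
Hypotheses (h0 : 0 < ch K) (rth : 2 * (rt y * ch K) < pi).
Hypotheses (r0 : 0 < crad K) (rh : (crad K ^+ 2 + y) * ch K ^+ 2 < 1).
Let w : R[i] := wpos y.

(** For t = i b one has |x|^2 = y cot^2(sqrt(y) b) >= 1/b^2 - y, since sin^2 u <= u^2, and (r^2 + y)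
    h^2 < 1 makes this larger than r^2. So inside the disc the sign of Re t separates the right and
    left components. *)
Lemma axis_far t : Re t = 0 -> zt y t != 1 -> - ch K < Im t < ch K ->
  crad K <= cabs (xtime w t).
Proof.
case: t => a b /= -> {a}; set t := _ +i* b => z1 bh; rewrite leNgt; apply/negP => xr.
have rt0 := rt_gt0 y0; pose s := sin (rt y * b).
have zE : zt y t = (1 - 2 * s ^+ 2) +i* (2 * s * cos (rt y * b)).
  rewrite /zt cexpE Im_zt.
  have -> : Re (2 * (rt y)%:C * t) = 0.
    by rewrite /t -[2%:R]/(2%:R : R[i]) -(rmorph_nat (real_complex R) 2); simpc.
  rewrite /t /=.
  have -> : 2 * rt y * b = (rt y * b) *+ 2 by rewrite -[RHS]mulr_natl mulrA.
  rewrite expR0 !mul1r cos_mulr2n sin_mulr2n /s.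
  have := cos2Dsin2 (rt y * b); move: (cos _) (sin _) => c u E.
  by congr (_ +i* _); [rewrite -[_ *+ 2]mulr_natl; lra | ring].
have cs := cos2Dsin2 (rt y * b); rewrite -/s in cs.
have d : 1 - zt y t != 0 by rewrite subr_eq0 eq_sym.
have E : cabs (xtime w t) ^+ 2 * (4 * s ^+ 2) = y * (4 * (1 - s ^+ 2)).
  have m2 : cabs (1 - zt y t) ^+ 2 = 4 * s ^+ 2.
    rewrite cabs_sqr zE /=; move: (cos _) cs => c cs.
    have -> : (0 - 2 * s * c) ^+ 2 = 4 * s ^+ 2 * c ^+ 2 by ring.
    have -> : c ^+ 2 = 1 - s ^+ 2 by rewrite -cs addrK.
    ring.
  have p2 : cabs (1 + zt y t) ^+ 2 = 4 * (1 - s ^+ 2).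
    rewrite cabs_sqr zE /=; move: (cos _) cs => c cs.
    have -> : (0 + 2 * s * c) ^+ 2 = 4 * s ^+ 2 * c ^+ 2 by ring.
    have -> : c ^+ 2 = 1 - s ^+ 2 by rewrite -cs addrK.
    ring.
  rewrite -m2 -p2 -exprMn -cabsM /w xtimeE // divfK // cabsM exprMn cabsR.
  by rewrite gtr0_norm // rt_sqr.
have sb : s ^+ 2 <= y * b ^+ 2.
  rewrite -(rt_sqr y0) -exprMn -[s ^+ 2]real_normK ?num_real // -[X in _ <= X]real_normK ?num_real //.
  by rewrite lerXn2r ?nnegrE // norm_sin_le.
have bh2 : b ^+ 2 < ch K ^+ 2.
  rewrite -[b ^+ 2]real_normK ?num_real // ltrXn2r ?nnegrE ?(ltW h0) //.
  by rewrite ltr_norml.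
have xr2 : cabs (xtime w t) ^+ 2 <= crad K ^+ 2.
  by rewrite lerXn2r ?nnegrE ?cabs_ge0 ?(ltW r0) ?(ltW xr).
have s0 : 0 <= s ^+ 2 by rewrite sqr_ge0.
have k1 : y * (1 - s ^+ 2) <= crad K ^+ 2 * s ^+ 2.
  have : cabs (xtime w t) ^+ 2 * s ^+ 2 <= crad K ^+ 2 * s ^+ 2 by rewrite ler_wpM2r.
  by move: E; lra.
have Rp : 0 <= crad K ^+ 2 + y by rewrite addr_ge0 ?sqr_ge0 ?(ltW y0).
have k2 : y <= (crad K ^+ 2 + y) * (y * b ^+ 2).
  by apply: le_trans (ler_wpM2l Rp sb); move: k1; lra.
have k3 : y * ((crad K ^+ 2 + y) * b ^+ 2) <= y * ((crad K ^+ 2 + y) * ch K ^+ 2).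
  by rewrite ler_pM2l // ler_wpM2l // ltW.
have k4 : y * ((crad K ^+ 2 + y) * ch K ^+ 2) < y * 1 by rewrite ltr_pM2l.
by move: k2 k3 k4; rewrite mulrCA; lra.
Qed.

(** Two times of the same x, one in each strip, coincide or differ by the period. In the first case
    Re t <> 0 places x in the left or right component, in the second x lies in [Omega_C]. *)
Lemma overlap x : cabs x < crad K -> Omega_D K w x -> Omega_U K w x ->
  [\/ Omega_L K w x, Omega_R K w x | Omega_C K w x].
Proof.
move=> xr [t1 D1 E1] [t2 U2 E2]; have rt0 := rt_gt0 y0; have p0 := pi_gt0 R.
have [z1 /andP[l1 u1]] := Gamma_D_wpos y0 kap0 kap1 rth D1.
have [z2 /andP[l2 u2]] := Gamma_U_wpos y0 kap0 kap1 rth U2.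
have q2 : 2 * (rt y)%:C != 0 :> R[i].
  by rewrite mulf_neq0 ?pnatr_eq0 // -cabs_gt0 cabsR gtr0_norm.
have rtpi : 2 * rt y * (pi / rt y) = 2 * pi.
  by rewrite -mulrA [rt y * _]mulrC divfK // gt_eqF.
have zz : cexp (2 * (rt y)%:C * (t1 - t2)) = 1.
  rewrite mulrBr cexpD cexpN -/(zt y t1) -/(zt y t2) zt_xtime // zt_xtime // -/w E1 E2 divff //.
  by rewrite -E1 /w -zt_xtime // zt_neq0.
have [||] := cexp_eq1 zz.
- rewrite Im_zt raddfB /=.
  have kp : ckap K * pi < 2^-1 * pi by rewrite ltr_pM2r.
  have a1 : 2 * rt y * (- ((2^-1 + ckap K) * (pi / rt y))) < 2 * rt y * Im t1.
    by rewrite ltr_pM2l ?mulr_gt0.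
  have a2 : 2 * rt y * Im t1 < 2 * rt y * ch K by rewrite ltr_pM2l ?mulr_gt0.
  have a3 : 2 * rt y * (- ch K) < 2 * rt y * Im t2 by rewrite ltr_pM2l ?mulr_gt0.
  have a4 : 2 * rt y * Im t2 < 2 * rt y * ((2^-1 + ckap K) * (pi / rt y)).
    by rewrite ltr_pM2l ?mulr_gt0.
  move: a1 a4; rewrite mulrN [2 * rt y * ((2^-1 + _) * _)]mulrCA rtpi => a1 a4.
  by apply/andP; split; move: rth; lra.
- move/eqP; rewrite mulf_eq0 (negPf q2) subr_eq0 => /eqP t12.
  have [tn|tp|t00] := ltgtP (Re t1) 0.
  + by apply: Or32; exists t1 => //; split=> //; rewrite t12.
  + by apply: Or31; exists t1 => //; split=> //; rewrite t12.
  have := axis_far t00 z1; rewrite -/w E1 leNgt xr => /(_ _)/negP[] //.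
  by rewrite u1 t12 l2.
move=> tE; apply: Or33; exists t1 => //; split=> //; rewrite /w period_wpos //.
suff -> : t1 + (pi / rt y) *i = t2 by [].
apply: (mulfI q2); rewrite mulrDr.
have -> : 2 * (rt y)%:C * (pi / rt y)*i = (2 * pi)*i :> R[i].
  rewrite -(rmorph_nat (real_complex R) 2); simpc.
  by rewrite -rtpi mulrA.
have -> : 2 * (rt y)%:C * t1 = 2 * (rt y)%:C * (t1 - t2) + 2 * (rt y)%:C * t2 by ring.
rewrite tE addrAC; have -> : (- (2 * pi))*i + (2 * pi)*i = 0 :> R[i].
  by simpc; rewrite addNr.
by rewrite add0r.
Qed.

End Overlap.

(** On this sheet arg sqrt(eps) = pi, so xR = q and xL = -q: the limit at q comes from [kR] and the
    limit at -q from [kL]. *)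
Lemma sectorial_piece (R : realType) n (Y : ode_family R n) (j : 'I_n)
    (K : constants R) (y lo hi : R) (G : R[i] -> set R[i])
    (l : R[i] -> R[i] -> R[i]) (F H : R[i] -> R[i] -> 'M[R[i]]_n)
    (kL kR : R[i] -> 'rV[R[i]]_n) :
  let w := wpos y in let q := (rt y)%:C in
  0 < y -> csector K w ->
  (forall t, G w t -> zt y t != 1 /\ lo < Im t < hi) ->
  (forall t, zt y t != 1 -> cabs (xtime w t) < crad K -> lo < Im t < hi -> G w t) ->
  log_branch K G l ->
  (forall t, G w t -> F w (xtime w t) = model_sol Y l w t) ->
  sectorial_conjugation Y K (fun w => xtime w @` G w) F H kL kR ->
  piece Y j y%:C (crad K) q (xtime w @` G w) (fun i x => H w x i j)
    (fun i => diag_mx (kR w) i j) (fun i => diag_mx (kL w) i j).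
Proof.
move=> w q y0 wK GE GI lb FE sc; split.
- move=> _ [t /GE[/(xtimeB y0)[xm xp] _] <-].
  by rewrite -subr_eq0 subr_sqr mulf_neq0.
- move=> _ [t Gt <-] xr; have [r r0 Hr] := strip_image_open y0 GE GI Gt xr ltr01.
  by exists r => // x /Hr[_ [t' [Gt' <- _]]]; exists t'.
- move=> x Gx xr i; split; first exact: (strip_la wK sc i j Gx).
  exact: (strip_ode j y0 wK GE GI lb FE sc Gx xr).
- move=> /(sc_fundamental sc wK)[u _ _].
  by apply: unitmx_col_neq0; move: u; rewrite unitmx_mul => /andP[].
have qR : xR w = q by exact: xR_wpos.
have qL : xL w = - q by exact: xL_wpos.
have lim (k : R[i] -> 'rV[R[i]]_n) p : H w x @[x --> within (xtime w @` G w) (nbhs p)] --> diag_mx (k w) ->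
    forall i (s : R), 0 < s -> exists2 d : R, 0 < d & forall x, (xtime w @` G w) x ->
      cabs (x - p) < d -> cabs (H w x i j - diag_mx (k w) i j) < s.
  move=> Hk i s s0.
  have /cvgrPdist_lt/(_ s%:C) : H w x i j @[x --> within (xtime w @` G w) (nbhs p)] --> diag_mx (k w) i j.
    exact: (cvg_comp _ _ Hk (@coord_continuous _ n n i j _)).
  rewrite ltcR => /(_ s0) /nbhs_cabs[d d0 Hd]; exists d => // x Gx xp.
  by have := Hd x xp Gx; rewrite distrC ltcabs.
move=> i s s0; have [d1 d10 H1] := lim _ _ (sc_limR sc wK) i s s0.
have [d2 d20 H2] := lim _ _ (sc_limL sc wK) i s s0.
exists (Num.min d1 d2); first by rewrite lt_min d10.
move=> x Gx; rewrite lt_min; split=> [/andP[xd _]|].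
  by apply: H1; rewrite // qR.
by rewrite lt_min => /andP[_ xd]; apply: H2; rewrite // qL opprK.
Qed.

Lemma unfolded_stokes_entire_data (R : realType) n (Y : ode_family R n) (j : 'I_n)
    (K : constants R) (C_R C_L : R[i] -> 'M[R[i]]_n) (y : R) :
  0 < y -> y < crho K -> 0 < cgam K -> 0 < ckap K -> ckap K < 2^-1 ->
  0 < ch K -> 2 * (rt y * ch K) < pi -> 0 < crad K ->
  (crad K ^+ 2 + y) * ch K ^+ 2 < 1 ->
  unfolded_stokes Y K C_R C_L ->
  (forall w, csector K w ->
     col j (C_R w) = col j 1%:M /\ col j (C_L w) = col j 1%:M) ->
  entire_data Y j (crad K) y%:C.
Proof.
move=> y0 yrho g0 kap0 kap1 h0 rth r0 rh.
move=> [F_D [F_U [H_D [H_U [k_L [k_R [ms [_ _] scD scU glue]]]]]]] Cj.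
have wK := csector_wpos y0 yrho g0; set w := wpos y in wK.
have [l_D [l_U [lbD _ lbU _ FE]]] := ms; have [FD FU] := FE _ wK.
have q0 : (rt y)%:C != 0 :> R[i] by rewrite -cabs_gt0 cabsR gtr0_norm ?rt_gt0.
have pD := sectorial_piece j y0 wK (fun t => @Gamma_D_wpos R K y y0 kap0 kap1 rth t)
  (fun t => @Gamma_D_intro R K y y0 t) lbD FD scD.
have pU := sectorial_piece j y0 wK (fun t => @Gamma_U_wpos R K y y0 kap0 kap1 rth t)
  (fun t => @Gamma_U_intro R K y y0 t) lbU FU scU.
apply: (pieces_entire_data r0 q0 pD pU) => [x xr xq|x xr Dx Ux i].
  exact: strips_cover.
have [uHF _ _] := sc_fundamental scD wK Dx.
move: uHF; rewrite unitmx_mul => /andP[uH uF].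
have [t Dt xE] := Dx.
have [f Ff] : exists f, F_D w x = diag_mx f.
  by rewrite -xE FD //; eexists.
have [_ _ gR gL gC] := glue _ wK; have [cR cL] := Cj _ wK.
have [Lx|Rx|Cx] := overlap y0 kap0 kap1 rth r0 rh xr Dx Ux.
- exact: unipotent_col uH uF Ff (gL _ Lx) cL i.
- exact: unipotent_col uH uF Ff (gR _ Rx) cR i.
apply: (unipotent_col uH uF Ff (C := 1%:M)) => //.
by rewrite gC // mulmx1 mulmxV.
Qed.

Theorem theorem4p59 (R : realType) (n : nat) (hn : (2 <= n)%N) (j : 'I_n)
    (Y : ode_family R n) (hY : prenormal Y)
    (g : R) (hg0 : 0 < g) (hg : g * (1 + 2 * g / pi) < theta0 Y) :
  exists2 r0 : R, 0 < r0 & forall r d : R, 0 < r < r0 ->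
    0 < d < pi / 2 -> sectors_avoid_rays Y r d ->
  exists2 s0 : R, 0 < s0 & forall c0 h kap : R,
    0 < c0 < s0 -> 0 < h < s0 -> h < r^-1 ->
    0 < kap < s0 -> kap < 2^-1 ->
  exists2 rho0 : R, 0 < rho0 & forall rho : R, 0 < rho < rho0 ->
    let K := Constants g r d c0 h kap rho in
    sector_gap Y K ->
    forall C_R C_L : R[i] -> 'M[R[i]]_n,
    unfolded_stokes Y K C_R C_L ->
    (forall w, csector K w ->
       col j (C_R w) = col j 1%:M /\ col j (C_L w) = col j 1%:M) ->
    exists Z : ode_family R n,
      [/\ prenormal Z, analytically_equivalent Y Z
        & \forall p \near ((0, 0) : R[i] * R[i]),
            forall i : 'I_n, i != j -> sysmx Z p.1 p.2 i j = 0].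
Proof.
exists 1 => // r d /andP[r0 _] _ _; exists 1 => // c0 h kap _ /andP[h0 _] hr /andP[kap0 _] kap1.
have rh1 : r ^+ 2 * h ^+ 2 < 1.
  by rewrite -exprMn expr_lt1 ?mulr_ge0 ?(ltW r0) ?(ltW h0) // mulrC -ltr_pdivlMr // mul1r.
have h2 : 0 < h ^+ 2 by rewrite exprn_gt0.
(* For 0 < y < a one has (r^2 + y) h^2 < 1, where a > 0 because r h < 1; for 0 < y < b one has
   sqrt(y) h < 1 <= pi / 2. These are the two smallness conditions on eps in the geometry of the
   domains. *)
pose b := (h ^+ 2)^-1; pose a := (1 - r ^+ 2 * h ^+ 2) * b; pose rho0 := Num.min a b.
exists rho0; first by rewrite lt_min mulr_gt0 ?subr_gt0 ?invr_gt0.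
move=> rho /andP[rho_gt0 rho_lt] K _ C_R C_L us Cj.
have [y0|u [s [ua u1 s0 uo]]] := analytic_solution (j := j) hY r0 rho_gt0; last first.
  exact: invariant_subsystem ua u1 s0 uo.
move=> /andP[yp yrho].
move: rho_lt; rewrite lt_min => /andP[]; rewrite ltr_pdivlMr // => b1 b2.
have p0 := pi_ge2 R.
apply: (unfolded_stokes_entire_data (K := K) yp yrho hg0 kap0 kap1 h0 _ r0 _ us Cj) => /=.
  have : rt y0 * h < 1.
    rewrite -(expr_lt1 (n := 2)) ?mulr_ge0 ?sqrtr_ge0 ?(ltW h0) // exprMn rt_sqr //.
    by rewrite -ltr_pdivlMr // mul1r (lt_trans yrho).
  by move: p0; lra.
have : y0 * h ^+ 2 < rho * h ^+ 2 by rewrite ltr_pM2r.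
by rewrite mulrDl; move: b1; lra.
Qed.
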